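(* Let $N\ge 1$, $M\ge 0$ be integers, let $\lambda,\widetilde\lambda,\mu,\widetilde\mu$ be partitions with $\lambda'_1+\widetilde\lambda'_1\le N+M$, $\mu'_1+\widetilde\mu'_1\le M$, and $\lambda_i\ge\mu_i$, $\widetilde\lambda_i\ge\widetilde\mu_i$ for all $i$, and let $\Omega,\widetilde\Omega$ be standard tableaux of skew shapes $\lambda/\mu$ and $\widetilde\lambda/\widetilde\mu$ respectively. Then the operator $F_{\Omega\widetilde\Omega}P_{n+\widetilde n}:W_n\otimes W^*_{\widetilde n}\to W^*_{\widetilde n}\otimes W_n$ is an intertwining operator of $\mathrm Y(\mathfrak{gl}_N)$-modules $$V(c_n(\Omega))\otimes\cdots\otimes V(c_1(\Omega))\otimes V(-c_1(\widetilde\Omega)-M)^*\otimes\cdots\otimes V(-c_{\widetilde n}(\widetilde\Omega)-M)^*$$ $$\longrightarrow\quad V(-c_{\widetilde n}(\widetilde\Omega)-M)^*\otimes\cdots\otimes V(-c_1(\widetilde\Omega)-M)^*\otimes V(c_1(\Omega))\otimes\cdots\otimes V(c_n(\Omega)).$$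
   Context: Partitions. A partition is a weakly decreasing sequence $\nu=(\nu_1,\nu_2,\ldots)$ of nonnegative integers with finitely many nonzero terms; $\nu'$ is the conjugate partition, so $\nu'_1$ is the number of nonzero parts. Put $n=\sum_i(\lambda_i-\mu_i)$, $\widetilde n=\sum_i(\widetilde\lambda_i-\widetilde\mu_i)$. Tableaux. $\lambda/\mu=\{(i,j)\in\mathbb Z^2: i\ge1,\ \lambda_i\ge j>\mu_i\}$. A standard tableau of shape $\lambda/\mu$ is a bijection $\Omega:\lambda/\mu\to\{1,\ldots,n\}$ with $\Omega(i,j)<\Omega(i+1,j)$ and $\Omega(i,j)<\Omega(i,j+1)$ whenever defined. The content is $c_k(\Omega)=j-i$ if $k=\Omega(i,j)$. Elements $f_\Omega$. Take complex variables $t_1,\ldots,t_n$ constrained by $t_k=t_l$ whenever $k,l$ occur in the same column of $\Omega$. The product over pairs $1\le k<l\le n$ in lexicographic order (from left to right) of the factors $1-\dfrac{(k\,l)}{c_k(\Omega)-c_l(\Omega)+t_k-t_l}\in\mathbb CS_n$ is a rational function of the constrained variables, known to be regular at $t_1=\cdots=t_n$; its value there is $f_\Omega\in\mathbb CS_n$. Similarly $f_{\widetilde\Omega}\in\mathbb CS_{\widetilde n}$. Operators. $W_n=(\mathbb C^N)^{\otimes n}$, $W^*_{\widetilde n}=((\mathbb C^N)^* )^{\otimes\widetilde n}$, $W_{n\widetilde n}=W^*_{\widetilde n}\otimes W_n$; its tensor factors are numbered $1,\ldots,\widetilde n+n$ from left to right. $F_\Omega$ is the operator on $W_n$, and $F_{\widetilde\Omega}$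 the operator on $W^*_{\widetilde n}$, by which $f_\Omega$, $f_{\widetilde\Omega}$ act under permutation of tensor factors. $P_{\widetilde n}$ is the operator on $W^*_{\widetilde n}$ reversing the order of the tensor factors, and $P_{n+\widetilde n}:W_n\otimes W^*_{\widetilde n}\to W^*_{\widetilde n}\otimes W_n$ is the operator reversing the order of all $n+\widetilde n$ tensor factors. For $l\le\widetilde n<j$, $Q_{lj}$ acts on $W_{n\widetilde n}$ in the $l$th and $j$th factors as $u\otimes v\mapsto\langle u,v\rangle\sum_{a=1}^N v_a^*\otimes v_a$ (dual bases) and as the identity in the other factors. Put $$G_{\Omega\widetilde\Omega}=\prod_{k=1,\ldots,n}^{\longrightarrow}\Bigl(\prod_{l=1,\ldots,\widetilde n}^{\longrightarrow}\Bigl(1-\frac{Q_{\widetilde n-l+1,\,\widetilde n+k}}{c_k(\Omega)+c_l(\widetilde\Omega)+N+M}\Bigr)\Bigr)$$ (factors arranged from left to right with increasing index; denominators are nonzero) and $F_{\Omega\widetilde\Omega}=G_{\Omega\widetilde\Omega}\cdot\bigl((P_{\widetilde n}F_{\widetilde\Omega}P_{\widetilde n})\otimes F_\Omega\bigr)$ on $W_{n\widetilde n}$. Yangian. $\mathrm Y(\mathfrak{gl}_N)$ is the unital associative algebra with generators $T^{(i)}_{ab}$ ($i\ge1$, $1\le a,b\le N$); with $T_{ab}(x)=\delta_{ab}+\sum_{i\ge1}T^{(i)}_{ab}x^{-i}$ the relations are $(x-y)[T_{ab}(x),T_{cd}(y)]=T_{cb}(x)T_{ad}(y)-T_{cb}(y)T_{ad}(x)$.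 Coproduct: $\Delta(T_{ab}(x))=\sum_c T_{ac}(x)\otimes T_{cb}(x)$. With $T(x)=\sum_{a,b}E_{ab}\otimes T_{ab}(x)$, the antipode $\mathrm S$ is given by $T(x)\mapsto T(x)^{-1}$. The evaluation module $V(z)$, $z\in\mathbb C$, is $\mathbb C^N$ with $T_{ab}(x)$ acting as $\delta_{ab}-E_{ba}(x-z)^{-1}$ (expanded in $x^{-1}$); $V(z)^*$ is its dual on $(\mathbb C^N)^*$, defined by means of $\mathrm S$. *)

(* Defs.v *)
From HB Require Import structures.
From mathcomp Require Import all_boot all_order all_fingroup all_algebra.
From mathcomp Require Import generic_quotient fraction boolp mpoly.

Set Implicit Arguments.
Unset Strict Implicit.
Unset Printing Implicit Defensive.

Import GRing.Theory.
Local Open Scope ring_scope.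

(* The power series in one central variable over a possibly noncommutative
   ring; they only serve to prove the Yangian relations below. *)
Definition series (A : Type) : Type := nat -> A.

HB.instance Definition _ (A : Type) := gen_eqMixin (series A).
HB.instance Definition _ (A : Type) := gen_choiceMixin (series A).

Section SeriesZmod.
Variable A : zmodType.
Implicit Types F G H : series A.

Let add F G : series A := fun n => F n + G n.
Let addA : associative add.
Proof. by move=> F G H; apply/funext => n; rewrite /add addrA. Qed.
Let addC : commutative add.
Proof. by move=> F G; apply/funext => n; rewrite /add addrC. Qed.
Let add0 : left_id (fun=> 0 : A) add.
Proof. by move=> F; apply/funext => n; rewrite /add add0r. Qed.
Let addN : left_inverse (fun=> 0 : A) (fun F n => - F n) add.
Proof. by move=> F; apply/funext => n; rewrite /add addNr. Qed.

HB.instance Definition _ :=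
  GRing.isZmodule.Build (series A) addA addC add0 addN.

Lemma seriesD F G n : (F + G) n = F n + G n. Proof. by []. Qed.
Lemma seriesN F n : (- F) n = - F n. Proof. by []. Qed.
Lemma series0 n : (0 : series A) n = 0. Proof. by []. Qed.
Lemma series_sum I (r : seq I) (P : pred I) (F : I -> series A) n :
  (\sum_(i <- r | P i) F i) n = \sum_(i <- r | P i) F i n.
Proof. by elim/big_rec2: _ => // i x y _ <-. Qed.

End SeriesZmod.

Section SeriesRing.
Variable A : pzRingType.
Implicit Types F G H : series A.

Definition smul F G : series A := fun n => \sum_(i < n.+1) F i * G (n - i)%N.
Definition scst (x : A) : series A := fun n => if n is 0 then x else 0.

Lemma smul_rev F G n : smul F G n = \sum_(i < n.+1) F (n - i)%N * G i.
Proof.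
rewrite /smul (reindex_inj rev_ord_inj) /=.
by apply: eq_bigr => i _; rewrite subSS subKn // -ltnS.
Qed.

Let smulA : associative smul.
Proof.
move=> p q r; apply/funext=> i; rewrite [RHS]smul_rev.
pose coef3 j k := p j * (q (i - j - k)%N * r k).
transitivity (\sum_(j < i.+1) \sum_(k < i.+1 | (k <= i - j)%N) coef3 j k).
  apply: eq_bigr => /= j _; rewrite smul_rev big_distrr /=.
  by rewrite (big_ord_narrow_leq (leq_subr _ _)).
rewrite (exchange_big_dep predT) //=; apply: eq_bigr => k _.
transitivity (\sum_(j < i.+1 | (j <= i - k)%N) coef3 j k).
  apply: eq_bigl => j; rewrite -ltnS -(ltnS j) -!subSn ?leq_ord //.
  by rewrite -subn_gt0 -(subn_gt0 j) -!subnDA addnC.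
rewrite (big_ord_narrow_leq (leq_subr _ _)) big_distrl /=.
by apply: eq_bigr => j _; rewrite /coef3 -!subnDA addnC mulrA.
Qed.

Lemma smul_cst x F n : smul (scst x) F n = x * F n.
Proof.
rewrite /smul big_ord_recl subn0 big1 ?addr0 // => i _.
by rewrite /= mul0r.
Qed.

Lemma smul_cstr x F n : smul F (scst x) n = F n * x.
Proof.
rewrite smul_rev big_ord_recl subn0 big1 ?addr0 // => i _.
by rewrite /= mulr0.
Qed.

Let smul1s : left_id (scst 1) smul.
Proof. by move=> F; apply/funext=> n; rewrite smul_cst mul1r. Qed.
Let smuls1 : right_id (scst 1) smul.
Proof. by move=> F; apply/funext=> n; rewrite smul_cstr mulr1. Qed.
Let smulDl : left_distributive smul +%R.
Proof.
move=> F G H; apply/funext=> n; rewrite seriesD /smul -big_split /=.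
by apply: eq_bigr => i _; rewrite mulrDl.
Qed.
Let smulDr : right_distributive smul +%R.
Proof.
move=> F G H; apply/funext=> n; rewrite seriesD /smul -big_split /=.
by apply: eq_bigr => i _; rewrite mulrDr.
Qed.

HB.instance Definition _ := GRing.Zmodule_isPzRing.Build (series A)
  smulA smul1s smuls1 smulDl smulDr.

Lemma seriesM F G n : (F * G) n = \sum_(i < n.+1) F i * G (n - i)%N.
Proof. by []. Qed.
Lemma series1 : (1 : series A) = scst 1. Proof. by []. Qed.

Lemma cstM x F n : (scst x * F) n = x * F n. Proof. exact: smul_cst. Qed.
Lemma Mcst x F n : (F * scst x) n = F n * x. Proof. exact: smul_cstr. Qed.

Lemma scstD x y : scst (x + y) = scst x + scst y.
Proof. by apply/funext => -[|n]; rewrite seriesD //= addr0. Qed.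
Lemma scst0 : scst 0 = 0.
Proof. by apply/funext => -[|n]. Qed.
Lemma scstM x y : scst (x * y) = scst x * scst y.
Proof. by apply/funext => n; rewrite cstM; case: n => //=; rewrite mulr0. Qed.
Lemma scst_sum I (r : seq I) (P : pred I) (F : I -> A) :
  scst (\sum_(i <- r | P i) F i) = \sum_(i <- r | P i) scst (F i).
Proof. exact: (big_morph scst scstD scst0). Qed.

Definition sX : series A := fun n => (n == 1%N)%:R.
Definition sshift F : series A := fun n => if n is n'.+1 then F n' else 0.

Lemma XM F : sX * F = sshift F.
Proof.
apply/funext => -[|n]; rewrite seriesM /sX.
  by rewrite big_ord1 mul0r.
rewrite big_ord_recl mul0r add0r big_ord_recl /= mul1r subSS subn0.
by rewrite big1 ?addr0 // => i _; rewrite mul0r.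
Qed.

Lemma MX F : F * sX = sshift F.
Proof.
apply/funext => -[|n].
  by rewrite seriesM big_ord1 /sX mulr0.
transitivity (smul F sX n.+1) => //; rewrite smul_rev /sX.
rewrite big_ord_recl mulr0 add0r big_ord_recl /= mulr1 subSS subn0.
by rewrite big1 ?addr0 // => i _; rewrite mulr0.
Qed.

End SeriesRing.

Section RTT.
Variables (D : pzRingType) (N : nat) (p q : D).
Hypotheses (pC : forall x, p * x = x * p) (qC : forall x, q * x = x * q).
Implicit Types X Y U V : 'M[D]_N.

Definition rtt X Y := forall a b c d,
  p * (X a b * Y c d - Y c d * X a b) = q * (X c b * Y a d - Y c b * X a d).

Let pCA x y : p * (x * y) = x * (p * y).
Proof. by rewrite !mulrA pC. Qed.
Let qCA x y : q * (x * y) = x * (q * y).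
Proof. by rewrite !mulrA qC. Qed.

Lemma rtt_mul X Y U V :
  (forall a b c d, U a b * Y c d = Y c d * U a b) ->
  (forall a b c d, V a b * X c d = X c d * V a b) ->
  rtt X Y -> rtt U V -> rtt (X *m U) (Y *m V).
Proof.
move=> UY VX hX hU a b c d; rewrite !mxE.
have dist (F G H K : 'I_N -> D) :
   (\sum_i F i * G i) * (\sum_j H j * K j) =
   \sum_i \sum_j F i * G i * (H j * K j).
  by rewrite big_distrl /=; apply: eq_bigr => i _; rewrite big_distrr.
rewrite !dist.
transitivity (\sum_i \sum_j p *
   ((X a i * Y c j - Y c j * X a i) * (U i b * V j d)
    + Y c j * X a i * (U i b * V j d - V j d * U i b))).
  rewrite [X in _ - X]exchange_big /= -sumrB mulr_sumr.
  apply: eq_bigr => i _; rewrite -sumrB mulr_sumr; apply: eq_bigr => j _.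
  congr (p * _); rewrite mulrBl mulrBr addrA subrK; congr (_ - _).
    by rewrite -!mulrA; congr (_ * _); rewrite !mulrA UY.
  by rewrite -!mulrA; congr (_ * _); rewrite !mulrA VX.
transitivity (\sum_i \sum_j q *
   ((X c i * Y a j - Y c i * X a j) * (U i b * V j d)
    + Y c j * X a i * (U j b * V i d - V j b * U i d))).
  apply: eq_bigr => i _; apply: eq_bigr => j _.
  by rewrite [in LHS]mulrDr mulrA hX pCA hU -qCA -mulrA -mulrDr.
under eq_bigr => i _ do rewrite -mulr_sumr.
rewrite -mulr_sumr; congr (q * _).
under eq_bigr => i _ do under eq_bigr => j _ do rewrite mulrBl mulrBr.
under eq_bigr => i _ do rewrite big_split /= !sumrB.
rewrite big_split /= !sumrB [X in (_ - X) + _]exchange_big /=.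
have -> : \sum_j \sum_i Y c i * X a j * (U i b * V j d)
        = \sum_j \sum_i Y c i * X a j * (U i b * V j d) by [].
rewrite addrA subrK; congr (_ - _).
  apply: eq_bigr => i _; apply: eq_bigr => j _.
  by rewrite -!mulrA; congr (_ * _); rewrite !mulrA UY.
rewrite exchange_big /=.
apply: eq_bigr => i _; apply: eq_bigr => j _.
by rewrite -!mulrA; congr (_ * _); rewrite !mulrA VX.
Qed.

Lemma comm_inv x Y Y' a b : Y *m Y' = 1%:M -> Y' *m Y = 1%:M ->
  x * Y' a b - Y' a b * x =
  - \sum_e \sum_f Y' a e * (x * Y e f - Y e f * x) * Y' f b.
Proof.
have sum_dl (i : 'I_N) (F : 'I_N -> D) : \sum_e (i == e)%:R * F e = F i.
  rewrite (bigD1 i) //= eqxx mul1r big1 ?addr0 // => e.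
  by rewrite eq_sym => /negbTE ->; rewrite mul0r.
have sum_dr (i : 'I_N) (F : 'I_N -> D) : \sum_e F e * (e == i)%:R = F i.
  rewrite (bigD1 i) //= eqxx mulr1 big1 ?addr0 // => e.
  by move => /negbTE ->; rewrite mulr0.
have one (Z Z' : 'M[D]_N) i j : Z *m Z' = 1%:M ->
    \sum_e Z i e * Z' e j = (i == j)%:R.
  by move/matrixP/(_ i j); rewrite !mxE.
move=> YY' Y'Y.
under eq_bigr => e _ do under eq_bigr => f _ do
  rewrite mulrBr mulrBl.
under eq_bigr => e _ do rewrite sumrB.
rewrite sumrB opprB; congr (_ - _).
  rewrite exchange_big /= -(sum_dl a (fun f => x * Y' f b)).
  apply: eq_bigr => f _; rewrite -(one _ _ _ _ Y'Y) mulr_suml.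
  by apply: eq_bigr => e _; rewrite !mulrA.
rewrite -(sum_dr b (fun e => Y' a e * x)).
apply: eq_bigr => e _; rewrite -(one _ _ _ _ YY') mulr_sumr.
by apply: eq_bigr => f _; rewrite !mulrA.
Qed.

Lemma rtt_inv X Y X' Y' :
  X *m X' = 1%:M -> X' *m X = 1%:M -> Y *m Y' = 1%:M -> Y' *m Y = 1%:M ->
  rtt X Y -> forall a b c d,
  p * (X' a b * Y' c d - Y' c d * X' a b)
    = q * (X' a d * Y' c b - Y' a d * X' c b).
Proof.
move=> XX' X'X YY' Y'Y h.
have sum_dl (i : 'I_N) (F : 'I_N -> D) : \sum_e (i == e)%:R * F e = F i.
  rewrite (bigD1 i) //= eqxx mul1r big1 ?addr0 // => e.
  by rewrite eq_sym => /negbTE ->; rewrite mul0r.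
have sum_dr (i : 'I_N) (F : 'I_N -> D) : \sum_e F e * (e == i)%:R = F i.
  rewrite (bigD1 i) //= eqxx mulr1 big1 ?addr0 // => e.
  by move => /negbTE ->; rewrite mulr0.
have one (Z Z' : 'M[D]_N) i j : Z *m Z' = 1%:M ->
    \sum_e Z i e * Z' e j = (i == j)%:R.
  by move/matrixP/(_ i j); rewrite !mxE.
have h1 a b c d : p * (X a b * Y' c d - Y' c d * X a b) =
   q * ((c == b)%:R * \sum_f X a f * Y' f d
        - (\sum_e Y' c e * X e b) * (a == d)%:R).
  rewrite (comm_inv (X a b) c d YY' Y'Y) [LHS]mulrN [in LHS]mulr_sumr.
  transitivity (- \sum_e \sum_f q *
      (Y' c e * (X e b * Y a f - Y e b * X a f) * Y' f d)).
    congr (- _); apply: eq_bigr => e _; rewrite mulr_sumr.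
    by apply: eq_bigr => f _; rewrite mulrA pCA h -!mulrA [RHS]qCA.
  under eq_bigr => e _ do rewrite -mulr_sumr.
  rewrite -mulr_sumr -mulrN; congr (q * _).
  under eq_bigr => e _ do under eq_bigr => f _ do
    rewrite mulrBr mulrBl.
  under eq_bigr => e _ do rewrite sumrB.
  rewrite sumrB opprB; congr (_ - _).
    rewrite exchange_big mulr_sumr /=; apply: eq_bigr => f _.
    rewrite -(one _ _ _ _ Y'Y) mulr_suml.
    by apply: eq_bigr => e _; rewrite !mulrA.
  rewrite mulr_suml; apply: eq_bigr => e _.
  rewrite -(one _ _ _ _ YY') mulr_sumr.
  by apply: eq_bigr => f _; rewrite !mulrA.
move=> a b c d.
rewrite -opprB mulrN (comm_inv (Y' c d) a b XX' X'X) [in LHS]mulrN opprK [LHS]mulr_sumr.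
transitivity (\sum_e \sum_f q * (X' a e *
    ((\sum_g Y' c g * X g f) * (e == d)%:R
     - (c == f)%:R * \sum_g X e g * Y' g d) * X' f b)).
  apply: eq_bigr => e _; rewrite mulr_sumr; apply: eq_bigr => f _.
  by rewrite mulrA pCA -opprB mulrN h1 -mulrN opprB -!mulrA [RHS]qCA.
under eq_bigr => e _ do rewrite -mulr_sumr.
rewrite -mulr_sumr; congr (q * _).
under eq_bigr => e _ do under eq_bigr => f _ do
  rewrite mulrBr mulrBl.
under eq_bigr => e _ do rewrite sumrB.
rewrite sumrB; congr (_ - _).
  rewrite -(sum_dr d (fun e => X' a e * Y' c b)); apply: eq_bigr => e _.
  rewrite -(sum_dr b (fun g => Y' c g)) mulr_sumr mulr_suml.
  transitivity (\sum_f \sum_g X' a e * Y' c g * (e == d)%:R * (X g f * X' f b)).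
    apply: eq_bigr => f _; rewrite mulrA mulr_sumr !mulr_suml.
    apply: eq_bigr => g _.
    by case: (e == d); rewrite ?(mulr1, mulr0, mul0r) // !mulrA.
  rewrite exchange_big /=; apply: eq_bigr => g _.
  rewrite -mulr_sumr (one _ _ _ _ XX').
  by case: (e == d); rewrite ?(mulr1, mulr0, mul0r) // !mulrA.
transitivity (\sum_e X' a e * (\sum_g X e g * Y' g d) * X' c b).
  apply: eq_bigr => e _.
  rewrite -(sum_dl c (fun f => X' a e * (\sum_g X e g * Y' g d) * X' f b)).
  apply: eq_bigr => f _.
  by case: (c == f); rewrite ?(mul1r, mulr0, mul0r).
rewrite -mulr_suml; congr (_ * _).
rewrite -(sum_dl a (fun g => Y' g d)).
transitivity (\sum_e \sum_g X' a e * X e g * Y' g d).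
  apply: eq_bigr => e _; rewrite mulr_sumr.
  by apply: eq_bigr => g _; rewrite mulrA.
rewrite exchange_big /=; apply: eq_bigr => g _.
by rewrite -mulr_suml (one _ _ _ _ X'X).
Qed.
End RTT.

Section YangianRelations.
Variables (A : pzRingType) (N : nat).
Implicit Types t u : nat -> 'I_N -> 'I_N -> A.

(* t r a b stands for the coefficient of T_ab(x) at x^-r, so that t 0 is the
   identity matrix.  The second clause is the coefficient at x^-r y^-s of
     (x - y) [T_ab(x), T_cd(y)] = T_cb(x) T_ad(y) - T_cb(y) T_ad(x);
   the coefficients at x y^-s and x^-r y vanish on both sides. *)
Definition yangian_rel t : Prop :=
  (forall a b, t 0 a b = (a == b)%:R) /\
  forall r s a b c d,
    (t r.+1 a b * t s c d - t s c d * t r.+1 a b)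
    - (t r a b * t s.+1 c d - t s.+1 c d * t r a b)
    = t r c b * t s a d - t s c b * t r a d.

(* The coefficients of the product of the matrices of series t(x) and u(x). *)
Definition gen_mul t u : nat -> 'I_N -> 'I_N -> A :=
  fun r a b => \sum_c \sum_(i < r.+1) t i a c * u (r - i)%N c b.

(* gen_inv t gives the coefficients of the inverse of the matrix of series
   t(x) = 1 + O(x^-1), see gen_inv_r and gen_inv_l; the recursion is gen_invS,
   and the fuel k only has to be at least r. *)
Fixpoint gen_inv_fuel k t r a b : A :=
  match k, r with
  | k'.+1, r'.+1 =>
      - \sum_c \sum_(i < r'.+1) t i.+1 a c * gen_inv_fuel k' t (r' - i)%N c b
  | _, _ => (a == b)%:R
  end.

Definition gen_inv t r a b := gen_inv_fuel r t r a b.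

Lemma gen_inv_fuelE k t r a b : (r <= k)%N ->
  gen_inv_fuel k t r a b = gen_inv t r a b.
Proof.
rewrite /gen_inv; elim: r {-2}r (leqnn r) k a b => [|m IH] r rm k a b rk.
  by move: rm rk; rewrite leqn0 => /eqP -> _; case: k.
case: r rm rk => [|r] rm; first by case: k.
case: k => // k rk /=; congr (- _); apply: eq_bigr => c _.
apply: eq_bigr => i _; congr (_ * _).
have ir : (r - i <= r)%N by exact: leq_subr.
by rewrite [RHS](IH _ _ r) ?(IH _ _ k) //; apply: leq_trans ir _.
Qed.

Lemma gen_inv0 t a b : gen_inv t 0 a b = (a == b)%:R.
Proof. by []. Qed.

Lemma gen_invS t r a b : gen_inv t r.+1 a b =
  - \sum_c \sum_(i < r.+1) t i.+1 a c * gen_inv t (r - i)%N c b.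
Proof.
rewrite {1}/gen_inv /=; congr (- _); apply: eq_bigr => c _.
by apply: eq_bigr => i _; rewrite gen_inv_fuelE // leq_subr.
Qed.

Let mxs t : 'M[series A]_N := \matrix_(a, b) ((fun r => t r a b) : series A).

Lemma mxs_mul t u : mxs t *m mxs u = mxs (gen_mul t u).
Proof.
apply/matrixP => a b; rewrite !mxE; apply/funext => r.
by rewrite series_sum; apply: eq_bigr => c _; rewrite !mxE.
Qed.

Lemma mxs_one (f : nat -> 'I_N -> 'I_N -> A) :
  (forall r a b, f r a b = ((r == 0%N) && (a == b))%:R) -> mxs f = 1%:M.
Proof.
move=> fE; apply/matrixP => a b; rewrite !mxE; apply/funext => r.
by rewrite fE; case: (a == b); case: r => [|r].
Qed.

Let unipotent t := forall a b, t 0 a b = (a == b)%:R.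

Lemma gen_inv_r t : unipotent t -> mxs t *m mxs (gen_inv t) = 1%:M.
Proof.
move=> t0; rewrite mxs_mul; apply: mxs_one => -[|r] a b; rewrite /gen_mul.
  transitivity (\sum_c (a == c)%:R * (c == b)%:R : A).
    by apply: eq_bigr => c _; rewrite big_ord1 t0.
  rewrite (bigD1 a) //= eqxx mul1r big1 ?addr0 // => e.
  by rewrite eq_sym => /negbTE ->; rewrite mul0r.
transitivity (\sum_c ((a == c)%:R * gen_inv t r.+1 c b
   + \sum_(i < r.+1) t i.+1 a c * gen_inv t (r - i)%N c b)).
  by apply: eq_bigr => c _; rewrite big_ord_recl t0 subn0.
rewrite big_split /= (bigD1 a) //= eqxx mul1r big1 => [|c]; last first.
  by rewrite eq_sym => /negbTE ->; rewrite mul0r.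
by rewrite addr0 gen_invS addNr.
Qed.

Lemma gen_inv_l t : unipotent t -> mxs (gen_inv t) *m mxs t = 1%:M.
Proof.
move=> t0; have h := gen_inv_r t0.
have h' := @gen_inv_r (gen_inv t) (gen_inv0 t).
suff -> : mxs t = mxs (gen_inv (gen_inv t)) by [].
by rewrite -[LHS]mulmx1 -h' mulmxA h mul1mx.
Qed.

Let D := series (series A).
Let ex (F : series A) : D := fun i => scst (F i).
Let ey (G : series A) : D := scst G.
Let p : D := ey (sX A) - sX (series A).
Let q : D := sX (series A) * ey (sX A).

Let exM F G : ex (F * G) = ex F * ex G.
Proof.
apply/funext => i; rewrite seriesM /ex seriesM scst_sum.
by apply: eq_bigr => j _; rewrite scstM.
Qed.

Let ex_sum I (r : seq I) (P : pred I) (F : I -> series A) :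
  ex (\sum_(i <- r | P i) F i) = \sum_(i <- r | P i) ex (F i).
Proof. by apply/funext => n; rewrite /ex !series_sum scst_sum. Qed.

Let exey F G i j : (ex F * ey G) i j = F i * G j.
Proof. by rewrite Mcst cstM. Qed.
Let eyex F G i j : (ey G * ex F) i j = G j * F i.
Proof. by rewrite cstM Mcst. Qed.

Let sXC (F : D) : sX (series A) * F = F * sX (series A).
Proof. by rewrite XM MX. Qed.
Let eyXC (F : D) : ey (sX A) * F = F * ey (sX A).
Proof. by apply/funext => i; rewrite cstM Mcst XM MX. Qed.

Let pC x : p * x = x * p.
Proof. by rewrite mulrBl mulrBr eyXC sXC. Qed.
Let qC x : q * x = x * q.
Proof. by rewrite -mulrA eyXC mulrA sXC mulrA. Qed.

Let exm t : 'M[D]_N := map_mx ex (mxs t).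
Let eym t : 'M[D]_N := map_mx ey (mxs t).

Let exm_mul t u : exm t *m exm u = exm (gen_mul t u).
Proof.
rewrite /exm -mxs_mul; apply/matrixP => a b; rewrite !mxE ex_sum.
by apply: eq_bigr => c _; rewrite !mxE exM.
Qed.
Let eym_mul t u : eym t *m eym u = eym (gen_mul t u).
Proof.
rewrite /eym -mxs_mul; apply/matrixP => a b; rewrite !mxE /ey scst_sum.
by apply: eq_bigr => c _; rewrite !mxE scstM.
Qed.
Let exm_one t : mxs t = 1%:M -> exm t = 1%:M.
Proof.
rewrite /exm => ->; apply/matrixP => a b; rewrite !mxE.
by case: (a == b); apply/funext => -[|i] //=; rewrite /ex /= scst0.
Qed.
Let eym_one t : mxs t = 1%:M -> eym t = 1%:M.
Proof.
rewrite /eym => ->; apply/matrixP => a b; rewrite !mxE.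
by case: (a == b); apply/funext => -[|i] //=; rewrite /ey /= scst0.
Qed.

Let pE (K : D) i j : (p * K) i j = sshift (K i) j - sshift K i j.
Proof. by rewrite mulrBl seriesD seriesD !seriesN cstM !XM. Qed.
Let qE (K : D) i j : (q * K) i j = sshift (fun i => sshift (K i)) i j.
Proof. by rewrite -mulrA XM; case: i => [|i] //=; rewrite cstM XM. Qed.

Let commE t u a b c d i j :
  (exm t a b * eym u c d - eym u c d * exm t a b) i j =
  t i a b * u j c d - u j c d * t i a b.
Proof. by rewrite !seriesD !seriesN !mxE exey eyex. Qed.

Lemma rtt_rel t : unipotent t ->
  rtt p q (exm t) (eym t) <-> yangian_rel t.
Proof.
move=> t0; split=> [h|[_ h]].
  split=> // r s a b c d.
  have := h a b c d; move/(congr1 (fun F : D => F r.+1 s.+1)).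
  rewrite pE qE /= !commE.
  by rewrite seriesD seriesN seriesD seriesN !mxE exey eyex => <-.
move=> a b c d; apply/funext => i; apply/funext => j.
have t0C x k l : t 0 k l * x - x * t 0 k l = 0.
  by rewrite t0; case: (k == l); rewrite ?(mul1r, mulr1, mul0r, mulr0) subrr.
have t0C' x k l : x * t 0 k l - t 0 k l * x = 0.
  by rewrite -opprB t0C oppr0.
rewrite pE qE; case: i => [|i]; case: j => [|j] /=.
- by rewrite !series0 subrr.
- by rewrite commE t0C subr0.
- by rewrite commE t0C' subrr.
rewrite !commE h.
by rewrite seriesD seriesN seriesD seriesN !mxE exey eyex.
Qed.

Lemma yangian_rel_mul t u :
  (forall r s a b c d, t r a b * u s c d = u s c d * t r a b) ->
  yangian_rel t -> yangian_rel u -> yangian_rel (gen_mul t u).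
Proof.
move=> tu ht hu; have [t0 u0] : unipotent t /\ unipotent u.
  by case: ht hu => ? _ [].
apply/rtt_rel.
  move=> a b; rewrite /gen_mul.
  transitivity (\sum_c (a == c)%:R * (c == b)%:R : A).
    by apply: eq_bigr => c _; rewrite big_ord1 t0 u0.
  rewrite (bigD1 a) //= eqxx mul1r big1 ?addr0 // => e.
  by rewrite eq_sym => /negbTE ->; rewrite mul0r.
rewrite -exm_mul -eym_mul; apply: rtt_mul => //; try exact/rtt_rel.
- by move=> a b c d; apply/funext=> i; apply/funext=> j; rewrite !mxE exey eyex tu.
- by move=> a b c d; apply/funext=> i; apply/funext=> j; rewrite !mxE exey eyex tu.
Qed.

Lemma yangian_rel_inv t : yangian_rel t ->
  forall r s a b c d,
    (gen_inv t r.+1 a b * gen_inv t s c d - gen_inv t s c d * gen_inv t r.+1 a b)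
    - (gen_inv t r a b * gen_inv t s.+1 c d
       - gen_inv t s.+1 c d * gen_inv t r a b)
    = gen_inv t r a d * gen_inv t s c b - gen_inv t s a d * gen_inv t r c b.
Proof.
move=> ht; have t0 : unipotent t by case: ht.
move=> r s a b c d; set u := gen_inv t.
have inv1 : exm t *m exm u = 1%:M.
  by have := gen_inv_r t0; rewrite mxs_mul exm_mul => /exm_one.
have inv2 : exm u *m exm t = 1%:M.
  by have := gen_inv_l t0; rewrite mxs_mul exm_mul => /exm_one.
have inv3 : eym t *m eym u = 1%:M.
  by have := gen_inv_r t0; rewrite mxs_mul eym_mul => /eym_one.
have inv4 : eym u *m eym t = 1%:M.
  by have := gen_inv_l t0; rewrite mxs_mul eym_mul => /eym_one.
have := rtt_inv pC qC inv1 inv2 inv3 inv4 (iffRL (rtt_rel t0) ht) a b c d.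
move/(congr1 (fun F : D => F r.+1 s.+1)); rewrite pE qE /= !commE => ->.
by rewrite seriesD seriesN seriesD seriesN !mxE exey eyex.
Qed.

Lemma yangian_rel_invc t : yangian_rel t ->
  forall r s a b c d,
    (gen_inv t s c d * gen_inv t r.+1 a b - gen_inv t r.+1 a b * gen_inv t s c d)
    - (gen_inv t s.+1 c d * gen_inv t r a b
       - gen_inv t r a b * gen_inv t s.+1 c d)
    = gen_inv t s a d * gen_inv t r c b - gen_inv t r a d * gen_inv t s c b.
Proof.
move=> ht r s a b c d; have h := yangian_rel_inv ht r s a b c d.
apply: oppr_inj; rewrite [RHS]opprB -h [LHS]opprB [RHS]addrC [in RHS]opprB.
by congr (_ + _); rewrite opprB.
Qed.
End YangianRelations.

Section YangianAlgebra.
Variables (C : fieldType) (N : nat).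
Local Open Scope quotient_scope.

(* The Yangian is the free associative unital algebra on the generators
   modulo its relations: expressions in the generators and scalars, modulo the
   smallest congruence containing the axioms of unital associative C-algebras
   and the relations yangian_rel.  YGen r a b is the generator T^(r+1)_ab, and
   YT r a b is T^(r)_ab with T^(0)_ab = delta_ab. *)
Inductive yterm : Type :=
| YGen (r : nat) (a b : 'I_N)
| YScal (x : C)
| YAdd (u v : yterm)
| YMul (u v : yterm).

HB.instance Definition _ := gen_eqMixin yterm.
HB.instance Definition _ := gen_choiceMixin yterm.

Definition YT r a b : yterm :=
  if r is r'.+1 then YGen r' a b else YScal (a == b)%:R.
Definition YSub u v : yterm := YAdd u (YMul (YScal (-1)) v).

Inductive ycong : yterm -> yterm -> Prop :=
| ycong_refl u : ycong u u
| ycong_sym u v : ycong u v -> ycong v u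
| ycong_trans v u w : ycong u v -> ycong v w -> ycong u w
| ycong_add u u' v v' :
    ycong u u' -> ycong v v' -> ycong (YAdd u v) (YAdd u' v')
| ycong_mul u u' v v' :
    ycong u u' -> ycong v v' -> ycong (YMul u v) (YMul u' v')
| ycong_addA u v w : ycong (YAdd u (YAdd v w)) (YAdd (YAdd u v) w)
| ycong_addC u v : ycong (YAdd u v) (YAdd v u)
| ycong_add0 u : ycong (YAdd (YScal 0) u) u
| ycong_mulA u v w : ycong (YMul u (YMul v w)) (YMul (YMul u v) w)
| ycong_mul1 u : ycong (YMul (YScal 1) u) u
| ycong_mul0 u : ycong (YMul (YScal 0) u) (YScal 0)
| ycong_mulDl u v w : ycong (YMul (YAdd u v) w) (YAdd (YMul u w) (YMul v w))
| ycong_mulDr u v w : ycong (YMul u (YAdd v w)) (YAdd (YMul u v) (YMul u w))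
| ycong_scalD x y : ycong (YScal (x + y)) (YAdd (YScal x) (YScal y))
| ycong_scalM x y : ycong (YScal (x * y)) (YMul (YScal x) (YScal y))
| ycong_scalC x u : ycong (YMul (YScal x) u) (YMul u (YScal x))
| ycong_rel r s a b c d : ycong
    (YSub (YSub (YMul (YT r.+1 a b) (YT s c d)) (YMul (YT s c d) (YT r.+1 a b)))
          (YSub (YMul (YT r a b) (YT s.+1 c d)) (YMul (YT s.+1 c d) (YT r a b))))
    (YSub (YMul (YT r c b) (YT s a d)) (YMul (YT s c b) (YT r a d))).

Section Eval.
Variables (A : pzRingType) (phi : C -> A) (t : nat -> 'I_N -> 'I_N -> A).
Hypotheses (phi1 : phi 1 = 1) (phiD : {morph phi : x y / x + y})
  (phiM : {morph phi : x y / x * y}) (phiC : forall x u, phi x * u = u * phi x)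
  (t_rel : yangian_rel t).

Fixpoint yeval u : A :=
  match u with
  | YGen r a b => t r.+1 a b
  | YScal x => phi x
  | YAdd u v => yeval u + yeval v
  | YMul u v => yeval u * yeval v
  end.

Let phi0 : phi 0 = 0.
Proof. by apply: (addrI (phi 0)); rewrite -phiD !addr0. Qed.
Let phiN1 u : phi (-1) * u = - u.
Proof.
by apply/eqP; rewrite -addr_eq0 -[X in _ + X]mul1r -phi1 -mulrDl -phiD addNr phi0 mul0r.
Qed.

Lemma yeval_T r a b : yeval (YT r a b) = t r a b.
Proof.
case: r => //=; have [-> _] := t_rel.
by case: (a == b); rewrite ?phi1 ?phi0.
Qed.

Lemma yeval_sub u v : yeval (YSub u v) = yeval u - yeval v.
Proof. by rewrite /= phiN1. Qed.

Lemma yeval_cong u v : ycong u v -> yeval u = yeval v.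
Proof.
elim=> {u v} //=.
- by move=> v u w _ -> _ ->.
- by move=> u u' v v' _ -> _ ->.
- by move=> u u' v v' _ -> _ ->.
- by move=> u v w; rewrite addrA.
- by move=> u v; rewrite addrC.
- by move=> u; rewrite phi0 add0r.
- by move=> u v w; rewrite mulrA.
- by move=> u; rewrite phi1 mul1r.
- by move=> u; rewrite phi0 mul0r.
- by move=> u v w; rewrite mulrDl.
- by move=> u v w; rewrite mulrDr.
- move=> r s a b c d; rewrite !phiN1 !yeval_T.
  by have [_ h] := t_rel; exact: h.
Qed.
End Eval.

Definition yeqv u v : bool := `[< ycong u v >].

Lemma yeqv_refl : reflexive yeqv.
Proof. by move=> u; apply/asboolP; exact: ycong_refl. Qed.
Lemma yeqv_sym : ssrbool.symmetric yeqv.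
Proof. by move=> u v; apply/asboolP/asboolP; exact: ycong_sym. Qed.
Lemma yeqv_trans : transitive yeqv.
Proof.
move=> v u w /asboolP uv /asboolP vw; apply/asboolP.
exact: ycong_trans uv vw.
Qed.

Canonical yeqv_equiv := EquivRel yeqv yeqv_refl yeqv_sym yeqv_trans.

Definition yangian : Type := {eq_quot yeqv}.
HB.instance Definition _ := Choice.on yangian.
HB.instance Definition _ := Quotient.on yangian.

Definition ycls (u : yterm) : yangian := \pi_({eq_quot yeqv}) u.

Lemma yclsP u v : ycls u = ycls v <-> ycong u v.
Proof.
split=> [/eqquotP/asboolP //|uv].
by apply/eqquotP/asboolP.
Qed.

Lemma yclsK (q : yangian) : ycls (repr q) = q.
Proof. exact: reprK. Qed.

Lemma ycls_repr u : ycong (repr (ycls u)) u.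
Proof. by apply/yclsP; rewrite yclsK. Qed.

Let Yadd (p q : yangian) := ycls (YAdd (repr p) (repr q)).
Let Ymul (p q : yangian) := ycls (YMul (repr p) (repr q)).
Let Yopp (p : yangian) := ycls (YMul (YScal (-1)) (repr p)).

Let YaddE u v : Yadd (ycls u) (ycls v) = ycls (YAdd u v).
Proof. by apply/yclsP/ycong_add; exact: ycls_repr. Qed.
Let YmulE u v : Ymul (ycls u) (ycls v) = ycls (YMul u v).
Proof. by apply/yclsP/ycong_mul; exact: ycls_repr. Qed.
Let YoppE u : Yopp (ycls u) = ycls (YMul (YScal (-1)) u).
Proof.
by apply/yclsP/ycong_mul; [exact: ycong_refl | exact: ycls_repr].
Qed.

Let YaddA : associative Yadd.
Proof.
move=> p q r; rewrite -(yclsK p) -(yclsK q) -(yclsK r) !YaddE.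
exact/yclsP/ycong_addA.
Qed.
Let YaddC : commutative Yadd.
Proof.
move=> p q; rewrite -(yclsK p) -(yclsK q) !YaddE.
exact/yclsP/ycong_addC.
Qed.
Let Yadd0 : left_id (ycls (YScal 0)) Yadd.
Proof. by move=> p; rewrite -(yclsK p) YaddE; exact/yclsP/ycong_add0. Qed.
Let YaddN : left_inverse (ycls (YScal 0)) Yopp Yadd.
Proof.
move=> p; rewrite -(yclsK p) YoppE YaddE; apply/yclsP.
have h1 := ycong_sym (ycong_mul1 (repr p)).
apply: ycong_trans (ycong_add (ycong_refl _) h1) _.
apply: ycong_trans (ycong_sym (ycong_mulDl _ _ _)) _.
apply: ycong_trans (ycong_mul0 (repr p)).
apply: ycong_mul; last exact: ycong_refl.
by rewrite -(addNr 1); exact/ycong_sym/ycong_scalD.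
Qed.

HB.instance Definition _ := GRing.isZmodule.Build yangian YaddA YaddC Yadd0 YaddN.

Let YmulA : associative Ymul.
Proof.
move=> p q r; rewrite -(yclsK p) -(yclsK q) -(yclsK r) !YmulE.
exact/yclsP/ycong_mulA.
Qed.
Let Ymul1 : left_id (ycls (YScal 1)) Ymul.
Proof. by move=> p; rewrite -(yclsK p) YmulE; exact/yclsP/ycong_mul1. Qed.
Let Ymulr1 : right_id (ycls (YScal 1)) Ymul.
Proof.
move=> p; rewrite -(yclsK p) YmulE; apply/yclsP.
exact: ycong_trans (ycong_sym (ycong_scalC _ _)) (ycong_mul1 _).
Qed.
Let YmulDl : left_distributive Ymul +%R.
Proof.
move=> p q r; rewrite -(yclsK p) -(yclsK q) -(yclsK r).
rewrite [_ + _]YaddE !YmulE [RHS]YaddE.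
exact/yclsP/ycong_mulDl.
Qed.
Let YmulDr : right_distributive Ymul +%R.
Proof.
move=> p q r; rewrite -(yclsK p) -(yclsK q) -(yclsK r).
rewrite [_ + _]YaddE !YmulE [RHS]YaddE.
exact/yclsP/ycong_mulDr.
Qed.

Let triv_rel : yangian_rel (fun r (a b : 'I_N) => ((r == 0%N) && (a == b))%:R : C).
Proof.
split=> // r s a b c d /=; rewrite !mul0r !mulr0 !subrr.
by case: r s => [|r] [|s] /=; rewrite ?mul0r ?mulr0 ?subrr.
Qed.

Let Y1_neq0 : ycls (YScal 1) != ycls (YScal 0).
Proof.
apply/eqP => /yclsP h.
have /= := yeval_cong (phi := id) erefl (fun=> fun=> erefl)
  (fun=> fun=> erefl) (@mulrC C) triv_rel h.
by move/eqP; rewrite oner_eq0.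
Qed.

HB.instance Definition _ := GRing.Zmodule_isNzRing.Build yangian
  YmulA Ymul1 Ymulr1 YmulDl YmulDr Y1_neq0.

Let Yscale x (p : yangian) : yangian := ycls (YScal x) * p.

Let YscalM x y : ycls (YScal (x * y)) = ycls (YScal x) * ycls (YScal y).
Proof. by rewrite [RHS]YmulE; exact/yclsP/ycong_scalM. Qed.
Let YscalD x y : ycls (YScal (x + y)) = ycls (YScal x) + ycls (YScal y).
Proof. by rewrite [RHS]YaddE; exact/yclsP/ycong_scalD. Qed.
Let YscalC x (p : yangian) : ycls (YScal x) * p = p * ycls (YScal x).
Proof.
rewrite -(yclsK p) [LHS]YmulE [RHS]YmulE.
exact/yclsP/ycong_scalC.
Qed.

Let YscaleA x y p : Yscale x (Yscale y p) = Yscale (x * y) p.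
Proof. by rewrite /Yscale mulrA YscalM. Qed.
Let Yscale1 : left_id 1 Yscale.
Proof. exact: mul1r. Qed.
Let YscaleDr : right_distributive Yscale +%R.
Proof. by move=> x p q; exact: mulrDr. Qed.
Let YscaleDl p : {morph Yscale^~ p : x y / x + y}.
Proof. by move=> x y; rewrite /Yscale YscalD mulrDl. Qed.

HB.instance Definition _ := GRing.Zmodule_isLmodule.Build C yangian
  YscaleA Yscale1 YscaleDr YscaleDl.

Let YscaleAl x (p q : yangian) : x *: (p * q) = (x *: p) * q.
Proof. exact: mulrA. Qed.
HB.instance Definition _ := GRing.Lmodule_isLalgebra.Build C yangian YscaleAl.

Let YscaleAr x (p q : yangian) : x *: (p * q) = p * (x *: q).
Proof. by rewrite /GRing.scale /= /Yscale !mulrA YscalC. Qed.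
HB.instance Definition _ := GRing.Lalgebra_isAlgebra.Build C yangian YscaleAr.

Definition ygen r a b : yangian := ycls (YT r a b).

Lemma ycls_add u v : ycls (YAdd u v) = ycls u + ycls v.
Proof. exact/esym/YaddE. Qed.
Lemma ycls_mul u v : ycls (YMul u v) = ycls u * ycls v.
Proof. exact/esym/YmulE. Qed.
Lemma ycls_scal x : ycls (YScal x) = x%:A.
Proof. by rewrite /GRing.scale /= /Yscale mulr1. Qed.
Lemma ycls_sub u v : ycls (YSub u v) = ycls u - ycls v.
Proof. by rewrite ycls_add ycls_mul ycls_scal scaleN1r mulN1r. Qed.

Lemma ygen_rel : yangian_rel ygen.
Proof.
split=> [a b|r s a b c d].
  by rewrite /ygen /= ycls_scal; case: (a == b); rewrite ?scale1r ?scale0r.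
have := (yclsP _ _).2 (ycong_rel r s a b c d).
by rewrite !ycls_sub !ycls_mul.
Qed.

(* The universal property of the Yangian: ylift is the homomorphism with
   ygen |-> t (ylift_gen), for any t satisfying the relations in an algebra A
   with structure map phi; uniqueness follows from yangian_ind. *)
Section Lift.
Variables (A : pzRingType) (phi : C -> A) (t : nat -> 'I_N -> 'I_N -> A).

Definition ylift (q : yangian) : A := yeval phi t (repr q).

Hypotheses (phi1 : phi 1 = 1) (phiD : {morph phi : x y / x + y})
  (phiM : {morph phi : x y / x * y}) (phiC : forall x u, phi x * u = u * phi x)
  (t_rel : yangian_rel t).

Let yliftE u : ylift (ycls u) = yeval phi t u.
Proof. by apply: (yeval_cong phi1 phiD phiM phiC t_rel); exact: ycls_repr. Qed.

Lemma ylift_gen r a b : ylift (ygen r a b) = t r a b.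
Proof. by rewrite yliftE (yeval_T phi1 phiD t_rel). Qed.
Lemma yliftD : {morph ylift : p q / p + q}.
Proof. by move=> p q; rewrite -(yclsK p) -(yclsK q) -ycls_add !yliftE. Qed.
Lemma yliftM : {morph ylift : p q / p * q}.
Proof. by move=> p q; rewrite -(yclsK p) -(yclsK q) -ycls_mul !yliftE. Qed.
Lemma ylift_scal x : ylift x%:A = phi x.
Proof. by rewrite -ycls_scal yliftE. Qed.
Lemma ylift1 : ylift 1 = 1.
Proof. by rewrite -[X in ylift X]scale1r ylift_scal. Qed.
Lemma yliftZ x p : ylift (x *: p) = phi x * ylift p.
Proof. by rewrite -[p in LHS]mul1r scalerAl yliftM ylift_scal. Qed.

End Lift.

Lemma yangian_ind (P : yangian -> Prop) :
  (forall r a b, P (ygen r a b)) -> (forall x : C, P x%:A) ->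
  (forall p q, P p -> P q -> P (p + q)) ->
  (forall p q, P p -> P q -> P (p * q)) -> forall p, P p.
Proof.
move=> Pg Ps Pa Pm p; rewrite -(yclsK p); elim: (repr p) => [r a b|x|u Pu v Pv|u Pu v Pv].
- exact: (Pg r.+1 a b).
- by rewrite ycls_scal.
- by rewrite ycls_add; exact: Pa.
- by rewrite ycls_mul; exact: Pm.
Qed.

Definition ygen_inv : nat -> 'I_N -> 'I_N -> yangian := gen_inv ygen.

(* The antihomomorphism given by T(x) |-> T(x)^-1, obtained as a homomorphism
   to the opposite algebra; see antipode_gen and antipodeM. *)
Definition antipode : yangian -> yangian :=
  @ylift yangian^c (fun x => x%:A) ygen_inv.

Let antipode_rel : @yangian_rel yangian^c N ygen_inv.
Proof.
split=> [a b|].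
  by apply: (etrans (gen_inv0 ygen a b)); case: (a == b).
move=> r s a b c d; exact: (yangian_rel_invc ygen_rel r s a b c d).
Qed.
Let scC (x : C) (u : yangian^c) : (x%:A : yangian^c) * u = u * (x%:A : yangian^c).
Proof.
exact: etrans (mulr_algr x (u : yangian)) (esym (mulr_algl x (u : yangian))).
Qed.
Let scD : {morph (fun x : C => x%:A : yangian^c) : x y / x + y}.
Proof. by move=> x y; exact: scalerDl. Qed.
Let scM : {morph (fun x : C => x%:A : yangian^c) : x y / x * y}.
Proof.
move=> x y; apply: etrans (esym (scalerA x y (1 : yangian))) _.
exact: (esym (mulr_algr x (y%:A : yangian))).
Qed.
Let sc1 : (1%:A : yangian^c) = 1.
Proof. exact: scale1r. Qed.

Lemma antipode_gen r a b : antipode (ygen r a b) = ygen_inv r a b.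
Proof. exact: (ylift_gen sc1 scD scM scC antipode_rel). Qed.
Lemma antipodeD p q : antipode (p + q) = antipode p + antipode q.
Proof. exact: (yliftD sc1 scD scM scC antipode_rel). Qed.
Lemma antipodeM p q : antipode (p * q) = antipode q * antipode p.
Proof. exact: (yliftM sc1 scD scM scC antipode_rel). Qed.
Lemma antipodeZ x p : antipode (x *: p) = x *: antipode p.
Proof.
apply: etrans (yliftZ sc1 scD scM scC antipode_rel x p) _.
exact: (mulr_algr x (antipode p)).
Qed.
Lemma antipode1 : antipode 1 = 1.
Proof. exact: (ylift1 sc1 scD scM scC antipode_rel). Qed.

End YangianAlgebra.

Section Tensors.
Variables (C : fieldType) (N : nat).

(* The m-th tensor power of C^N is taken in the coordinates of its standard
   basis e_(i 0) (x) ... (x) e_(i (m - 1)), indexed by i : midx m.  A factor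
   (C^N)^* is taken in the dual basis, with the same index set.  Operators are
   matrices acting on columns. *)
Definition midx m : finType := {ffun 'I_m -> 'I_N}.
Definition tdim m : nat := #|midx m|.

(* The operator with matrix entries K i j, for row index i and column index j. *)
Definition opmx (I J : finType) (K : I -> J -> C) : 'M[C]_(#|I|, #|J|) :=
  \matrix_(i, j) K (enum_val i) (enum_val j).

Lemma opmx_ent (I J : finType) (A : 'M[C]_(#|I|, #|J|)) :
  A = opmx (fun i j => A (enum_rank i) (enum_rank j)).
Proof. by apply/matrixP => i j; rewrite mxE !enum_valK. Qed.

Lemma opmxM (I J L : finType) (K : I -> J -> C) (K' : J -> L -> C) :
  opmx K *m opmx K' = opmx (fun i l => \sum_j K i j * K' j l).
Proof.
apply/matrixP => i l; rewrite !mxE.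
rewrite [RHS](reindex (fun k : 'I_#|J| => enum_val k)) /=; last first.
  exact/onW_bij/enum_val_bij.
by apply: eq_bigr => j _; rewrite !mxE.
Qed.

Lemma eq_opmx (I J : finType) (K K' : I -> J -> C) :
  (forall i j, K i j = K' i j) -> opmx K = opmx K'.
Proof. by move=> e; apply/matrixP => i j; rewrite !mxE e. Qed.

Lemma opmx1 (I : finType) : opmx (fun i j : I => (i == j)%:R) = 1%:M.
Proof. by apply/matrixP => i j; rewrite !mxE (inj_eq enum_val_inj). Qed.

Definition lidx m k (i : midx (m + k)) : midx m := [ffun x => i (lshift k x)].
Definition ridx m k (i : midx (m + k)) : midx k := [ffun x => i (rshift m x)].

(* The tensor product of operators on the first m and on the last k factors. *)
Definition tenmx m k (A : 'M[C]_(tdim m)) (B : 'M[C]_(tdim k)) :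
    'M[C]_(tdim (m + k)) :=
  opmx (fun i j : midx (m + k) =>
    A (enum_rank (lidx i)) (enum_rank (lidx j))
    * B (enum_rank (ridx i)) (enum_rank (ridx j))).

Let split_idx m k (i : midx (m + k)) := (lidx i, ridx i).
Let join_idx m k (x : midx m * midx k) : midx (m + k) :=
  [ffun u => match split u with inl y => x.1 y | inr z => x.2 z end].

Let split_idxK m k : cancel (@split_idx m k) (@join_idx m k).
Proof.
move=> i; apply/ffunP => u; rewrite ffunE -[u in RHS]splitK.
by case: (split u) => y; rewrite /= ffunE.
Qed.
Let join_idxK m k : cancel (@join_idx m k) (@split_idx m k).
Proof.
move=> [x y]; congr pair; apply/ffunP => u; rewrite !ffunE.
  by rewrite -[lshift k u]/(unsplit (inl u)) unsplitK.
by rewrite -[rshift m u]/(unsplit (inr u)) unsplitK.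
Qed.

Lemma tenmxM m k (A A' : 'M[C]_(tdim m)) (B B' : 'M[C]_(tdim k)) :
  tenmx A B *m tenmx A' B' = tenmx (A *m A') (B *m B').
Proof.
rewrite /tenmx opmxM; apply: eq_opmx => i j.
rewrite !mxE big_distrl /=.
under [RHS]eq_bigr => x _ do rewrite big_distrr /=.
rewrite [RHS](reindex (@enum_rank (midx m))) /=; last exact/onW_bij/enum_rank_bij.
under [RHS]eq_bigr => x _ do
  (rewrite (reindex (@enum_rank (midx k))) /=; last exact/onW_bij/enum_rank_bij).
rewrite pair_big /= [RHS](reindex (@split_idx m k)) /=; last first.
  by apply/onW_bij; exists (@join_idx m k); [exact: split_idxK | exact: join_idxK].
by apply: eq_bigr => x _; rewrite /= mulrACA.
Qed.

Lemma tenmx1 m k : tenmx (1%:M : 'M_(tdim m)) (1%:M : 'M_(tdim k)) = 1%:M.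
Proof.
rewrite -[RHS]opmx1; apply: eq_opmx => i j; rewrite !mxE !(inj_eq enum_rank_inj).
rewrite -natrM mulnb -(can_eq (@split_idxK m k)) /split_idx.
by [].
Qed.

Lemma tenmxDl m k (A A' : 'M[C]_(tdim m)) (B : 'M[C]_(tdim k)) :
  tenmx (A + A') B = tenmx A B + tenmx A' B.
Proof. by apply/matrixP => i j; rewrite !mxE mulrDl. Qed.
Lemma tenmxDr m k (A : 'M[C]_(tdim m)) (B B' : 'M[C]_(tdim k)) :
  tenmx A (B + B') = tenmx A B + tenmx A B'.
Proof. by apply/matrixP => i j; rewrite !mxE mulrDr. Qed.
Lemma tenmxZl m k x (A : 'M[C]_(tdim m)) (B : 'M[C]_(tdim k)) :
  tenmx (x *: A) B = x *: tenmx A B.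
Proof. by apply/matrixP => i j; rewrite !mxE mulrA. Qed.
Lemma tenmxZr m k x (A : 'M[C]_(tdim m)) (B : 'M[C]_(tdim k)) :
  tenmx A (x *: B) = x *: tenmx A B.
Proof. by apply/matrixP => i j; rewrite !mxE mulrCA. Qed.

(* s moves the k-th tensor factor to the position s k. *)
Definition perm_op m (s : 'S_m) : 'M[C]_(tdim m) :=
  opmx (fun i j : midx m => [forall k, i (s k) == j k]%:R).

Lemma perm_opM m (s t : 'S_m) : perm_op (t * s)%g = perm_op s *m perm_op t.
Proof.
rewrite [RHS]opmxM; apply: eq_opmx => i l.
rewrite (bigD1 [ffun k => i (s k)]) //= big1 => [|j ne]; last first.
  case: forallP => [e|_]; last by rewrite mul0r.
  by case/eqP: ne; apply/ffunP => k; rewrite ffunE; exact/esym/eqP/e.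
rewrite addr0 (_ : [forall k, _ == [ffun k => i (s k)] k]); last first.
  by apply/forallP => k; rewrite ffunE.
by rewrite mul1r; congr (nat_of_bool _)%:R; apply: eq_forallb => k; rewrite permM ffunE.
Qed.

(* The reversal of all the tensor factors.  This is only used for m = m'
   propositionally; m' is separate since n + nt and nt + n are not convertible. *)
Definition rev_op m m' : 'M[C]_(tdim m, tdim m') :=
  opmx (fun (i : midx m) (j : midx m') =>
    [forall k : 'I_m, forall l : 'I_m', (k + l.+1 == m)%N ==> (i k == j l)]%:R).

(* u (x) v |-> <u, v> sum_a v_a^* (x) v_a in the factors l (a factor (C^N)^* )
   and j (a factor C^N), identity in the others: it sends a basis vector q with
   q l = q j to the sum of the basis vectors p with p l = p j that agree with q
   away from l and j, and kills those with q l <> q j. *)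
Definition pairing_op m (l j : 'I_m) : 'M[C]_(tdim m) :=
  opmx (fun p q : midx m =>
    [&& p l == p j, q l == q j
      & [forall k : 'I_m, (k != l) && (k != j) ==> (p k == q k)]]%:R).

End Tensors.

Section YangianModules.
Variables (C : fieldType) (N : nat).
Local Notation Y := (yangian C N).
Local Notation tdim := (tdim N).
Local Notation midx := (midx N).

(* Modules with underlying space C^d. *)
Record ymodule (d : nat) := YModule {
  yact :> Y -> 'M[C]_d;
  yact_linear : linear yact;
  yact_monoid : monoid_morphism yact }.

Definition yintertwiner d d' (V : ymodule d) (W : ymodule d')
    (A : 'M[C]_(d', d)) : Prop :=
  forall y : Y, A *m V y = W y *m A.

Section Generators.
Variables (d : nat) (t : nat -> 'I_N -> 'I_N -> 'M[C]_d).
Hypothesis t_rel : yangian_rel t.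

Let scD : {morph (@scalar_mx C d) : x y / x + y}.
Proof. by move=> x y; rewrite raddfD. Qed.
Let scM : {morph (@scalar_mx C d) : x y / x * y}.
Proof. by move=> x y; exact: scalar_mxM. Qed.
Let scC (x : C) (u : 'M[C]_d) : x%:M * u = u * x%:M.
Proof. by rewrite [LHS]mul_scalar_mx [RHS]mul_mx_scalar. Qed.

Let gen_linear : linear (ylift (@scalar_mx C d) t).
Proof.
move=> x p q; rewrite (yliftD _ scD scM scC t_rel) //.
by rewrite (yliftZ _ scD scM scC t_rel) // [_ * _]mul_scalar_mx.
Qed.
Let gen_monoid : monoid_morphism (ylift (@scalar_mx C d) t).
Proof.
split; first exact: (ylift1 _ scD scM scC t_rel).
exact: (yliftM _ scD scM scC t_rel).
Qed.

Definition ymod_gen : ymodule d := YModule gen_linear gen_monoid.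

Lemma ymod_genE r a b : ymod_gen (ygen C r a b) = t r a b.
Proof. exact: (ylift_gen _ scD scM scC t_rel). Qed.

End Generators.

Lemma ymodule_rel d (V : ymodule d) : yangian_rel (fun r a b => V (ygen C r a b)).
Proof.
have [V1 VM] := yact_monoid V.
have VD p q : V (p + q) = V p + V q.
  by have := yact_linear V 1 p q; rewrite !scale1r.
have V0 : V 0 = 0 by apply: (addrI (V 0)); rewrite -VD !addr0.
have VZ x p : V (x *: p) = x *: V p.
  by have := yact_linear V x p 0; rewrite V0 !addr0.
have VB p q : V (p - q) = V p - V q by rewrite VD -scaleN1r VZ scaleN1r.
have [h0 h] := ygen_rel C N; split=> [a b|r s a b c e].
  by rewrite h0; case: (a == b); rewrite ?mulr0n.
by rewrite -!VM -!VB h.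
Qed.

(* The matrix unit E_ba on C^N. *)
Definition unit_op (b a : 'I_N) : 'M[C]_(tdim 1) :=
  opmx (fun i j : midx 1 => ((i ord0 == b) && (j ord0 == a))%:R).

(* The coefficient at x^-r of delta_ab - E_ba (x - z)^-1. *)
Definition eval_gen (z : C) r a b : 'M[C]_(tdim 1) :=
  if r is r'.+1 then - (z ^+ r' *: unit_op b a) else (a == b)%:R.

Lemma unit_opM b a d c : unit_op b a * unit_op d c = (a == d)%:R *: unit_op b c.
Proof.
rewrite [LHS]opmxM; apply/matrixP => i j; rewrite !mxE.
set i' := enum_val i; set j' := enum_val j.
rewrite (bigD1 [ffun=> a]) //= big1 ?addr0 => [|k kna].
  rewrite !ffunE eqxx andbT -!natrM !mulnb.
  by case: (a == d); case: (i' ord0 == b); case: (j' ord0 == c).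
case: (altP (k ord0 =P a)) => [ka|_]; last by rewrite andbF mul0r.
case/eqP: kna; apply/ffunP => x; rewrite ffunE -ka.
by congr (k _); apply/val_inj; case: x => [[]].
Qed.

Lemma eval_rel z : yangian_rel (eval_gen z).
Proof.
have nC (e : bool) (A : 'M[C]_(tdim 1)) : A * e%:R - e%:R * A = 0.
  by case: e; rewrite ?mulr1 ?mul1r ?mulr0 ?mul0r subrr.
have nC' (e : bool) (A : 'M[C]_(tdim 1)) : e%:R * A - A * e%:R = 0.
  by rewrite -opprB nC oppr0.
have mZ (x y : C) (A B : 'M[C]_(tdim 1)) :
    - (x *: A) * - (y *: B) = (x * y) *: (A * B).
  rewrite mulrNN -[LHS]/((x *: A) *m (y *: B)).
  by rewrite -scalemxAl -scalemxAr scalerA.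
have mn (e : bool) (A : 'M[C]_(tdim 1)) : A * e%:R = e%:R *: A.
  by case: e; rewrite ?mulr1 ?scale1r ?mulr0 ?scale0r.
have nm (e : bool) (A : 'M[C]_(tdim 1)) : e%:R * A = e%:R *: A.
  by case: e; rewrite ?mul1r ?scale1r ?mul0r ?scale0r.
split=> // r s a b c d; have sw (x y : C) (A : 'M[C]_(tdim 1)) : x *: (y *: A) = y *: (x *: A).
  by rewrite !scalerA [x * y]mulrC.
case: r s => [|r] [|s] /=.
- by rewrite nC nC' !subrr.
- rewrite nC' subr0 !mZ !unit_opM nm mn expr0 mul1r mulr1.
  rewrite !(scalerN _%:R) opprK [RHS]addrC; congr (_ - _); exact: sw.
- rewrite nC sub0r !mZ !unit_opM nm mn expr0 mul1r mulr1.
  by rewrite !(scalerN _%:R) opprK opprB [RHS]addrC; congr (_ - _); exact: sw.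
- rewrite !mZ !unit_opM -!exprD !addnS !addSn [(s + r)%N]addnC.
  by rewrite !subrr.
Qed.

Definition ymod_eval (z : C) : ymodule (tdim 1) := ymod_gen (eval_rel z).

Section Dual.
Variables (d : nat) (V : ymodule d).

(* The dual module: (y f)(v) = f (S(y) v), in the dual basis. *)
Definition dual_act (y : Y) : 'M[C]_d := (V (antipode y))^T.

Let dual_linear : linear dual_act.
Proof.
move=> x p q; rewrite /dual_act antipodeD antipodeZ.
by rewrite (yact_linear V) linearP.
Qed.
Let dual_monoid : monoid_morphism dual_act.
Proof.
have [V1 VM] := yact_monoid V; split=> [|p q]; rewrite /dual_act.
  by rewrite antipode1 V1 trmx1.
by rewrite antipodeM VM trmx_mul.
Qed.

Definition ymod_dual : ymodule d := YModule dual_linear dual_monoid.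

End Dual.

Lemma counit_rel : yangian_rel
  (fun r (a b : 'I_N) => ((r == 0%N) && (a == b))%:R : 'M[C]_(tdim 0)).
Proof.
split=> // r s a b c d /=; rewrite !mul0r !mulr0 !subrr.
by case: r s => [|r] [|s] /=; rewrite ?mul0r ?mulr0 ?subrr.
Qed.

(* The trivial module, which is the empty tensor product. *)
Definition ymod_counit : ymodule (tdim 0) := ymod_gen counit_rel.

Section Tensor.
Variables (m k : nat) (V : ymodule (tdim m)) (W : ymodule (tdim k)).

(* The images of the generators under the coproduct
   T_ab(x) |-> sum_c T_ac(x) (x) T_cb(x), acting on V (x) W. *)
Definition coprod_gen : nat -> 'I_N -> 'I_N -> 'M[C]_(tdim (m + k)) :=
  fun r a b => \sum_c \sum_(i < r.+1)
    tenmx (V (ygen C i a c)) (W (ygen C (r - i)%N c b)).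

Lemma coprod_rel : yangian_rel coprod_gen.
Proof.
pose l (A : 'M[C]_(tdim m)) := tenmx A (1%:M : 'M_(tdim k)).
pose r (B : 'M[C]_(tdim k)) := tenmx (1%:M : 'M_(tdim m)) B.
have lM A A' : l (A * A') = l A * l A'.
  by rewrite [RHS]tenmxM mul1mx.
have rM A A' : r (A * A') = r A * r A'.
  by rewrite [RHS]tenmxM mul1mx.
have lB A A' : l (A - A') = l A - l A'.
  by rewrite /l tenmxDl -!scaleN1r tenmxZl.
have rB A A' : r (A - A') = r A - r A'.
  by rewrite /r tenmxDr -!scaleN1r tenmxZr.
have l_nat (e : bool) : l e%:R = e%:R.
  case: e; first exact: tenmx1.
  by rewrite mulr0n /l -(scale0r (0 : 'M_(tdim m))) tenmxZl scale0r.
have r_nat (e : bool) : r e%:R = e%:R.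
  case: e; first exact: tenmx1.
  by rewrite mulr0n /r -(scale0r (0 : 'M_(tdim k))) tenmxZr scale0r.
have lV : yangian_rel (fun i a b => l (V (ygen C i a b))).
  have [h0 h] := ymodule_rel V; split=> [a b|i j a b c d].
    by rewrite h0 l_nat.
  by rewrite -!lM -!lB h.
have rW : yangian_rel (fun i a b => r (W (ygen C i a b))).
  have [h0 h] := ymodule_rel W; split=> [a b|i j a b c d].
    by rewrite h0 r_nat.
  by rewrite -!rM -!rB h.
have lr A B : l A * r B = r B * l A.
  by rewrite [LHS]tenmxM [RHS]tenmxM !mulmx1 !mul1mx.
have := yangian_rel_mul (fun i j a b c d => lr _ _) lV rW.
congr (yangian_rel _); apply/funext => i; apply/funext => a; apply/funext => b.
apply: eq_bigr => c _; apply: eq_bigr => j _.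
by rewrite [LHS]tenmxM mulmx1 mul1mx.
Qed.

Definition ymod_tensor2 : ymodule (tdim (m + k)) := ymod_gen coprod_rel.

End Tensor.

Fixpoint ymod_tensor m : ('I_m -> ymodule (tdim 1)) -> ymodule (tdim m) :=
  match m with
  | 0 => fun=> ymod_counit
  | m'.+1 => fun V =>
      ymod_tensor2 (V ord0) (ymod_tensor (fun k => V (lift ord0 k)))
  end.

End YangianModules.

(* A partition is given by a weakly decreasing sequence, extended by zeros;
   trailing zeros are allowed.  Rows, columns and entries of tableaux are all
   counted from 0, so that part nu i is nu_(i+1); this does not affect the
   contents.  The index j of conj_part nu j = nu'_j is counted from 1. *)
Definition is_partition (nu : seq nat) : bool := sorted geq nu.
Definition part (nu : seq nat) (i : nat) : nat := nth 0%N nu i.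
Definition conj_part (nu : seq nat) (j : nat) : nat := count (leq j) nu.

Section Tableaux.
Variables la mu : seq nat.

Definition skew_size : nat := (\sum_(i < size la) (part la i - part mu i))%N.

Definition in_skew (x : nat * nat) : bool :=
  (part mu x.1 <= x.2)%N && (x.2 < part la x.1)%N.

Definition cell : Type := {x : nat * nat | in_skew x}.

(* The map box is the inverse of the bijection entry. *)
Record std_tableau := StdTableau {
  entry :> cell -> 'I_skew_size;
  box : 'I_skew_size -> cell;
  entryK : cancel entry box;
  boxK : cancel box entry;
  entry_down : forall x y : cell,
    val y = ((val x).1.+1, (val x).2) -> (entry x < entry y)%N;
  entry_right : forall x y : cell,
    val y = ((val x).1, (val x).2.+1) -> (entry x < entry y)%N }.

Definition trow (Om : std_tableau) k : nat := (val (box Om k)).1.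
Definition tcol (Om : std_tableau) k : nat := (val (box Om k)).2.
Definition content (Om : std_tableau) k : int := (tcol Om k)%:Z - (trow Om k)%:Z.

End Tableaux.

Section GroupAlgebra.
Variables (K : comNzRingType) (n : nat).

Definition galg : Type := {ffun 'S_n -> K}.
HB.instance Definition _ := GRing.Zmodule.on galg.

Definition gelt (x : K) (s : 'S_n) : galg := [ffun u => if u == s then x else 0].

(* gelt 1 u * gelt 1 v is the composite u \o v, which is (v * u)%g since
   permutations are multiplied from left to right in the library. *)
Definition gmul (x y : galg) : galg :=
  [ffun s : 'S_n => \sum_(u : 'S_n) x u * y (s * u^-1)%g].

Let gmulA : associative gmul.
Proof.
move=> x y z; apply/ffunP => s; rewrite !ffunE.
under eq_bigr => u _ do rewrite ffunE mulr_sumr.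
under [RHS]eq_bigr => u _ do rewrite ffunE mulr_suml.
rewrite [RHS]exchange_big /=; apply: eq_bigr => u _.
rewrite [RHS](reindex_inj (mulIg u)) /=.
by apply: eq_bigr => v _; rewrite mulrA mulgK invMg mulgA.
Qed.

Let gmul1 : left_id (gelt 1 1%g) gmul.
Proof.
move=> x; apply/ffunP => s; rewrite !ffunE (bigD1 1%g) //= ffunE eqxx mul1r.
rewrite invg1 mulg1 big1 ?addr0 // => u /negbTE ne.
by rewrite ffunE ne mul0r.
Qed.
Let gmulr1 : right_id (gelt 1 1%g) gmul.
Proof.
move=> x; apply/ffunP => s; rewrite !ffunE (bigD1 s) //= ffunE mulgV eqxx mulr1.
rewrite big1 ?addr0 // => u ne.
by rewrite ffunE -eq_mulgV1 eq_sym (negbTE ne) mulr0.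
Qed.
Let gmulDl : left_distributive gmul +%R.
Proof.
move=> x y z; apply/ffunP => s; rewrite !ffunE -big_split /=.
by apply: eq_bigr => u _; rewrite ffunE mulrDl.
Qed.
Let gmulDr : right_distributive gmul +%R.
Proof.
move=> x y z; apply/ffunP => s; rewrite !ffunE -big_split /=.
by apply: eq_bigr => u _; rewrite ffunE mulrDr.
Qed.

HB.instance Definition _ := GRing.Zmodule_isPzRing.Build galg
  gmulA gmul1 gmulr1 gmulDl gmulDr.

End GroupAlgebra.

Section Operators.
Variables (C : fieldType) (N : nat).

(* The value at v of a rational function regular at v (see frac_valE), and the
   junk value 0 if it is not regular. *)
Definition frac_val n (v : 'I_n -> C) (x : {fraction {mpoly C[n]}}) : C :=
  match pselect (exists y, exists p q : {mpoly C[n]},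
      [/\ q.@[v] != 0, x = tofrac p / tofrac q & y = p.@[v] / q.@[v]]) with
  | left regular => projT1 (cid regular)
  | right _ => 0
  end.

Lemma frac_valE n (v : 'I_n -> C) (p q : {mpoly C[n]}) : q.@[v] != 0 ->
  frac_val v (tofrac p / tofrac q) = p.@[v] / q.@[v].
Proof.
move=> qv; rewrite /frac_val; case: pselect => [reg|[]]; last first.
  by exists (p.@[v] / q.@[v]), p, q.
case: (cid reg) => y /= [p' [q' [q'v e ->]]].
have nz (r : {mpoly C[n]}) : r.@[v] != 0 -> tofrac r != 0.
  by rewrite tofrac_eq0; apply: contra => /eqP ->; rewrite meval0.
move/eqP: e; rewrite eqr_div ?nz // -!tofracM tofrac_eq => /eqP e.
by apply/eqP; rewrite eqr_div // -!mevalM e.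
Qed.

Section OneTableau.
Variables (la mu : seq nat) (Om : std_tableau la mu).
Local Notation n := (skew_size la mu).

(* The variables t_k and t_l are identified when k and l are in the same column:
   there is one variable per column, named after its least entry. *)
Definition col_rep (k : 'I_n) : 'I_n :=
  [arg min_(l < k | tcol Om l == tcol Om k) (l : nat)]%N.

Definition tvar (k : 'I_n) : {mpoly C[n]} := 'X_(col_rep k).

Definition f_rat : galg {fraction {mpoly C[n]}} n :=
  \prod_(k < n) \prod_(l < n | (k < l)%N)
    (1 - gelt (tofrac ((content Om k - content Om l)%:~R + tvar k - tvar l))^-1
           (tperm k l)).

(* f_rat depends only on the differences of the variables, hence its value on
   the diagonal t_1 = ... = t_n is its value at the origin. *)
Definition f_tab : galg C n := [ffun s => frac_val (fun=> 0) (f_rat s)].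

Definition F_op : 'M[C]_(tdim N n) := \sum_(s : 'S_n) f_tab s *: perm_op C N s.

End OneTableau.

Section TwoTableaux.
Variables (M : nat) (la mu lat mut : seq nat).
Variables (Om : std_tableau la mu) (Omt : std_tableau lat mut).
Local Notation n := (skew_size la mu).
Local Notation nt := (skew_size lat mut).

Definition G_op : 'M[C]_(tdim N (nt + n)) :=
  \prod_(k < n) \prod_(l < nt)
    (1 - ((content Om k + content Omt l)%:~R + N%:R + M%:R)^-1
           *: pairing_op C N (lshift n (rev_ord l)) (rshift nt k)).

Definition F_mixed : 'M[C]_(tdim N (nt + n)) :=
  G_op *m tenmx (rev_op C N nt nt *m F_op Omt *m rev_op C N nt nt) (F_op Om).

End TwoTableaux.
End Operators.

(* Main.v *)
Require Import Defs.
From mathcomp Require Import all_boot all_order all_fingroup all_algebra.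
From mathcomp Require Import fraction mpoly boolp reals complex ring zify.

Set Implicit Arguments.
Unset Strict Implicit.
Unset Printing Implicit Defensive.

Import Order.TTheory GRing.Theory Num.Theory.
Local Open Scope ring_scope.

(** Why the theorem holds.  On a tensor product of evaluation modules V(z) the
matrix T(x) acts as the ordered product of the R-matrices 1 - P / (x - z), where
P transposes the auxiliary factor C^N with the factor that carries V(z).  On a
dual module the antipode and the transposition replace this R-matrix by a scalar
multiple of 1 + Q / (x - z), with a contraction Q in place of P.  To intertwine
two orderings of the factors is to exchange the corresponding factors of T(x),
and each elementary exchange is an instance of the Yang-Baxter equation
(yang_baxter, yang_baxter_dual, yang_baxter_mixed): the operator that does it is
1 - P / (z - w) for two ordinary factors V(z) and V(w), the same with z - w
replaced by w - z for their duals, and 1 - Q / (z - w + N) for V(z) and the dual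
of V(w).  The lemmas rmx_eval, rmx_cap and qmx_exchange state these exchanges,
with T(x) expanded as a power series in 1 / x.

The operator F_op of a tableau is a product of such elements over all pairs of
factors, taken in an order in which it reverses the factors one exchange after
the other (lexprod_exchange_rev, lexprod_exchange).  This makes sense for generic
values of the variables attached to the columns.  The relation is an identity
between rational functions, and it survives at the origin provided that the
product is regular there (F_op_eval, F_op_dual).

Regularity is proved by the fusion procedure (fusion_regular, lexprod_regular).
The factor of a pair of entries is singular if they lie on one diagonal.  By the
Yang-Baxter equation two consecutive entries whose contents differ by at least
two can be exchanged at the cost of a regular invertible scalar, so the tableau
may be assumed to be filled column by column.  If l lies on the diagonal of a, in
a later column, then the cell b below a belongs to the shape and is the next
entry.  The preceding factors are antisymmetric in a and b, and this cancels the
pole of the factor of (a, l) against the factor of (b, l).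

Finally G_op moves the block of ordinary factors past the block of dual ones
(grid_exchange).  Its scalars have to be the inverses of the differences of the
parameters shifted by N, so the denominators must not vanish: a content is
greater than minus the number of rows, and the two numbers of rows add up to at
most N + M. *)

(** * Yang-Baxter relations in an abstract ring *)

Section YangBaxter.
Variable B : pzRingType.
Implicit Types a b c p q A P Q U V W X Y Z : B.

Definition central a := forall X, a * X = X * a.

Lemma centralN a : central a -> central (- a).
Proof. by move=> ca X; rewrite mulNr ca mulrN. Qed.

Lemma mulr_central a b X Y : central b -> a * X * (b * Y) = a * b * (X * Y).
Proof. by move=> cb; rewrite mulrA -[a * X * b]mulrA -cb !mulrA. Qed.

Lemma central_rev p q X Y Z : central p -> central q -> X * Y * Z = Z * Y * X ->
  X * (p * Y) * (q * Z) = q * Z * (p * Y) * X.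
Proof.
move=> cp cq e; rewrite [X * (p * Y)]mulrA -cp -[p * X * Y]mulrA.
rewrite (mulr_central p _ _ cq) e [q * Z * (p * Y)]mulr_central //.
by rewrite cq -!mulrA.
Qed.

Lemma comm_1B a X Y : central a -> X * Y = Y * X ->
  (1 - a * X) * Y = Y * (1 - a * X).
Proof.
move=> ca XY; rewrite mulrBl mulrBr mul1r mulr1 -mulrA XY; congr (_ - _).
by rewrite !mulrA ca.
Qed.

(** G, A and F stand for operators exchanging, respectively, two blocks of
factors with each other and the factors inside of either block. *)
Lemma exchange_assemble (G A F X X' Y Y' : B) :
  F * X' = X * F -> F * Y = Y * F -> A * X = X * A -> A * Y = Y' * A ->
  G * (X * Y') = Y' * X * G ->
  G * (A * F) * (X' * Y) = Y' * X * (G * (A * F)).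
Proof.
move=> FX FY AX AY GXY; rewrite [RHS]mulrA -GXY -!mulrA; congr (_ * _).
rewrite [F * (X' * Y)]mulrA FX -[X * F * Y]mulrA FY.
by rewrite mulrA AX -mulrA [A * (Y * F)]mulrA AY -!mulrA.
Qed.

Lemma mul_1B_1D X : (1 - X) * (1 + X) = 1 - X * X.
Proof. by rewrite mulrDr mulr1 mulrBl mul1r addrA subrK. Qed.

Lemma mul2_1B U V : (1 - U) * (1 - V) = 1 - (U + V) + U * V.
Proof.
rewrite mulrBl mul1r mulrBr mulr1 opprB opprD.
by rewrite [U * V - U]addrC !addrA [1 - U - V]addrAC.
Qed.

Lemma mul3_1B U V W : (1 - U) * (1 - V) * (1 - W) =
  1 - (U + V + W) + (U * V + U * W + V * W) - U * V * W.
Proof.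
rewrite mul2_1B mulrDl mul2_1B mulrDl mulrBr mulr1.
rewrite -[RHS]addrA -[LHS]addrA; congr (_ + _).
by rewrite !addrA; congr (_ - _); rewrite addrC addrA -addrA; congr (_ + _).
Qed.

(** Reversing a product of three factors 1 - x X only concerns its terms of
degree at least two, because the scalars are central. *)
Lemma mul3_1B_rev x y z X Y Z : central x -> central y -> central z ->
  x * y * (X * Y) + x * z * (X * Z) + y * z * (Y * Z) - x * y * z * (X * Y * Z)
  = y * z * (Z * Y) + x * z * (Z * X) + x * y * (Y * X)
    - x * y * z * (Z * Y * X) ->
  (1 - x * X) * (1 - y * Y) * (1 - z * Z)
  = (1 - z * Z) * (1 - y * Y) * (1 - x * X).
Proof.
move=> cx cy cz e; rewrite !mul3_1B !(@mulr_central _ y) //.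
rewrite !(@mulr_central _ z) // !(@mulr_central _ x) //.
have -> : z * y * x = x * y * z by rewrite -mulrA cy cz.
rewrite [z * y]cz [z * x]cz [y * x]cy -[LHS]addrA -[RHS]addrA e.
by congr (_ - _ + _); rewrite [RHS]addrC addrA [RHS]addrAC.
Qed.

(** A, P and C are the transpositions of a symmetric group on three letters,
and the condition on the scalars is 1/a + 1/c = 1/b. *)
Lemma yang_baxter a b c A P C :
  central a -> central b -> central c -> a * c = a * b + b * c ->
  A * A = 1 -> C * C = 1 -> P = A * C * A -> P = C * A * C ->
  (1 - a * A) * (1 - b * P) * (1 - c * C) =
  (1 - c * C) * (1 - b * P) * (1 - a * A).
Proof.
move=> ca cb cc e A2 C2 eP eP'; apply: mul3_1B_rev => //.
have AP : A * P = C * A by rewrite eP !mulrA A2 mul1r.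
have PC : P * C = C * A by rewrite eP' -!mulrA C2 mulr1.
have PA : P * A = A * C by rewrite eP -!mulrA A2 mulr1.
have CP : C * P = A * C by rewrite eP' !mulrA C2 mul1r.
have -> : A * P * C = C * P * A 
  by rewrite AP -PC -mulrA C2 mulr1 CP -PA -mulrA A2 mulr1.
rewrite AP CP PC PA; congr (_ - _).
rewrite [LHS]addrAC [RHS]addrAC -!mulrDl [b * c + _]addrC -e.
by rewrite addrC.
Qed.

(** The relation obtained when the auxiliary factor stays and the two other
factors are replaced by their duals: their transposition P survives, while the
transpositions with the auxiliary factor become the contractions Q and Q'.  The
condition on the scalars is 1/a + 1/b = 1/c. *)
Lemma yang_baxter_dual a b c P Q Q' :
  central a -> central b -> central c -> a * b = a * c + b * c ->
  P * P = 1 -> Q' = P * Q * P -> Q * P * Q = Q ->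
  (1 - a * P) * (1 - b * Q) * (1 - c * Q') =
  (1 - c * Q') * (1 - b * Q) * (1 - a * P).
Proof.
move=> ca cb cc e P2 eQ' QPQ; apply: mul3_1B_rev => //.
have PQ' : P * Q' = Q * P by rewrite eQ' !mulrA P2 mul1r.
have QQ' : Q * Q' = Q * P by rewrite eQ' !mulrA QPQ.
have Q'P : Q' * P = P * Q by rewrite eQ' -!mulrA P2 mulr1.
have Q'Q : Q' * Q = P * Q by rewrite eQ' -!mulrA [Q * _]mulrA QPQ.
rewrite PQ' QQ' Q'P Q'Q -[P * Q * Q']mulrA QQ' [P * (Q * P)]mulrA -eQ'.
congr (_ - _).
by rewrite -[LHS]addrA -!mulrDl [b + a]addrC [(a + b) * c]mulrDl -e.
Qed.

(** The relation between an ordinary and a dual factor: P permutes the auxiliary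
factor with the ordinary one, Q' and Q are the contractions of these two with
the dual factor, and n is the dimension.  The condition on the scalars is
1/a + 1/b = 1/c + n; the shift by n comes from Q' Q' = n Q'. *)
Lemma yang_baxter_mixed a b c n P Q Q' :
  central a -> central b -> central c -> central n ->
  a * b + n * (a * b * c) = a * c + b * c ->
  P * P = 1 -> Q = P * Q' * P -> Q' * P * Q' = Q' -> Q' * Q' = n * Q' ->
  (1 - a * Q) * (1 - b * P) * (1 + c * Q') =
  (1 + c * Q') * (1 - b * P) * (1 - a * Q).
Proof.
move=> ca cb cc cn e P2 eQ Q'PQ' Q'2.
have -> : 1 + c * Q' = 1 - (- c) * Q' by rewrite mulNr opprK.
have cNc := centralN cc.
apply: mul3_1B_rev => //.
have QP : Q * P = P * Q' by rewrite eQ -!mulrA P2 mulr1.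
have QQ' : Q * Q' = P * Q' by rewrite eQ -!mulrA [Q' * _]mulrA Q'PQ'.
have PQ : P * Q = Q' * P by rewrite eQ !mulrA P2 mul1r.
have Q'Q : Q' * Q = Q' * P by rewrite eQ !mulrA Q'PQ'.
have QPQ' : Q * P * Q' = n * (P * Q').
  by rewrite QP -mulrA Q'2 mulrA -cn mulrA.
have Q'PQ : Q' * P * Q = n * (Q' * P).
  by rewrite -mulrA PQ mulrA Q'2 mulrA.
rewrite QPQ' Q'PQ QP QQ' PQ Q'Q.
have coef X : a * b * X + a * - c * X + b * - c * X - a * b * - c * (n * X) = 0.
  rewrite !mulrN !mulNr opprK [a * b * c * (n * X)]mulrA -[a * b * c * n]cn.
  rewrite addrAC [X in X + _]addrAC -mulrDl e mulrDl.
  by rewrite [X in X - _]addrAC subrr add0r subrr.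
rewrite coef -[LHS](coef (Q' * P)); congr (_ - _).
by rewrite addrC addrA addrAC.
Qed.
End YangBaxter.

(** * Products over the pairs of elements of a list *)

Section LexProduct.
Variables (B : pzRingType) (I : eqType).
Implicit Types (g : I -> I -> B) (X Y Z : I -> B) (s t : seq I) (W : B).

Lemma comm_prod W s X : (forall a, a \in s -> W * X a = X a * W) ->
  W * (\prod_(a <- s) X a) = (\prod_(a <- s) X a) * W.
Proof.
elim: s => [|a s IH] h; first by rewrite big_nil mulr1 mul1r.
rewrite big_cons mulrA h ?mem_head // -mulrA IH ?mulrA // => b bs.
by apply: h; rewrite inE bs orbT.
Qed.

Fixpoint lexprod g s : B :=
  if s is a :: s' then (\prod_(b <- s') g a b) * lexprod g s' else 1.

Lemma comm_lexprod W g s :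
  (forall a b, a \in s -> b \in s -> W * g a b = g a b * W) ->
  W * lexprod g s = lexprod g s * W.
Proof.
elim: s => [|a s IH] h /=; first by rewrite mulr1 mul1r.
rewrite mulrA comm_prod => [|b bs]; last by rewrite h // inE ?eqxx ?bs ?orbT.
by rewrite -!mulrA IH // => b c bs cs; rewrite h // inE ?bs ?cs orbT.
Qed.

Lemma eq_lexprod g g' s : {in s &, g =2 g'} -> lexprod g s = lexprod g' s.
Proof.
elim: s => [|a s IH] //= e; rewrite IH => [|b c bs cs]; last first.
  by rewrite e // inE ?bs ?cs orbT.
congr (_ * _); apply: eq_big_seq => b bs.
by rewrite e // inE ?eqxx ?bs ?orbT.
Qed.

Section Exchange.
Variables (g : I -> I -> B) (X : I -> B).
Hypothesis gX : forall a b c, c != a -> c != b -> g a b * X c = X c * g a b.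

Let row_right (h : I -> B) Z W s : uniq s ->
  (forall b c, b \in s -> c \in s -> b != c -> h b * Z c = Z c * h b) ->
  (forall b, b \in s -> h b * Z b * W = W * Z b * h b) ->
  (\prod_(b <- s) h b) * (\prod_(b <- s) Z b) * W =
  W * (\prod_(b <- s) Z b) * \prod_(b <- s) h b.
Proof.
elim: s => [|b s IH] /=; first by rewrite !big_nil !mulr1 mul1r.
case/andP => bs us hZ hZW; rewrite !big_cons.
have sub c : c \in s -> c \in b :: s by rewrite inE orbC => ->.
have b_in : b \in b :: s by rewrite mem_head.
have {}IH := IH us (fun c d cs ds => hZ c d (sub c cs) (sub d ds))
  (fun c cs => hZW c (sub c cs)).
have nb c : c \in s -> c != b by move=> cs; apply: contraNneq bs => <-.
have Zb : Z b * (\prod_(j <- s) h j) = (\prod_(j <- s) h j) * Z b.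
  by apply: comm_prod => c cs; rewrite hZ // ?sub // nb.
have hb : h b * (\prod_(j <- s) Z j) = (\prod_(j <- s) Z j) * h b.
  by apply: comm_prod => c cs; rewrite hZ // ?sub // eq_sym nb.
rewrite -!mulrA [X in h b * X]mulrA -Zb -!mulrA [X in _ * (_ * X)]mulrA IH.
by rewrite !mulrA hZW // -[_ * h b * _]mulrA hb !mulrA.
Qed.

Let row_left (h : I -> B) Z W s : uniq s ->
  (forall b c, b \in s -> c \in s -> b != c -> h b * Z c = Z c * h b) ->
  (forall b, b \in s -> h b * W * Z b = Z b * W * h b) ->
  (\prod_(b <- s) h b) * W * (\prod_(b <- rev s) Z b) =
  (\prod_(b <- rev s) Z b) * W * \prod_(b <- s) h b.
Proof.
elim: s => [|b s IH] /=; first by rewrite !big_nil !mulr1 mul1r.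
case/andP => bs us hZ hZW; rewrite rev_cons !big_rcons /= !big_cons.
have sub c : c \in s -> c \in b :: s by rewrite inE orbC => ->.
have b_in : b \in b :: s by rewrite mem_head.
have {}IH := IH us (fun c d cs ds => hZ c d (sub c cs) (sub d ds))
  (fun c cs => hZW c (sub c cs)).
have nb c : c \in s -> c != b by move=> cs; apply: contraNneq bs => <-.
have Zb : Z b * (\prod_(j <- s) h j) = (\prod_(j <- s) h j) * Z b.
  by apply: comm_prod => c cs; rewrite hZ // ?sub // nb.
have hb : h b * (\prod_(j <- rev s) Z j) = (\prod_(j <- rev s) Z j) * h b.
  by apply: comm_prod => c; rewrite mem_rev => cs; rewrite hZ // ?sub // eq_sym nb.
rewrite mulrA -[h b * _ * W]mulrA -[h b * _ * _]mulrA IH -!mulrA -Zb.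
by rewrite [in LHS]mulrA hb -!mulrA; congr (_ * _); rewrite !mulrA hZW.
Qed.

(** The factors of the lexicographic product, read from right to left, perform
adjacent exchanges which sort the reversed product of the X a; the row of
the factors g a b with fixed a carries X a past all the later elements. *)
Lemma lexprod_exchange_rev s : uniq s ->
  (forall a b, a \in s -> b \in s -> a != b ->
     g a b * X b * X a = X a * X b * g a b) ->
  lexprod g s * (\prod_(a <- rev s) X a) = (\prod_(a <- s) X a) * lexprod g s.
Proof.
elim: s => [|a s IH] /=; first by rewrite !big_nil mulr1.
case/andP => as' us gXX; rewrite rev_cons big_rcons /= big_cons.
have sub c : c \in s -> c \in a :: s by rewrite inE orbC => ->.
have na c : c \in s -> c != a by move=> cs; apply: contraNneq as' => <-.
have Xa : X a * lexprod g s = lexprod g s * X a.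
  by apply: comm_lexprod => b c bs cs; rewrite gX // eq_sym na.
rewrite mulrA -[_ * lexprod g s * _]mulrA IH => [|//|b c bs cs]; last first.
  by apply: gXX; apply: sub.
rewrite -!mulrA -Xa 2![in LHS]mulrA row_right // => [|b c bs cs bc|b bs].
- by rewrite !mulrA.
- by rewrite gX ?na // eq_sym.
- by rewrite gXX ?mem_head ?sub // eq_sym na.
Qed.

(** The same when the exchanges start from the increasing order; the row of a
then acts after the later elements have been reversed. *)
Lemma lexprod_exchange s : uniq s ->
  (forall a b, a \in s -> b \in s -> a != b ->
     g a b * X a * X b = X b * X a * g a b) ->
  lexprod g s * (\prod_(a <- s) X a) = (\prod_(a <- rev s) X a) * lexprod g s.
Proof.
elim: s => [|a s IH] /=; first by rewrite !big_nil mulr1.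
case/andP => as' us gXX; rewrite rev_cons big_rcons /= big_cons.
have sub c : c \in s -> c \in a :: s by rewrite inE orbC => ->.
have na c : c \in s -> c != a by move=> cs; apply: contraNneq as' => <-.
have Xa : X a * lexprod g s = lexprod g s * X a.
  by apply: comm_lexprod => b c bs cs; rewrite gX // eq_sym na.
rewrite mulrA -[_ * lexprod g s * _]mulrA -Xa mulrA -[LHS]mulrA IH; last first.
- by move=> b c bs cs; apply: gXX; apply: sub.
- by [].
rewrite [LHS]mulrA row_left // => [|b c bs cs bc|b bs].
- by rewrite !mulrA.
- by rewrite gX ?na // eq_sym.
- by rewrite gXX ?mem_head ?sub // eq_sym na.
Qed.
End Exchange.
End LexProduct.

Section CentralFactors.
Variables (B : pzRingType) (I : eqType) (p X : I -> B).
Hypothesis pC : forall a, central (p a).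

Lemma prod_central s :
  \prod_(a <- s) (p a * X a) = (\prod_(a <- s) p a) * \prod_(a <- s) X a.
Proof.
elim: s => [|a s IH]; first by rewrite !big_nil mulr1.
by rewrite !big_cons IH mulr_central // => Y; apply/esym/comm_prod => b _;
   rewrite pC.
Qed.

Lemma prod_rev_central s : \prod_(a <- rev s) p a = \prod_(a <- s) p a.
Proof.
elim: s => [|a s IH]; first by rewrite big_nil.
by rewrite rev_cons big_rcons big_cons /= IH pC.
Qed.
End CentralFactors.

Lemma ord_index_enum n : index_enum 'I_n = enum 'I_n.
Proof. by rewrite [index_enum _]unlock enumT. Qed.

Lemma rev_enum_ord n : rev (enum 'I_n) = map (@rev_ord n) (enum 'I_n).
Proof.
apply: (inj_map val_inj); rewrite map_rev val_enum_ord -map_comp.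
apply: (@eq_from_nth _ 0%N); rewrite size_rev size_iota.
  by rewrite size_map size_enum_ord.
move=> i ni; rewrite nth_rev ?size_iota // nth_iota ?rev_ord_proof //; last first.
  by rewrite ltn_subrL (leq_ltn_trans _ ni).
by rewrite (nth_map (Ordinal ni)) ?size_enum_ord //= nth_enum_ord.
Qed.

Lemma lexprod_enum (B : pzRingType) n (F : 'I_n -> 'I_n -> B) :
  \prod_(k < n) \prod_(l < n | (k < l)%N) F k l = lexprod F (enum 'I_n).
Proof.
rewrite ord_index_enum.
have srt : sorted (fun k l : 'I_n => (k < l)%N) (enum 'I_n).
  by have := iota_ltn_sorted 0 n; rewrite -val_enum_ord sorted_map.
elim: (enum 'I_n) srt => [|a s IH] srt; first by rewrite big_nil.
have {}srt : pairwise (fun k l : 'I_n => (k < l)%N) (a :: s).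
  by rewrite -sorted_pairwise // => k l m; apply: ltn_trans.
have /= /andP[/allP a_lt ps] := srt; rewrite big_cons big_cons ltnn.
congr (_ * _).
  rewrite big_seq_cond [RHS]big_seq; apply: eq_bigl => l.
  by case ls: (l \in s) => //=; rewrite a_lt.
rewrite -IH; last by rewrite sorted_pairwise // => k l m; apply: ltn_trans.
apply: eq_big_seq => k ks; rewrite big_cons ifN // -leqNgt.
exact: ltnW (a_lt _ ks).
Qed.

Section GridExchange.
Variables (B : pzRingType) (I J : eqType).
Variables (g : I -> J -> B) (X : I -> B) (Y : J -> B).
Hypotheses (gX : forall a l b, b != a -> g a l * X b = X b * g a l)
  (gY : forall a l m, m != l -> g a l * Y m = Y m * g a l)
  (gXY : forall a l, g a l * X a * Y l = Y l * X a * g a l).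

(** Each g a l moves X a past Y l; the product over l moves X a past all of the
Y l, and the product over a then does so for one X a after the other. *)
Lemma grid_exchange (s : seq I) (t : seq J) : uniq s -> uniq t ->
  (\prod_(a <- s) \prod_(l <- t) g a l)
    * ((\prod_(a <- s) X a) * \prod_(l <- rev t) Y l) =
  (\prod_(l <- rev t) Y l) * (\prod_(a <- s) X a)
    * \prod_(a <- s) \prod_(l <- t) g a l.
Proof.
move=> us ut; elim: s us => [|a s IH] /=.
  by rewrite !big_nil !mul1r !mulr1.
case/andP => as' us; rewrite !big_cons.
have na c : c \in s -> c != a by move=> cs; apply: contraNneq as' => <-.
have Xa : X a * (\prod_(b <- s) \prod_(l <- t) g b l)
    = (\prod_(b <- s) \prod_(l <- t) g b l) * X a.
  apply: comm_prod => b bs; apply: comm_prod => l _.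
  by rewrite gX // eq_sym na.
have ga : (\prod_(l <- t) g a l) * (\prod_(b <- s) X b)
    = (\prod_(b <- s) X b) * (\prod_(l <- t) g a l).
  apply: comm_prod => b bs; apply/esym/comm_prod => l _.
  by rewrite gX // na.
have row : (\prod_(l <- t) g a l) * X a * (\prod_(l <- rev t) Y l)
    = (\prod_(l <- rev t) Y l) * X a * (\prod_(l <- t) g a l).
  elim: t ut {IH Xa ga} => [|l t IH] /=; first by rewrite !big_nil !mulr1 mul1r.
  case/andP => lt ut; rewrite rev_cons !big_rcons /= !big_cons.
  have nl c : c \in t -> c != l by move=> cs; apply: contraNneq lt => <-.
  have Yl : Y l * (\prod_(j <- t) g a j) = (\prod_(j <- t) g a j) * Y l.
    by apply: comm_prod => c cs; rewrite gY // eq_sym nl.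
  have gl : g a l * (\prod_(j <- rev t) Y j) = (\prod_(j <- rev t) Y j) * g a l.
    by apply: comm_prod => c; rewrite mem_rev => cs; rewrite gY // nl.
  rewrite mulrA -[g a l * _ * X a]mulrA -[g a l * _ * _]mulrA IH // -!mulrA -Yl.
  by rewrite [in LHS]mulrA gl -!mulrA; congr (_ * _); rewrite !mulrA gXY.
rewrite -!mulrA [X in _ * X]mulrA -Xa -!mulrA IH // !mulrA row.
by rewrite -!mulrA; congr (_ * (_ * _)); rewrite !mulrA ga.
Qed.
End GridExchange.

(** * Reordering and regularity of products of solutions of the Yang-Baxter equation *)

Section Reordering.
Variables (B : pzRingType) (I : eqType) (r : I -> I -> B).
Hypothesis rYB : forall a b c, a != b -> a != c -> b != c ->
  r a b * r a c * r b c = r b c * r a c * r a b.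
Hypothesis rC : forall a b c d, a != c -> a != d -> b != c -> b != d ->
  r a b * r c d = r c d * r a b.
Implicit Types (s t : seq I).

Let row_swap a b s : uniq [:: a, b & s] ->
  r a b * ((\prod_(c <- s) r a c) * (\prod_(c <- s) r b c)) =
  (\prod_(c <- s) r b c) * (\prod_(c <- s) r a c) * r a b.
Proof.
elim: s => [|c s IH]; first by rewrite !big_nil !mulr1 !mul1r.
rewrite /= !inE !negb_or => /andP[/and3P[ab ac as'] /andP[/andP[bc bs] /andP[cs us]]].
rewrite !big_cons.
have ne d (x : I) : x \notin s -> d \in s -> x != d.
  by move=> xs ds; apply: contraNneq xs => ->.
have [ba ca cb] : [/\ b != a, c != a & c != b] by split; rewrite eq_sym.
have c1 : (\prod_(d <- s) r a d) * r b c = r b c * (\prod_(d <- s) r a d).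
  by apply/esym/comm_prod => d ds; apply: rC => //; apply: ne.
have c2 : (\prod_(d <- s) r b d) * r a c = r a c * (\prod_(d <- s) r b d).
  by apply/esym/comm_prod => d ds; apply: rC => //; apply: ne.
rewrite -!mulrA [X in _ * (_ * X)]mulrA c1 -!mulrA 2!mulrA rYB //.
rewrite -!mulrA IH /= ?inE ?negb_or ?ab ?as' ?bs //.
by rewrite -!mulrA; congr (_ * _); rewrite !mulrA c2.
Qed.

Let lex_pair a b s : uniq [:: a, b & s] ->
  lexprod r [:: a, b & s] =
  (\prod_(c <- s) r b c) * (\prod_(c <- s) r a c) * lexprod r s * r a b.
Proof.
move=> u; have /= := u.
rewrite inE negb_or => /andP[/andP[ab as'] /andP[bs us]].
have ne d (x : I) : x \notin s -> d \in s -> x != d.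
  by move=> xs ds; apply: contraNneq xs => ->.
rewrite big_cons -[RHS]mulrA -[lexprod r s * _]comm_lexprod => [|c d cs ds].
  by rewrite !mulrA -[_ * _ * (\prod_(_ <- s) _)]mulrA row_swap.
by rewrite rC // ne.
Qed.

(** Within the rows of a and b every pair of factors r a c, r b c can be moved
through r a b, so that this factor can also be put at the right end. *)
Lemma lexprod_right_factor s a b t : uniq (s ++ [:: a, b & t]) ->
  exists H, lexprod r (s ++ [:: a, b & t]) = H * r a b.
Proof.
elim: s => [|c s IH] u.
  by rewrite [_ ++ _]/= lex_pair //; eexists.
have /andP[_ /IH[H]] := u => e.
by rewrite /= e mulrA; eexists.
Qed.

(** By the Yang-Baxter equation the factor r b a can be carried through the rows
of all the elements of s, exchanging a and b in each of them. *)
Lemma lexprod_swap s a b t : uniq (s ++ [:: a, b & t]) ->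
  r b a * lexprod r (s ++ [:: a, b & t]) =
  lexprod r (s ++ [:: b, a & t]) * r a b.
Proof.
elim: s => [|c s IH] u.
  rewrite [_ ++ _]/= [_ ++ _]/= lex_pair //= big_cons !mulrA; do 3 congr (_ * _).
have [cs us] : c \notin s ++ [:: a, b & t] /\ uniq (s ++ [:: a, b & t]).
  by apply/andP.
have e := IH us; rewrite /=.
have : r b a * (\prod_(d <- s ++ [:: a, b & t]) r c d)
     = (\prod_(d <- s ++ [:: b, a & t]) r c d) * r b a.
  move: us; rewrite cat_uniq /= inE !negb_or.
  case/and3P => _ /and3P[as' bs _] /andP[/andP[ab at'] /andP[bt _]].
  move: cs; rewrite mem_cat !inE !negb_or => /and4P[cs ca cb ct].
  have ne d (x : I) (t' : seq I) : x \notin t' -> d \in t' -> x != d.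
    by move=> xs ds; apply: contraNneq xs => ->.
  have [ba ac bc] : [/\ b != a, a != c & b != c] by split; rewrite eq_sym.
  rewrite !big_cat !big_cons /= mulrA comm_prod => [|d ds]; last first.
    by apply: rC => //; apply: (ne _ _ s).
  rewrite -[RHS]mulrA -[LHS]mulrA; congr (_ * _).
  rewrite !mulrA -(rYB cb ca) 1?eq_sym // -!mulrA; do 2 congr (_ * _).
  by apply: comm_prod => d dt; apply: rC => //; apply: (ne _ _ t).
by move=> e'; rewrite mulrA e' -mulrA e mulrA.
Qed.

(** Factors with disjoint pairs of indices commute, hence the lexicographic order
can be traded for the order by the second index. *)
Lemma lexprod_rcons s l : uniq (rcons s l) ->
  lexprod r (rcons s l) = lexprod r s * \prod_(k <- s) r k l.
Proof.
elim: s => [|a s IH] /=; first by rewrite !big_nil !mulr1.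
rewrite mem_rcons inE negb_or => /andP[/andP[al as'] /[dup] us /IH ->].
move: us; rewrite rcons_uniq => /andP[ls _].
have ne d (x : I) : x \notin s -> d \in s -> x != d.
  by move=> xs ds; apply: contraNneq xs => ->.
rewrite big_rcons big_cons /= -!mulrA; congr (_ * _); rewrite !mulrA.
congr (_ * _); apply: comm_lexprod => b c bs cs.
by rewrite rC // ne.
Qed.

End Reordering.

Section Fusion.
Variables (B : pzRingType) (I : eqType) (P u : I -> I -> B) (reg : B -> Prop).
Hypotheses (reg1 : reg 1) (regM : forall X Y, reg X -> reg Y -> reg (X * Y))
  (regB : forall X Y, reg X -> reg Y -> reg (X - Y))
  (regP : forall a b, reg (P a b)).
Hypothesis uC : forall a b, central (u a b).
Hypotheses (PP : forall a b, P a b * P a b = 1)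
  (PC : forall a b c d, a != c -> a != d -> b != c -> b != d ->
     P a b * P c d = P c d * P a b)
  (Pcycle : forall a b c, a != b -> a != c -> b != c ->
     P a c * P b c = P a b * P a c).
Let r a b := 1 - u a b * P a b.
Hypothesis rYB : forall a b c, a != b -> a != c -> b != c ->
  r a b * r a c * r b c = r b c * r a c * r a b.

Lemma one_sub_comm a b c d : a != c -> a != d -> b != c -> b != d ->
  r a b * r c d = r c d * r a b.
Proof.
move=> ac ad bc bd; rewrite !mul2_1B (mulr_central _ _ _ (uC c d)).
rewrite (mulr_central _ _ _ (uC a b)) PC // [u c d * u a b]uC.
by rewrite [u a b * P a b + _]addrC.
Qed.

Let regD X Y : reg X -> reg Y -> reg (X + Y).
Proof.
move=> rX rY; rewrite -[Y]opprK -[- Y]sub0r -(subrr 1).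
by apply: regB rX _; apply: regB rY; apply: regB.
Qed.

(** The basic cancellation of the fusion procedure.  If Y is antisymmetric in a
and b then the pole of the factor for (a, l) cancels against the next factor
for (b, l), provided the parameters of a and b differ by one. *)
Lemma antisymmetric_cancel Y a b l : a != b -> a != l -> b != l ->
  Y * P a b = - Y -> u a l * u b l = u b l - u a l ->
  Y * r a l * r b l = Y - u b l * (Y * P a l + Y * P b l).
Proof.
move=> ab al bl Ya e; rewrite -mulrA mul2_1B (mulr_central _ _ _ (uC b l)) Pcycle //.
rewrite mulrDr mulrBr mulr1 mulrDr.
have uY c d X : Y * (u c d * X) = u c d * (Y * X).
  by rewrite mulrA -uC mulrA.
have -> : Y * (u a l * u b l * (P a b * P a l)) =
    u a l * (Y * P a l) - u b l * (Y * P a l).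
  rewrite -[u a l * u b l * _]mulrA !uY [Y * (_ * _)]mulrA Ya mulNr.
  rewrite [u a l * (u b l * _)]mulrA e.
  by rewrite mulrN mulrBl opprB.
rewrite !uY mulrDr [X in Y - X + _]addrC !opprD !addrA subrK.
by rewrite addrAC.
Qed.

(** A criterion for the product to be regular although some of its factors are
not: a singular factor for (a, l) must be followed by a regular one for (b, l),
where b is the next element after a and the parameter of b is that of a minus
one.  Adding the elements of w one at a time on the right, the product over the
previous elements is antisymmetric in a and b, hence the two factors combine. *)
Lemma fusion_regular w : uniq w ->
  (forall s a b t, w = s ++ [:: a, b & t] -> reg (r a b)) ->
  (forall s a b t l, w = s ++ [:: a, b & t] -> l \in t ->
     reg (r a l) \/
     [/\ u a b = 1, reg (u b l) & u a l * u b l = u b l - u a l]) ->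
  reg (lexprod r w).
Proof.
move=> uw next sing.
suff H v t : w = v ++ t -> reg (lexprod r v) by apply: (H w [::]); rewrite cats0.
elim/last_ind: v t => [|v l IH] t ew //.
have rC := one_sub_comm.
have uvl : uniq (rcons v l) by move: uw; rewrite ew cat_uniq => /andP[].
rewrite lexprod_rcons //; move: uvl; rewrite rcons_uniq => /andP[lv uv].
have {IH} regv : reg (lexprod r v) by apply: (IH (l :: t)); rewrite ew cat_rcons.
have H n v1 v2 : (size v2 <= n)%N -> v = v1 ++ v2 ->
    reg (lexprod r v * \prod_(k <- v1) r k l) ->
    reg (lexprod r v * \prod_(k <- v) r k l).
  elim: n v1 v2 => [|n IH] v1 v2.
    by rewrite leqn0 size_eq0 => /eqP -> ->; rewrite cats0.
  case: v2 => [|a v2] sz ev regY; first by rewrite [X in \prod_(_ <- X) _]ev cats0.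
  have step : reg (r a l) -> reg (lexprod r v * \prod_(k <- v) r k l).
    move=> ral; apply: (IH (rcons v1 a) v2) => //; first by rewrite cat_rcons.
    by rewrite big_rcons /= mulrA; apply: regM.
  case: v2 sz ev step => [|b v2] sz ev step.
    by apply/step/(next v1 a l t); rewrite ew ev cat_rcons -catA.
  have eab : w = v1 ++ [:: a, b & v2 ++ l :: t] by rewrite ew ev cat_rcons -catA.
  (* Only the pair of factors for (a, l) and (b, l) is regular in the second
     case, so both of them are absorbed at once. *)
  case: (sing _ _ _ _ l eab) => [||[uab regu ul]]; first by rewrite mem_cat mem_head orbT.
    exact: step.
  have uv' : uniq (v1 ++ [:: a, b & v2]) by rewrite -ev.
  have [H eH] := lexprod_right_factor rYB rC uv'; rewrite -ev in eH.
  move: uv'; rewrite cat_uniq /= inE !negb_or.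
  case/and3P => _ /and3P[av1 bv1 _] /andP[/andP[ab _] _].
  move: lv; rewrite {1}ev mem_cat !inE !negb_or => /and4P[lv1 la lb _].
  have ne d (x : I) (t' : seq I) : x \notin t' -> d \in t' -> x != d.
    by move=> xs ds; apply: contraNneq xs => ->.
  set Y := lexprod r v * _ in regY.
  have Ya : Y * P a b = - Y.
    rewrite /Y -mulrA -[X in _ * X]comm_prod => [|k kv]; last first.
      rewrite /r mulrBl mulrBr mulr1 mul1r mulrA -uC -!mulrA PC //.
      + by rewrite (ne _ _ v1).
      + by rewrite eq_sym.
      + by rewrite (ne _ _ v1).
      + by rewrite eq_sym.
    rewrite mulrA eH -[H * _ * P a b]mulrA /r uab mul1r mulrBl mul1r PP.
    by rewrite -(opprB 1) mulrN mulNr.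
  apply: (IH (v1 ++ [:: a; b]) v2); first by apply: ltnW.
    by rewrite -catA.
  rewrite big_cat !big_cons /= big_nil mulr1 !mulrA -/Y.
  rewrite antisymmetric_cancel // 1?eq_sym //.
  by apply: regB => //; apply: regM => //; apply: regD; apply: regM.
by apply: (H (size v) [::] v) => //; rewrite big_nil mulr1.
Qed.
End Fusion.

(** * Matrices of power series of operators *)

(** A family of operators T^(r)_ab is handled as one element of the ring of
N x N matrices over the power series in 1 / x with operator coefficients.  The
coproduct then is the product of matrices, and its N x N part plays the role of
an auxiliary tensor factor C^N. *)
Section SeriesMatrices.
Variable N : nat.
Local Notation mx A := 'M[series A]_N.

Definition series_mx (A : pzRingType) (t : nat -> 'I_N -> 'I_N -> A) : mx A :=
  \matrix_(a, b) (fun r => t r a b).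

Lemma entryD (A : pzRingType) (X Y : mx A) a b r :
  (X + Y) a b r = X a b r + Y a b r.
Proof. by rewrite mxE. Qed.

Lemma entryN (A : pzRingType) (X : mx A) a b r : (- X) a b r = - X a b r.
Proof. by rewrite mxE. Qed.

Lemma entry1 (A : pzRingType) a b r : (1 : mx A) a b r = ((a == b) && (r == 0%N))%:R.
Proof. by rewrite mxE; case: (a == b); case: r. Qed.

Section Map.
Variables (A A' : pzRingType) (phi : A -> A').
Hypotheses (phiD : {morph phi : x y / x + y}) (phi1 : phi 1 = 1)
  (phiM : {morph phi : x y / x * y}).

Definition smap (X : mx A) : mx A' := map_mx (fun s r => phi (s r)) X.

Let phi0 : phi 0 = 0.
Proof. by apply: (addrI (phi 0)); rewrite -phiD !addr0. Qed.
Let phi_sum I (r : seq I) (p : pred I) (F : I -> A) :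
  phi (\sum_(i <- r | p i) F i) = \sum_(i <- r | p i) phi (F i).
Proof. exact: (big_morph phi phiD phi0). Qed.

Lemma smap1 : smap 1 = 1.
Proof.
apply/matrixP => a b; rewrite !mxE.
by case: (a == b); apply/funext => -[|r].
Qed.

Lemma smapM : {morph smap : X Y / X * Y}.
Proof.
move=> X Y; apply/matrixP => a b; rewrite !mxE; apply/funext => r.
rewrite !series_sum phi_sum; apply: eq_bigr => c _.
by rewrite !mxE !seriesM phi_sum; apply: eq_bigr => i _; rewrite phiM.
Qed.

Lemma smap_prod I (r : seq I) (F : I -> mx A) :
  smap (\prod_(i <- r) F i) = \prod_(i <- r) smap (F i).
Proof. exact: (big_morph smap smapM smap1). Qed.

End Map.

Section Scalars.
Variables (K : fieldType) (d : nat).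
Implicit Types (f g : series K) (X : mx 'M[K]_d) (A : 'M[K]_d).

(** Scalar series, and operators that act on the tensor factors only. *)
Definition scal f : mx 'M[K]_d := ((fun r => (f r)%:M) : series 'M[K]_d)%:M.
Definition phys A : mx 'M[K]_d := (scst A)%:M.

Let scal_coef f a b r : scal f a b r = (a == b)%:R *: (f r)%:M.
Proof.
by rewrite !mxE; case: (a == b); rewrite ?scale1r ?scale0r ?mulr0n ?mulr1n.
Qed.

Lemma scal_entry f X a b r : (scal f * X) a b r =
  \sum_(i < r.+1) f i *: X a b (r - i)%N.
Proof.
rewrite [_ * X]mul_scalar_mx mxE seriesM.
by apply: eq_bigr => i _; rewrite [LHS]mul_scalar_mx.
Qed.

Let mulE (X : mx 'M[K]_d) S a b : (X * S%:M) a b = X a b * S.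
Proof.
rewrite [LHS]mxE (bigD1 b) //= !mxE eqxx mulr1n big1 ?addr0 // => c /negbTE cb.
by rewrite !mxE cb mulr0n mulr0.
Qed.

Lemma scal_central f : central (scal f).
Proof.
move=> X; apply/matrixP => a b; apply/funext => r; rewrite scal_entry mulE.
rewrite [RHS]smul_rev; apply: eq_bigr => i _.
by rewrite [RHS]mul_mx_scalar.
Qed.

Lemma scalM f g : scal (f * g) = scal f * scal g.
Proof.
apply/matrixP => a b; apply/funext => r; rewrite scal_entry scal_coef.
under eq_bigr => i _ do rewrite scal_coef scalerA mulrC -scalerA.
rewrite -scaler_sumr seriesM raddf_sum; congr (_ *: _).
by apply: eq_bigr => i _ /=; rewrite scale_scalar_mx.
Qed.

Lemma scal1 : scal 1 = 1.
Proof.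
apply/matrixP => a b; apply/funext => r; rewrite scal_coef !mxE.
case: (a == b); case: r => [|r] /=; rewrite ?scale1r ?scale0r ?mulr1n ?mulr0n //.
by rewrite raddf0.
Qed.

Lemma scalD f g : scal (f + g) = scal f + scal g.
Proof.
apply/matrixP => a b; apply/funext => r; rewrite [in RHS]mxE seriesD !scal_coef.
by rewrite seriesD raddfD scalerDr.
Qed.

Lemma scalN f : scal (- f) = - scal f.
Proof.
apply/matrixP => a b; apply/funext => r; rewrite [in RHS]mxE seriesN !scal_coef.
by rewrite seriesN raddfN scalerN.
Qed.

Lemma physM A A' : phys (A *m A') = phys A * phys A'.
Proof.
by rewrite /phys [A *m A']/(A * A') scstM [RHS]mul_scalar_mx scale_scalar_mx.
Qed.

Lemma physD A A' : phys (A + A') = phys A + phys A'.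
Proof. by rewrite /phys scstD raddfD. Qed.

Lemma scstN (R : pzRingType) (x : R) : scst (- x) = - scst x.
Proof. by apply/funext => -[|r] //=; rewrite seriesN oppr0. Qed.

Lemma physN A : phys (- A) = - phys A.
Proof. by rewrite /phys scstN raddfN. Qed.

Lemma phys1 : phys 1%:M = 1.
Proof. by []. Qed.

Lemma physZ (x : K) A : phys (x *: A) = scal (scst x) * phys A.
Proof.
apply/matrixP => a b; apply/funext => r; rewrite scal_entry big_ord_recl subn0 /=.
rewrite big1 ?addr0 => [|i _]; last by rewrite /= scale0r.
rewrite ![_ _ a b]mxE; case: (a == b); last by rewrite !mulr0n scaler0.
by rewrite !mulr1n; case: r => [|r] //=; rewrite scaler0.
Qed.

Lemma phys_entry A X a b r : (phys A * X) a b r = A *m X a b r.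
Proof. by rewrite [_ * X]mul_scalar_mx mxE cstM. Qed.

Lemma entry_phys A X a b r : (X * phys A) a b r = X a b r *m A.
Proof. by rewrite mulE Mcst. Qed.

End Scalars.
End SeriesMatrices.

(** * Permutations and contractions of tensor factors *)

Section Kernels.
Variables (K : fieldType) (N m : nat).
Local Notation B := 'M[series 'M[K]_(tdim N m)]_N.
Local Notation pidx := ('I_N * midx N m)%type.
Implicit Types (p q : pidx) (k l : 'I_m) (b : rel pidx) (i j : midx N m).

(** The operator on the tensor product of an auxiliary factor C^N, which carries
the indices of the matrix, with the m-th tensor power. *)
Definition kernel_op (k : pidx -> pidx -> K) : B :=
  \matrix_(a, b) scst (opmx (fun i j => k (a, i) (b, j))).

Lemma eq_kernel_op (k k' : pidx -> pidx -> K) : k =2 k' -> kernel_op k = kernel_op k'.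
Proof.
move=> e; apply/matrixP => a b; rewrite !mxE; congr (scst _).
by apply: eq_opmx => i j.
Qed.

Lemma kernel_opM (k k' : pidx -> pidx -> K) :
  kernel_op k * kernel_op k' = kernel_op (fun p q => \sum_r k p r * k' r q).
Proof.
apply/matrixP => a b; rewrite !mxE.
transitivity (\sum_c scst (opmx (fun i j : midx N m =>
    \sum_h k (a, i) (c, h) * k' (c, h) (b, j)))).
  by apply: eq_bigr => c _; rewrite !mxE -scstM [_ * _]opmxM.
rewrite -scst_sum; congr (scst _).
apply/matrixP => i j; rewrite summxE mxE.
under eq_bigr => c _ do rewrite mxE.
by rewrite pair_big; apply: eq_bigr => -[].
Qed.

Lemma kernel_op1 : kernel_op (fun p q => (p == q)%:R) = 1.
Proof.
apply/matrixP => a b; rewrite !mxE; apply/funext => -[|r] /=; last first.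
  by case: (a == b).
rewrite (eq_opmx (K' := fun i j : midx N m => (a == b)%:R * (i == j)%:R)).
  case: (a == b).
    by rewrite -[RHS]opmx1; apply: eq_opmx => i j; rewrite mul1r.
  by apply/matrixP => i j; rewrite !mxE mul0r.
by move=> i j; rewrite xpair_eqE -mulnb natrM.
Qed.

Lemma kernel_op_scal (x : K) (u : pidx -> pidx -> K) :
  scal N (tdim N m) (scst x) * kernel_op u = kernel_op (fun p q => x * u p q).
Proof.
apply/matrixP => a b; apply/funext => r; rewrite scal_entry big_ord_recl subn0 /=.
rewrite big1 ?addr0 => [|i _]; last by rewrite scale0r.
rewrite !mxE; case: r => [|r] /=; last by rewrite scaler0.
by apply/matrixP => i j; rewrite !mxE.
Qed.

Definition rel_op b : B := kernel_op (fun p q => (b p q)%:R).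
Definition fun_op (s : pidx -> pidx) : B := rel_op (fun p q => p == s q).

Lemma eq_rel_op b b' : b =2 b' -> rel_op b = rel_op b'.
Proof. by move=> e; apply: eq_kernel_op => p q; rewrite e. Qed.

Lemma fun_op_rel_op s b : involutive s -> fun_op s * rel_op b = rel_op (fun p q => b (s p) q).
Proof.
move=> sK; rewrite [LHS]kernel_opM; apply: eq_kernel_op => p q.
rewrite (bigD1 (s p)) //= big1 ?addr0 => [|r].
  by rewrite sK eqxx mul1r.
by rewrite -(inj_eq (can_inj sK)) sK eq_sym => /negbTE ->; rewrite mul0r.
Qed.

Lemma rel_op_fun_op s b : rel_op b * fun_op s = rel_op (fun p q => b p (s q)).
Proof.
rewrite [LHS]kernel_opM; apply: eq_kernel_op => p q.
rewrite (bigD1 (s q)) //= big1 ?addr0 => [|r /negbTE ->]; last by rewrite mulr0.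
by rewrite eqxx mulr1.
Qed.

Lemma fun_op_inv s : involutive s -> fun_op s * fun_op s = 1.
Proof.
move=> sK; rewrite rel_op_fun_op -kernel_op1; apply: eq_kernel_op => p q.
by rewrite sK.
Qed.

Lemma fun_op_conj s b : involutive s ->
  fun_op s * rel_op b * fun_op s = rel_op (fun p q => b (s p) (s q)).
Proof. by move=> sK; rewrite fun_op_rel_op // rel_op_fun_op. Qed.

Definition off k (i j : midx N m) := [forall x, (x != k) ==> (i x == j x)].
Definition upd k (a : 'I_N) (i : midx N m) : midx N m :=
  [ffun x => if x == k then a else i x].

Lemma offP k i j : reflect (forall x, x != k -> i x = j x) (off k i j).
Proof.
apply: (iffP forallP) => h x; last by apply/implyP => /h ->.
by move=> xk; have /implyP/(_ xk)/eqP := h x.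
Qed.

(** The first two maps transpose the auxiliary factor with the factor k, and the
factors k and l; the last two relations are the corresponding contractions, in
which one of the two factors is dual. *)
Definition aswap k p : pidx := (p.2 k, upd k p.1 p.2).
Definition pswap k l p : pidx := (p.1, [ffun x => p.2 (tperm k l x)]).
Definition acap k p q := [&& p.2 k == p.1, q.2 k == q.1 & off k p.2 q.2].
Definition pcap l k p q := [&& p.1 == q.1, p.2 l == p.2 k, q.2 l == q.2 k
  & [forall x, (x != l) && (x != k) ==> (p.2 x == q.2 x)]].

Lemma aswapK k : involutive (aswap k).
Proof.
move=> [a i]; rewrite /aswap /= ffunE eqxx; congr (_, _).
by apply/ffunP => x; rewrite !ffunE; case: (altP (x =P k)) => // ->.
Qed.

Lemma pswapK k l : involutive (pswap k l).
Proof.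
move=> [a i]; rewrite /pswap /=; congr (_, _).
by apply/ffunP => x; rewrite !ffunE tpermK.
Qed.

(** P stands for a transposition and Q for a contraction; the suffix tells
whether the auxiliary factor is involved. *)
Definition Paux k := fun_op (aswap k).
Definition Qaux k := rel_op (acap k).
Definition Pphys k l : B := phys N (perm_op K N (tperm k l)).
Definition Qphys l k : B := phys N (pairing_op K N l k).

Lemma PphysE k l : Pphys k l = fun_op (pswap k l).
Proof.
apply/matrixP => a b; rewrite !mxE.
case: (altP (a =P b)) => [->|ab]; last first.
  rewrite mulr0n; apply/funext => -[|r] //=.
  by apply/matrixP => i j; rewrite !mxE xpair_eqE (negbTE ab).
rewrite mulr1n; congr (scst _); apply: eq_opmx => i j.
rewrite xpair_eqE eqxx /=; congr (nat_of_bool _)%:R.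
apply/forallP/eqP => [e|-> x]; last by rewrite ffunE tpermK.
by apply/ffunP => x; rewrite ffunE -[in LHS](tpermK k l x); apply/eqP.
Qed.

Lemma QphysE l k : Qphys l k = rel_op (pcap l k).
Proof.
apply/matrixP => a b; rewrite !mxE /pcap /=.
case: (a == b); last first.
  rewrite mulr0n; apply/funext => -[|r] //=.
  by apply/matrixP => i j; rewrite !mxE.
by rewrite mulr1n; congr (scst _); apply: eq_opmx => i j.
Qed.

Lemma Paux_inv k : Paux k * Paux k = 1.
Proof. exact/fun_op_inv/aswapK. Qed.
Lemma Pphys_inv k l : Pphys k l * Pphys k l = 1.
Proof. by rewrite PphysE; exact/fun_op_inv/pswapK. Qed.

Let fun_op_braid s t u : involutive s -> (forall q, u q = s (t (s q))) ->
  fun_op u = fun_op s * fun_op t * fun_op s.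
Proof.
move=> sK e; rewrite fun_op_conj //; apply: eq_rel_op => p q.
by rewrite /= e (inv_eq sK).
Qed.

Lemma Paux_braid k l : k != l -> Paux l = Paux k * Pphys k l * Paux k.
Proof.
move=> kl; rewrite PphysE; apply: fun_op_braid (aswapK k) _ => -[a i].
rewrite /aswap /pswap /= !ffunE tpermL eq_sym (negbTE kl); congr (_, _).
apply/ffunP => x; rewrite !ffunE.
case: tpermP => [->|->|/eqP/negbTE nk /eqP/negbTE nl].
- by rewrite eqxx (negbTE kl).
- by rewrite eqxx eq_sym (negbTE kl) eqxx.
- by rewrite nk nl.
Qed.

Lemma Paux_braid' k l : k != l -> Paux l = Pphys k l * Paux k * Pphys k l.
Proof.
move=> kl; rewrite PphysE; apply: fun_op_braid (pswapK k l) _ => -[a i].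
rewrite /aswap /pswap /= !ffunE tpermL; congr (_, _).
apply/ffunP => x; rewrite !ffunE.
case: tpermP => [->|->|/eqP/negbTE nk /eqP/negbTE nl].
- by rewrite (negbTE kl) eq_sym (negbTE kl) tpermR.
- by rewrite !eqxx.
- by rewrite nk nl tpermD // eq_sym ?nk ?nl.
Qed.

Lemma Qaux_braid k l : k != l -> Qaux l = Pphys k l * Qaux k * Pphys k l.
Proof.
move=> kl; rewrite PphysE fun_op_conj; last exact: pswapK.
apply: eq_rel_op => -[a i] [b j]; rewrite /acap /pswap /= !ffunE tpermL.
congr [&& _, _ & _]; apply/offP/offP => e x xk.
  rewrite !ffunE; apply: e; apply: contra_neq xk => xl.
  by rewrite -[x](tpermK k l) xl tpermR.
have := e (tperm k l x); rewrite !ffunE tpermK => -> //.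
by apply: contra_neq xk => xl; rewrite -[x](tpermK k l) xl tpermL.
Qed.

Lemma Qphys_braid k l : k != l -> Qphys l k = Paux k * Qaux l * Paux k.
Proof.
move=> kl; rewrite QphysE fun_op_conj; last exact: aswapK.
apply: eq_rel_op => -[a i] [b j]; rewrite /acap /pcap /aswap /= !ffunE.
rewrite [l == k]eq_sym (negbTE kl).
apply/and4P/and3P => [[/eqP -> -> ->] h|[-> -> /offP h]]; split=> //.
  apply/offP => x xl; rewrite !ffunE; case: ifP => // /negbT xk.
  by have /forallP/(_ x) := h; rewrite xl xk => /eqP.
- by have := h k kl; rewrite !ffunE eqxx => ->.
apply/forallP => x; apply/implyP => /andP[xl xk].
by have := h x xl; rewrite !ffunE (negbTE xk) => ->.
Qed.

Let sum_pick (c : 'I_N) (f : pred 'I_N) :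
  \sum_d ((d == c) && f d)%:R = (f c)%:R :> K.
Proof.
rewrite (bigD1 c) //= eqxx big1 ?addr0 // => d /negbTE -> //.
Qed.

Let Qaux_rel_op k b : Qaux k * rel_op b =
  kernel_op (fun p q => (p.2 k == p.1)%:R * \sum_d (b (d, upd k d p.2) q)%:R).
Proof.
rewrite [LHS]kernel_opM; apply: eq_kernel_op => -[a i] q; rewrite big_distrr /=.
transitivity (\sum_d \sum_h (acap k (a, i) (d, h))%:R * (b (d, h) q)%:R : K).
  by rewrite pair_big; apply: eq_bigr => -[].
apply: eq_bigr => d _; rewrite (bigD1 (upd k d i)) //= big1 ?addr0 => [|h ne].
  rewrite /acap /= ffunE !eqxx (_ : off k _ _) ?andbT //.
  by apply/offP => x /negbTE xk; rewrite ffunE xk.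
rewrite /acap /=; case: and3P => [[_ /eqP hk /offP e]|]; last by rewrite mul0r.
case/eqP: ne; apply/ffunP => x; rewrite ffunE.
by case: eqP => [->|/eqP xk] //; rewrite e.
Qed.

Let rel_op_Qaux k b : rel_op b * Qaux k =
  kernel_op (fun p q => (\sum_d (b p (d, upd k d q.2))%:R) * (q.2 k == q.1)%:R).
Proof.
rewrite [LHS]kernel_opM; apply: eq_kernel_op => p [a i]; rewrite big_distrl /=.
transitivity (\sum_d \sum_h (b p (d, h))%:R * (acap k (d, h) (a, i))%:R : K).
  by rewrite pair_big; apply: eq_bigr => -[].
apply: eq_bigr => d _; rewrite (bigD1 (upd k d i)) //= big1 ?addr0 => [|h ne].
  rewrite /acap /= ffunE !eqxx (_ : off k _ _) ?andbT //.
  by apply/offP => x /negbTE xk; rewrite ffunE xk.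
rewrite /acap /=; case: and3P => [[/eqP hk _ /offP e]|]; last by rewrite mulr0.
case/eqP: ne; apply/ffunP => x; rewrite ffunE.
by case: eqP => [->|/eqP xk] //; rewrite e.
Qed.

(** This and the next two relations are those of the Brauer algebra. *)
Lemma Qaux_Pphys_Qaux k l : k != l -> Qaux k * Pphys k l * Qaux k = Qaux k.
Proof.
move=> kl; rewrite -mulrA PphysE fun_op_rel_op; last exact: pswapK.
rewrite Qaux_rel_op; apply: eq_kernel_op => -[a i] [b j] /=.
rewrite (eq_bigr (fun d => ((d == i l) && ((j k == b) && off k i j))%:R)).
  by rewrite sum_pick -natrM mulnb.
move=> d _; congr (nat_of_bool _)%:R; rewrite /acap /= !ffunE tpermL.
rewrite [l == k]eq_sym (negbTE kl) [i l == d]eq_sym.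
case: eqP => //= ->; case: (j k == b) => //=.
apply/offP/offP => e x xk.
  have := e x xk; rewrite !ffunE; case: tpermP => [xk'|->|_ _].
  - by rewrite xk' eqxx in xk.
  - by rewrite eqxx.
  by rewrite (negbTE xk).
rewrite !ffunE; case: tpermP => [xk'|->|_ _].
- by rewrite xk' eqxx in xk.
- by rewrite eqxx e // eq_sym.
- by rewrite (negbTE xk) e.
Qed.

Lemma Qaux_Paux_Qaux k l : k != l -> Qaux l * Paux k * Qaux l = Qaux l.
Proof.
move=> kl; rewrite -mulrA fun_op_rel_op; last exact: aswapK.
rewrite Qaux_rel_op; apply: eq_kernel_op => -[a i] [b j] /=.
rewrite (eq_bigr (fun d => ((d == i k) && ((j l == b) && off l i j))%:R)).
  by rewrite sum_pick -natrM mulnb.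
move=> d _; congr (nat_of_bool _)%:R; rewrite /acap /aswap /= !ffunE eqxx.
rewrite (negbTE kl) [l == k]eq_sym (negbTE kl).
case: (altP (d =P i k)) => //= dk; case: (j l == b) => //=.
apply/offP/offP => e x xl.
  have := e x xl; rewrite !ffunE (negbTE xl).
  by case: (altP (x =P k)) => // ->; rewrite dk.
rewrite !ffunE (negbTE xl) -e //.
by case: (altP (x =P k)) => // ->; rewrite dk.
Qed.

Lemma Qaux_sqr k : Qaux k * Qaux k = scal N (tdim N m) (scst N%:R) * Qaux k.
Proof.
rewrite Qaux_rel_op kernel_op_scal; apply: eq_kernel_op => -[a i] [b j] /=.
rewrite (eq_bigr (fun=> ((j k == b) && off k i j)%:R)) => [|d _].
  rewrite sumr_const card_ord -[X in _ * X]mulr_natl mulrCA -natrM mulnb.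
  by rewrite /acap.
rewrite /acap /= ffunE !eqxx /=; congr (nat_of_bool (_ && _))%:R.
by apply/offP/offP => e x /[dup] xk /e <-; rewrite ffunE (negbTE xk).
Qed.

Lemma Pphys_Paux k l c : c != k -> c != l ->
  Pphys k l * Paux c = Paux c * Pphys k l.
Proof.
move=> ck cl; rewrite PphysE !rel_op_fun_op; apply: eq_rel_op => p [b j] /=.
congr (p == _); rewrite /aswap /pswap /= ffunE tpermD 1?eq_sym //; congr (_, _).
apply/ffunP => x; rewrite !ffunE.
by rewrite -[x == c](inj_eq (@perm_inj _ (tperm k l))) [tperm _ _ c]tpermD // eq_sym.
Qed.

Lemma Pphys_Qaux k l c : c != k -> c != l ->
  Pphys k l * Qaux c = Qaux c * Pphys k l.
Proof.
move=> ck cl; have tc : tperm k l c = c by rewrite tpermD // eq_sym.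
rewrite PphysE fun_op_rel_op ?rel_op_fun_op; last exact: pswapK.
apply: eq_rel_op => -[a i] [b j]; rewrite /acap /= !ffunE tc.
congr [&& _, _ & _]; apply/offP/offP => e x xc.
  rewrite !ffunE -e; last by rewrite -[c]tc (inj_eq perm_inj).
  by rewrite ffunE tpermK.
rewrite ffunE e ?ffunE ?tpermK //.
by rewrite -[c]tc (inj_eq perm_inj).
Qed.

Let comm_fun_op s b : involutive s -> (forall p q, b (s p) q -> b p (s q)) ->
  rel_op b * fun_op s = fun_op s * rel_op b.
Proof.
move=> sK h; rewrite fun_op_rel_op ?rel_op_fun_op //; apply: eq_rel_op => p q.
apply/idP/idP => [|/h //].
by rewrite -{1}[p]sK => /h; rewrite sK.
Qed.

Lemma Qphys_Paux l k c : c != l -> c != k ->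
  Qphys l k * Paux c = Paux c * Qphys l k.
Proof.
move=> cl ck; rewrite QphysE; apply: comm_fun_op (aswapK c) _ => -[a i] [b j].
rewrite /pcap /aswap /= !ffunE ![_ == c]eq_sym (negbTE cl) (negbTE ck).
move=> /and4P[ic il jl /forallP h]; apply/and4P; split=> //.
  by have := h c; rewrite cl ck !ffunE eqxx.
apply/forallP => x; have := h x; rewrite !ffunE.
by case: (altP (x =P c)) => [->|_] //; rewrite (eqP ic) eqxx implybT.
Qed.

(** Composing with the contraction in the auxiliary factor and c leaves a sum over
the index that runs through the factor c, of which the contraction in l and k
picks a single term. *)
Lemma Qphys_Qaux l k c : c != l -> c != k ->
  Qphys l k * Qaux c = Qaux c * Qphys l k.
Proof.
move=> cl ck; rewrite QphysE Qaux_rel_op rel_op_Qaux; apply: eq_kernel_op => -[a i] [b j] /=.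
pose e := [&& i l == i k, j l == j k &
  [forall x, [&& x != l, x != k & x != c] ==> (i x == j x)]].
have capE (f g : midx N m) :
    (forall x, x != c -> f x = i x) -> (forall x, x != c -> g x = j x) ->
    [&& f l == f k, g l == g k
      & [forall x, (x != l) && (x != k) ==> (f x == g x)]] = (f c == g c) && e.
  have [lc kc] : l != c /\ k != c by split; rewrite eq_sym.
  move=> fi gj; rewrite (fi l) // (fi k) // (gj l) // (gj k) //.
  apply/and3P/idP => [[il jl /forallP h]|/andP[fg /and3P[il jl /forallP h]]].
    have := h c; rewrite cl ck /= => ->; rewrite /e il jl; apply/forallP => x.
    apply/implyP => /and3P[xl xk xc].
    by have := h x; rewrite xl xk fi ?gj.
  split=> //; apply/forallP => x; have := h x.
  case: (altP (x =P c)) => [->|xc]; first by rewrite fg implybT.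
  by rewrite andbT fi ?gj.
have updN d (h : midx N m) x : x != c -> upd c d h x = h x.
  by move=> /negbTE xc; rewrite ffunE xc.
have updc d (h : midx N m) : upd c d h c = d by rewrite ffunE eqxx.
rewrite (eq_bigr (fun d => ((d == a) && ((i c == d) && e))%:R)) => [|d _].
  rewrite [X in _ = _ * X](eq_bigr (fun d => ((d == b) && ((d == j c) && e))%:R)).
    rewrite !sum_pick -!natrM !mulnb [b == _]eq_sym; congr (nat_of_bool _)%:R.
    by case: (i c == a); case: (j c == b); rewrite ?andbF ?andbT.
  move=> d _; rewrite /pcap /= (capE (upd c d i) j) ?updc // => x xc.
  by rewrite updN.
rewrite /pcap /= (capE i (upd c d j)) ?updc 1?eq_sym // => x xc.
by rewrite updN.
Qed.
End Kernels.

(** * The generator matrices of the Yangian modules *)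

Section Placement.
Variables (K : fieldType) (N : nat).
Local Notation tdim := (tdim N).
Local Notation midx := (midx N).
Local Notation mx m := 'M[series 'M[K]_(tdim m)]_N.

Definition place m (k : 'I_m) (A : 'M[K]_(tdim 1)) : 'M[K]_(tdim m) :=
  opmx (fun i j : midx m =>
    A (enum_rank ([ffun=> i k] : midx 1)) (enum_rank ([ffun=> j k] : midx 1))
    * (off k i j)%:R).

Lemma placeD m (k : 'I_m) A A' : place k (A + A') = place k A + place k A'.
Proof. by apply/matrixP => i j; rewrite !mxE mulrDl. Qed.

Lemma placeZ m (k : 'I_m) x A : place k (x *: A) = x *: place k A.
Proof. by apply/matrixP => i j; rewrite !mxE mulrA. Qed.

Lemma place1 m (k : 'I_m) : place k 1%:M = 1%:M.
Proof.
rewrite -[RHS]opmx1; apply: eq_opmx => i j; rewrite !mxE (inj_eq enum_rank_inj).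
rewrite -natrM mulnb; congr (nat_of_bool _)%:R.
apply/andP/eqP => [[/eqP e /offP h]|->]; last by split=> //; apply/offP.
apply/ffunP => x; case: (altP (x =P k)) => [->|/h //].
by move/ffunP/(_ ord0): e; rewrite !ffunE.
Qed.

Lemma place_ord0 A : place (ord0 : 'I_1) A = A.
Proof.
rewrite [RHS]opmx_ent; apply: eq_opmx => i j.
have c (h : midx 1) : [ffun=> h ord0] = h.
  by apply/ffunP => x; rewrite ffunE (ord1 x).
rewrite !c (_ : off _ _ _) ?mulr1 //.
by apply/offP => x; rewrite (ord1 x).
Qed.

Lemma place_lshift m k (x : 'I_m) A :
  tenmx (place x A) (1%:M : 'M_(tdim k)) = place (lshift k x) A.
Proof.
apply: eq_opmx => i j; rewrite !mxE !enum_rankK !ffunE (inj_eq enum_rank_inj).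
rewrite -mulrA -natrM mulnb; congr (_ * (nat_of_bool _)%:R).
apply/andP/offP => [[/offP h /eqP e] y|h].
  rewrite -[y]splitK; case: (split y) => z /= zx.
    by have := h z; rewrite !ffunE; apply; apply: contraNneq zx => ->.
  by move/ffunP/(_ z): e; rewrite !ffunE.
split; first by apply/offP => y yx; rewrite !ffunE h // (inj_eq (@lshift_inj _ _)).
by apply/eqP/ffunP => y; rewrite !ffunE h // eq_rlshift.
Qed.

Lemma place_rshift m k (x : 'I_k) A :
  tenmx (1%:M : 'M_(tdim m)) (place x A) = place (rshift m x) A.
Proof.
apply: eq_opmx => i j; rewrite !mxE !enum_rankK !ffunE (inj_eq enum_rank_inj).
rewrite mulrC -mulrA -natrM mulnb; congr (_ * (nat_of_bool _)%:R).
apply/andP/offP => [[/offP h /eqP e] y|h].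
  rewrite -[y]splitK; case: (split y) => z /= zx.
    by move/ffunP/(_ z): e; rewrite !ffunE.
  by have := h z; rewrite !ffunE; apply; apply: contraNneq zx => ->.
split; first by apply/offP => y yx; rewrite !ffunE h // (inj_eq (@rshift_inj _ _)).
by apply/eqP/ffunP => y; rewrite !ffunE h // eq_lrshift.
Qed.

Lemma unit_op_tr (a b : 'I_N) : (unit_op K b a)^T = unit_op K a b.
Proof. by apply/matrixP => i j; rewrite !mxE andbC. Qed.

Lemma Paux_entry m (k : 'I_m) a b : Paux K N k a b = scst (place k (unit_op K b a)).
Proof.
rewrite mxE; congr (scst _); apply: eq_opmx => i j.
rewrite mxE !enum_rankK !ffunE -natrM mulnb; congr (nat_of_bool _)%:R.
rewrite /aswap /= xpair_eqE.
apply/andP/andP => [[/eqP -> /eqP ->]|[/andP[/eqP ik /eqP jk] /offP h]].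
  rewrite ffunE !eqxx; split=> //.
  by apply/offP => x /negbTE xk; rewrite ffunE xk.
rewrite jk eqxx; split=> //; apply/eqP/ffunP => x; rewrite ffunE.
by case: eqP => [->|/eqP /h].
Qed.

Lemma Qaux_entry m (k : 'I_m) a b : Qaux K N k a b = scst (place k (unit_op K a b)).
Proof.
rewrite mxE; congr (scst _); apply: eq_opmx => i j.
by rewrite mxE !enum_rankK !ffunE -natrM mulnb /acap /= andbA.
Qed.

Lemma scal_scst m f (X : mx m) M a b r : X a b = scst M ->
  (scal N (tdim m) f * X) a b r = f r *: M.
Proof.
move=> e; rewrite scal_entry big_ord_recr /= subnn e big1 ?add0r // => i _.
rewrite /=; have := subn_gt0 i r; rewrite ltn_ord.
by case: (r - i)%N => //= n _; rewrite scaler0.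
Qed.

(** The expansion of 1 / (x - z) in powers of 1 / x. *)
Definition pole_series (z : K) : series K := fun r => if r is r'.+1 then z ^+ r' else 0.

(** The partial fraction decomposition of 1 / ((x - z) (x - w)). *)
Lemma pole_series_diff z w :
  pole_series z - pole_series w = scst (z - w) * (pole_series z * pole_series w).
Proof.
apply/funext => r; rewrite cstM seriesD seriesN seriesM.
case: r => [|r]; first by rewrite big_ord1 /= mul0r mulr0 subrr.
rewrite big_ord_recl mul0r add0r big_ord_recr /= subSS subnn mulr0 addr0.
rewrite subrXX; congr (_ * _); rewrite [RHS](reindex_inj rev_ord_inj) /=.
apply: eq_bigr => i _; rewrite subSS.
have ir : (i < r)%N := ltn_ord i.
rewrite (_ : (r - (r - i.+1))%N = i.+1) ?subKn //.
by rewrite /bump /= -subn1 -subnDA add1n.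
Qed.

Lemma series_inv (f : series K) : f 0%N = 1 -> exists g, g * f = 1.
Proof.
move=> f0; pose t r (a b : 'I_1) := f r.
have t0 a b : t 0%N a b = (a == b)%:R by rewrite /t f0 !ord1.
exists (fun r => gen_inv t r ord0 ord0).
have /matrixP/(_ ord0 ord0) := gen_inv_l t0.
by rewrite !mxE big_ord1 !mxE.
Qed.

Section OneModule.
Variables (d : nat) (V : ymodule K N d).

(** The matrix of the series by which the T_ab(x) act. *)
Definition gen_mx : 'M[series 'M[K]_d]_N := series_mx (fun r a b => V (ygen K r a b)).

Lemma yact1 : V 1 = 1. Proof. by case: (yact_monoid V). Qed.
Lemma yactM : {morph V : x y / x * y}. Proof. by case: (yact_monoid V). Qed.
Lemma yactD : {morph V : x y / x + y}.
Proof. by move=> x y; have := yact_linear V 1 x y; rewrite !scale1r. Qed.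

Lemma gen_mx_antipode :
  gen_mx * series_mx (fun r a b => V (antipode (ygen K r a b))) = 1.
Proof.
have [y0 _] := ygen_rel K N.
have e : series_mx (@ygen K N) * series_mx (@ygen_inv K N) = 1 := gen_inv_r y0.
rewrite -(smap1 N yactD yact1) -e (smapM yactD yactM); congr (_ * _).
  by apply/matrixP => a b; rewrite !mxE.
apply/matrixP => a b; rewrite !mxE; apply/funext => r.
by rewrite antipode_gen.
Qed.
End OneModule.

Lemma intertwiner_gen d d' (V : ymodule K N d) (W : ymodule K N d') A :
  (forall r a b, A *m gen_mx V a b r = gen_mx W a b r *m A) -> yintertwiner V W A.
Proof.
move=> h; have VZ (c : K) U e (M : ymodule K N e) : M (c *: U) = c *: M U.
  have := yact_linear M c U 0; rewrite !addr0 => ->.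
  suff -> : M 0 = 0 by rewrite addr0.
  by apply: (addrI (M 0)); rewrite -yactD !addr0.
move=> y; elim/yangian_ind: y => [r a b|c|p q hp hq|p q hp hq].
- by have := h r a b; rewrite !mxE.
- by rewrite !VZ !yact1 -scalemxAr -scalemxAl [_ *m 1]mulmx1 [1 *m _]mul1mx.
- by rewrite !yactD mulmxDl mulmxDr hp hq.
- by rewrite !yactM [_ * _]/(_ *m _) [X in _ = X *m _]/(_ *m _) mulmxA hp -mulmxA hq mulmxA.
Qed.

(** The contribution of the module V in the factor k of a tensor product. *)
Definition factor_mx m (k : 'I_m) (V : ymodule K N (tdim 1)) : mx m :=
  series_mx (fun r a b => place k (V (ygen K r a b))).

Lemma factor_mx_eval m (k : 'I_m) z :
  factor_mx k (ymod_eval N z) = 1 - scal N (tdim m) (pole_series z) * Paux K N k.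
Proof.
apply/matrixP => a b; apply/funext => r.
rewrite entryD entryN entry1 (scal_scst _ _ (Paux_entry k a b)) mxE ymod_genE.
case: r => [|r] /=.
  rewrite scale0r subr0 andbT; case: (a == b); first exact: place1.
  by apply/matrixP => i j; rewrite !mxE mul0r.
by rewrite andbF add0r -scaleN1r !placeZ scaleN1r.
Qed.

(** Since P is an involution, the inverse of 1 - P / (x - z) is proportional to
1 + P / (x - z), with the factor of proportionality kap.  Passing to the dual
space transposes the factor k, which turns P into the contraction Q. *)
Lemma factor_mx_dual z : exists kap : series K, forall m (k : 'I_m),
  factor_mx k (ymod_dual (ymod_eval N z)) =
  scal N (tdim m) kap * (1 + scal N (tdim m) (pole_series z) * Qaux K N k).
Proof.
have [|kap kapE] := @series_inv (1 - pole_series z * pole_series z).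
  by rewrite seriesD seriesN seriesM big_ord1 /= mul0r subr0.
exists kap => m k; set V := ymod_eval N z.
pose X : mx 1 := series_mx (fun r a b => V (antipode (ygen K r a b))).
have tV : gen_mx V = 1 - scal N (tdim 1) (pole_series z) * Paux K N (ord0 : 'I_1).
  rewrite -factor_mx_eval; apply/matrixP => a b; rewrite !mxE.
  by apply/funext => r; rewrite place_ord0.
have XE : X = scal N (tdim 1) kap
    * (1 + scal N (tdim 1) (pole_series z) * Paux K N (ord0 : 'I_1)).
  have cl : central (scal N (tdim 1) (pole_series z)) by exact: scal_central.
  have e : (1 + scal N (tdim 1) (pole_series z) * Paux K N (ord0 : 'I_1)) * gen_mx V =
      scal N (tdim 1) (1 - pole_series z * pole_series z).
    rewrite tV mulrBr mulr1 mulrDl mul1r (mulr_central _ _ _ cl) Paux_inv.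
    rewrite mulr1 opprD addrA addrK; apply/esym.
    rewrite [LHS]scalD [X in X + _]scal1 [X in _ + X]scalN.
    by congr (_ - _); exact: scalM.
  have e2 : gen_mx V * X = 1 := gen_mx_antipode V.
  transitivity (scal N (tdim 1) (kap * (1 - pole_series z * pole_series z)) * X).
    by rewrite kapE scal1 mul1r.
  by rewrite scalM -e -!mulrA e2 mulr1.
have ent m' (k' : 'I_m') (Z : mx m') M a b r : Z a b = scst M ->
    (scal N (tdim m') kap * (1 + scal N (tdim m') (pole_series z) * Z)) a b r
    = ((a == b)%:R * kap r) *: 1%:M + (kap * pole_series z) r *: M.
  move=> e; rewrite mulrDr mulr1 mulrA -scalM entryD (scal_scst _ _ e).
  congr (_ + _); rewrite mxE -scalerA scalemx1.
  by case: (a == b); rewrite ?scale1r ?scale0r.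
apply/matrixP => a b; apply/funext => r.
rewrite (ent _ k _ _ _ _ _ (Qaux_entry k a b)) mxE /= /dual_act.
have := congr1 (fun Z : mx 1 => Z a b r) XE.
rewrite (ent _ ord0 _ _ _ _ _ (Paux_entry ord0 a b)) mxE => ->.
by rewrite place_ord0 linearD !linearZ /= trmx1 unit_op_tr placeD !placeZ place1.
Qed.

Lemma gen_mx_tensor2 m k (V : ymodule K N (tdim m)) (W : ymodule K N (tdim k)) :
  gen_mx (ymod_tensor2 V W) =
  smap (fun A => tenmx A (1%:M : 'M_(tdim k))) (gen_mx V)
  * smap (fun A => tenmx (1%:M : 'M_(tdim m)) A) (gen_mx W).
Proof.
apply/matrixP => a b; apply/funext => r; rewrite !mxE ymod_genE series_sum.
apply: eq_bigr => c _; rewrite !mxE seriesM; apply: eq_bigr => i _.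
by rewrite [RHS]tenmxM mulmx1 mul1mx.
Qed.

Section TensorMaps.
Variables m k : nat.
Let tl (A : 'M[K]_(tdim m)) := tenmx A (1%:M : 'M_(tdim k)).
Let tr (A : 'M[K]_(tdim k)) := tenmx (1%:M : 'M_(tdim m)) A.
Let tlD : {morph tl : A A' / A + A'}.
Proof. by move=> A A'; exact: tenmxDl. Qed.
Let tlM : {morph tl : A A' / A * A'}.
Proof. by move=> A A'; rewrite [RHS]tenmxM mul1mx. Qed.
Let trD : {morph tr : A A' / A + A'}.
Proof. by move=> A A'; exact: tenmxDr. Qed.
Let trM : {morph tr : A A' / A * A'}.
Proof. by move=> A A'; rewrite [RHS]tenmxM mul1mx. Qed.

Lemma smap_factor_l (x : 'I_m) V : smap tl (factor_mx x V) = factor_mx (lshift k x) V.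
Proof.
apply/matrixP => a b; rewrite !mxE; apply/funext => r.
exact: place_lshift.
Qed.
Lemma smap_factor_r (x : 'I_k) V : smap tr (factor_mx x V) = factor_mx (rshift m x) V.
Proof.
apply/matrixP => a b; rewrite !mxE; apply/funext => r.
exact: place_rshift.
Qed.

Lemma smapM_l (X Y : mx m) : smap tl (X * Y) = smap tl X * smap tl Y.
Proof. by move: X Y; apply: smapM; [exact: tlD | exact: tlM]. Qed.
Lemma smapM_r (X Y : mx k) : smap tr (X * Y) = smap tr X * smap tr Y.
Proof. by move: X Y; apply: smapM; [exact: trD | exact: trM]. Qed.
Lemma smap_prod_l I (s : seq I) (F : I -> mx m) :
  smap tl (\prod_(x <- s) F x) = \prod_(x <- s) smap tl (F x).
Proof. by apply: smap_prod; [exact: tlD | exact: tenmx1 | exact: tlM]. Qed.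
Lemma smap_prod_r I (s : seq I) (F : I -> mx k) :
  smap tr (\prod_(x <- s) F x) = \prod_(x <- s) smap tr (F x).
Proof. by apply: smap_prod; [exact: trD | exact: tenmx1 | exact: trM]. Qed.
End TensorMaps.

Lemma gen_mx_tensor m (V : 'I_m -> ymodule K N (tdim 1)) :
  gen_mx (ymod_tensor V) = \prod_(k < m) factor_mx k (V k).
Proof.
elim: m V => [|m IH] V.
  rewrite big_ord0; apply/matrixP => a b; apply/funext => r.
  rewrite !mxE ymod_genE /=; case: (a == b); case: r => [|r] //=.
apply: etrans (gen_mx_tensor2 (V ord0) (ymod_tensor (fun k => V (lift ord0 k)))) _.
rewrite IH smap_prod_r big_ord_recl.
congr (_ * _).
  have -> : gen_mx (V ord0) = factor_mx (ord0 : 'I_1) (V ord0).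
    by apply/matrixP => a b; rewrite !mxE; apply/funext => r; rewrite place_ord0.
  by rewrite smap_factor_l; congr (factor_mx _ _); apply: val_inj.
apply: eq_bigr => k _; rewrite smap_factor_r; congr (factor_mx _ _); exact: val_inj.
Qed.

Lemma gen_mx_tensor_pair m k (V : 'I_m -> ymodule K N (tdim 1))
    (W : 'I_k -> ymodule K N (tdim 1)) :
  gen_mx (ymod_tensor2 (ymod_tensor V) (ymod_tensor W)) =
  (\prod_(x < m) factor_mx (lshift k x) (V x)) * \prod_(x < k) factor_mx (rshift m x) (W x).
Proof.
rewrite gen_mx_tensor2 !gen_mx_tensor smap_prod_l smap_prod_r.
by congr (_ * _); apply: eq_bigr => x _; rewrite ?smap_factor_l ?smap_factor_r.
Qed.

End Placement.

(** * Exchange relations between tensor factors *)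

Section Exchange.
Variables (K : fieldType) (N m : nat).
Local Notation tdim := (tdim N).
Local Notation mx := 'M[series 'M[K]_(tdim m)]_N.
Local Notation sc f := (scal N (tdim m) f).
Local Notation L k z := (factor_mx k (ymod_eval N z)).
Local Notation D k z := (factor_mx k (ymod_dual (ymod_eval N z))).
Implicit Types (k l c : 'I_m) (z w x : K).

(** The R-matrix, where 1/x is the spectral parameter, and its image under
transposition of the factor l. *)
Definition rmx x k l : mx := phys N (1 - x *: perm_op K N (tperm k l)).
Definition qmx x l k : mx := phys N (1 - x *: pairing_op K N l k).

Let scC (f : series K) : central (sc f). Proof. exact: scal_central. Qed.

Lemma rmxE x k l : rmx x k l = 1 - sc (scst x) * Pphys K N k l.
Proof. by rewrite /rmx physD physN physZ. Qed.

Lemma qmxE x l k : qmx x l k = 1 - sc (scst x) * Qphys K N l k.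
Proof. by rewrite /qmx physD physN physZ. Qed.

Let pole_series_frac x z w : x * (w - z) = 1 ->
  scst x * pole_series w - scst x * pole_series z = pole_series w * pole_series z.
Proof.
move=> e; have := mul1r (pole_series w * pole_series z); rewrite series1 -e => <-.
by rewrite [scst (x * _)]scstM -mulrA -pole_series_diff mulrBr.
Qed.

Let pole_seriesC z w : pole_series z * pole_series w = pole_series w * pole_series z.
Proof.
apply/funext => r; rewrite [RHS]smul_rev.
by apply: eq_bigr => i _; rewrite mulrC.
Qed.

Lemma rmx_eval x z w k l : k != l -> x * (z - w) = 1 ->
  rmx x k l * L l w * L k z = L k z * L l w * rmx x k l.
Proof.
move=> kl xzw; rewrite !factor_mx_eval rmxE; apply: yang_baxter (scC _) (scC _) (scC _) _ _ _ _ _.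
- rewrite -!scalM -scalD; congr (scal _ _ _).
  by rewrite [pole_series w * _]pole_seriesC -(pole_series_frac xzw) addrC subrK.
- exact: Pphys_inv.
- exact: Paux_inv.
- exact: Paux_braid'.
- exact: Paux_braid.
Qed.

Local Notation U k z := (1 + sc (pole_series z) * Qaux K N k).

Let dual_1sub k z : U k z = 1 - (- sc (pole_series z)) * Qaux K N k.
Proof. by rewrite mulNr opprK. Qed.

(** For two dual factors; their scalar series kap are central and are left out. *)
Lemma rmx_cap x z w k l : k != l -> x * (w - z) = 1 ->
  rmx x k l * U k z * U l w = U l w * U k z * rmx x k l.
Proof.
move=> kl xwz; rewrite rmxE [U k z]dual_1sub [U l w]dual_1sub.
apply: yang_baxter_dual (scC _) (centralN (scC _)) (centralN (scC _)) _ _ _ _.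
- rewrite !mulrN mulNr opprK -!scalM -!scalN -scalD; congr (scal _ _ _).
  by rewrite [pole_series z * _]pole_seriesC -(pole_series_frac xwz) addrA addNr add0r.
- exact: Pphys_inv.
- exact: Qaux_braid.
- exact: Qaux_Pphys_Qaux.
Qed.

Let qmx_U x z w k l : k != l -> x * (z - w + N%:R) = 1 ->
  qmx x l k * L k z * U l w = U l w * L k z * qmx x l k.
Proof.
move=> kl e; rewrite factor_mx_eval qmxE.
apply: (@yang_baxter_mixed _ _ _ _ (sc (scst N%:R))) (scC _) (scC _) (scC _) (scC _) _ _ _ _ _.
- rewrite -!scalM -!scalD; congr (scal _ _ _).
  have xzw : scst (x * (z - w)) * (pole_series z * pole_series w)
      = scst x * pole_series z - scst x * pole_series w.
    by rewrite [scst (x * _)]scstM -mulrA -pole_series_diff mulrBr.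
  have xN : scst (x * N%:R) * (pole_series z * pole_series w)
      = scst N%:R * (scst x * pole_series z * pole_series w).
    by rewrite mulrC [scst (_ * x)]scstM -!mulrA.
  have {}e : scst (x * (z - w + N%:R)) = 1 :> series K by rewrite e.
  have := mul1r (pole_series z * pole_series w); rewrite -[X in X * _ = _]e mulrDr scstD mulrDl.
  by rewrite xzw xN => <-; rewrite addrA [X in _ = X + _]addrC subrK.
- exact: Paux_inv.
- exact: Qphys_braid.
- exact: Qaux_Paux_Qaux.
- exact: Qaux_sqr.
Qed.

(** The spectral parameter 1/x is the difference of the parameters of the two
factors, shifted by the dimension N as in the relation Q Q = N Q. *)
Lemma qmx_exchange x z w k l : k != l -> x * (z - w + N%:R) = 1 ->
  qmx x l k * L k z * D l w = D l w * L k z * qmx x l k.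
Proof.
move=> kl e; have [kw ->] := factor_mx_dual N w.
have := central_rev (@scC 1) (scC kw) (qmx_U kl e).
by rewrite scal1 !mul1r.
Qed.

Let eval_comm (X : mx) c z : X * Paux K N c = Paux K N c * X -> X * L c z = L c z * X.
Proof. by move=> XP; rewrite factor_mx_eval; apply/esym/(comm_1B (scC _))/esym. Qed.

Let dual_comm (X : mx) c z : X * Qaux K N c = Qaux K N c * X -> X * D c z = D c z * X.
Proof.
move=> XQ; have [kz ->] := factor_mx_dual N z.
rewrite mulrA -[X * sc kz]scC -!mulrA; congr (_ * _).
rewrite dual_1sub -scalN.
by apply/esym/(comm_1B (scC _))/esym.
Qed.

Lemma rmx_eval_comm x k l c z : c != k -> c != l ->
  rmx x k l * L c z = L c z * rmx x k l.
Proof.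
move=> ck cl; apply: eval_comm; rewrite rmxE; apply: comm_1B (scC _) _.
exact: Pphys_Paux.
Qed.

Lemma rmx_cap_comm x k l c z : c != k -> c != l ->
  rmx x k l * U c z = U c z * rmx x k l.
Proof.
move=> ck cl; rewrite dual_1sub -scalN; apply/esym/(comm_1B (scC _))/esym.
rewrite rmxE; apply: comm_1B (scC _) _; exact: Pphys_Qaux.
Qed.

Lemma qmx_eval_comm x l k c z : c != l -> c != k ->
  qmx x l k * L c z = L c z * qmx x l k.
Proof.
move=> cl ck; apply: eval_comm; rewrite qmxE; apply: comm_1B (scC _) _.
exact: Qphys_Paux.
Qed.

Lemma qmx_dual_comm x l k c z : c != l -> c != k ->
  qmx x l k * D c z = D c z * qmx x l k.
Proof.
move=> cl ck; apply: dual_comm; rewrite qmxE; apply: comm_1B (scC _) _.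
exact: Qphys_Qaux.
Qed.
End Exchange.

(** * Values of rational functions *)

Lemma invf_cocycle (F : fieldType) (x y z : F) :
  x - y != 0 -> x - z != 0 -> y - z != 0 ->
  (x - y)^-1 * (y - z)^-1
  = (x - y)^-1 * (x - z)^-1 + (x - z)^-1 * (y - z)^-1.
Proof. by move=> xy xz yz; field; rewrite xy xz yz. Qed.

Lemma invf_step (F : fieldType) (x y z : F) :
  x - y = 1 -> x - z != 0 -> y - z != 0 ->
  (x - z)^-1 * (y - z)^-1 = (y - z)^-1 - (x - z)^-1.
Proof.
move=> xy xz yz; have -> : (y - z)^-1 = (x - y) / (y - z) by rewrite xy mul1r.
have e : x = y + 1 by rewrite -xy addrC subrK.
by rewrite xy; rewrite e in xz *; field; rewrite xz yz.
Qed.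

Section Values.
Variables (C : fieldType) (n : nat) (v : 'I_n -> C).
Local Notation K := {fraction {mpoly C[n]}}.
Implicit Types (x : K) (y : C) (p q : {mpoly C[n]}).

(** Unlike the function frac_val, this relation is compatible with the ring
operations without any side condition, so that identities between regular
functions pass to their values. *)
Definition has_value x y := exists p q,
  [/\ q.@[v] != 0, x = tofrac p / tofrac q & y = p.@[v] / q.@[v]].

Lemma has_value_frac x y : has_value x y -> frac_val v x = y.
Proof. by case=> p [q [qv -> ->]]; exact: frac_valE. Qed.

Let tofrac_neq0 q : q.@[v] != 0 -> tofrac q != 0.
Proof. by rewrite tofrac_eq0; apply: contraNneq => ->; rewrite meval0. Qed.

Lemma value_poly p : has_value (tofrac p) p.@[v].
Proof.
by exists p, 1; rewrite meval1 oner_neq0 tofrac1 !divr1; split.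
Qed.

Lemma value0 : has_value 0 0.
Proof. by have := value_poly 0; rewrite tofrac0 meval0. Qed.

Lemma value1 : has_value 1 1.
Proof. by have := value_poly 1; rewrite tofrac1 meval1. Qed.

Lemma valueD x y x' y' : has_value x y -> has_value x' y' -> has_value (x + x') (y + y').
Proof.
case=> p [q [qv -> ->]] [p' [q' [qv' -> ->]]].
exists (p * q' + p' * q), (q * q'); rewrite mevalM mulf_neq0 //; split=> //.
  by rewrite addf_div ?tofrac_neq0 // tofracD !tofracM.
by rewrite addf_div // mevalD !mevalM.
Qed.

Lemma valueN x y : has_value x y -> has_value (- x) (- y).
Proof.
case=> p [q [qv -> ->]]; exists (- p), q; split=> //.
  by rewrite tofracN mulNr.
by rewrite mevalN mulNr.
Qed.

Lemma valueM x y x' y' : has_value x y -> has_value x' y' -> has_value (x * x') (y * y').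
Proof.
case=> p [q [qv -> ->]] [p' [q' [qv' -> ->]]].
exists (p * p'), (q * q'); rewrite mevalM mulf_neq0 //; split=> //.
  by rewrite mulf_div !tofracM.
by rewrite mulf_div !mevalM.
Qed.

Lemma value_neq0 x y : has_value x y -> y != 0 -> x != 0.
Proof.
case=> p [q [qv -> ->]]; rewrite mulf_eq0 negb_or => /andP[pv _].
by rewrite mulf_neq0 ?invr_eq0 ?tofrac_neq0.
Qed.

Lemma valueV x y : has_value x y -> y != 0 -> has_value x^-1 y^-1.
Proof.
case=> p [q [qv -> ->]]; rewrite mulf_eq0 negb_or => /andP[pv _].
by exists q, p; rewrite !invf_div; split.
Qed.

Lemma value_sum I (r : seq I) (P : pred I) (F : I -> K) (G : I -> C) :
  (forall i, has_value (F i) (G i)) ->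
  has_value (\sum_(i <- r | P i) F i) (\sum_(i <- r | P i) G i).
Proof.
move=> FG; elim/big_rec2: _ => [|i y z _ IH]; first exact: value0.
exact: valueD.
Qed.

Lemma value_bool (b : bool) : has_value b%:R b%:R.
Proof. by case: b; [exact: value1 | exact: value0]. Qed.

End Values.

Section GroupAlgebraElements.
Variables (K : comNzRingType) (n : nat).
Implicit Types (x y : K) (s t : 'S_n) (X : galg K n).

(** The order of the factors is reversed because permutations are multiplied from
left to right, and elements of the group algebra as composites of functions. *)
Lemma geltM x y s t : gelt x s * gelt y t = gelt (x * y) (t * s)%g.
Proof.
apply/ffunP => u; rewrite [LHS]ffunE (bigD1 s) //= !ffunE eqxx big1 ?addr0.
  rewrite -[(u * _)%g == _](inj_eq (mulIg s)) mulgKV.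
  by case: eqP; rewrite ?mulr0.
by move=> w /negbTE ws; rewrite ffunE ws mul0r.
Qed.

Lemma gelt1 : gelt 1 1%g = 1 :> galg K n. Proof. by []. Qed.

Lemma geltB x y s : gelt (x - y) s = gelt x s - gelt y s.
Proof. by apply/ffunP => u; rewrite !ffunE; case: eqP; rewrite ?subr0. Qed.

Lemma gelt0 s : gelt 0 s = 0 :> galg K n.
Proof. by apply/ffunP => u; rewrite !ffunE; case: eqP. Qed.

Lemma gelt_scalar_central x : central (gelt x 1%g : galg K n).
Proof.
move=> X; apply/ffunP => s; rewrite [LHS]ffunE [RHS]ffunE.
rewrite (bigD1 1%g) //= ffunE eqxx invg1 mulg1 big1 ?addr0; last first.
  by move=> w /negbTE w1; rewrite ffunE w1 mul0r.
rewrite (bigD1 s) //= ffunE mulgV eqxx big1 ?addr0 1?mulrC // => w ws.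
by rewrite ffunE -eq_mulgV1 eq_sym (negbTE ws) mulr0.
Qed.

End GroupAlgebraElements.

(** * Regularity of the products defining the elements of the group algebra *)

(** The indices k stand for the cells of a skew shape, with rows, columns and
contents c k, and x k is the content c k shifted by the variable of the column. *)
Section FusionProcedure.
Variables (C : numFieldType) (n : nat) (v : 'I_n -> C).
Local Notation K := {fraction {mpoly C[n]}}.
Variables (row col : 'I_n -> nat) (x : 'I_n -> K).
Implicit Types (a b k l m : 'I_n) (w s t : seq 'I_n).
Let c k : int := (col k)%:Z - (row k)%:Z.
Hypotheses (cell_inj : forall a b, row a = row b -> col a = col b -> a = b)
  (cell_below : forall a l, (row a < row l)%N -> (col a < col l)%N ->
     exists2 m, row m = (row a).+1 & col m = col a)
  (x_col : forall a b, col a = col b -> x a - x b = (c a - c b)%:~R)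
  (x_val : forall a b, has_value v (x a - x b) (c a - c b)%:~R)
  (x_neq : forall a b, a != b -> x a - x b != 0).

Let P a b : galg K n := gelt 1 (tperm a b).
Let u a b : galg K n := gelt (x a - x b)^-1 1%g.
Let r a b := 1 - u a b * P a b.

Definition regular (X : galg K n) := forall g : 'S_n, exists y, has_value v (X g) y.

Let reg_gelt y z (g : 'S_n) : has_value v y z -> regular (gelt y g).
Proof.
move=> yz t; rewrite ffunE; case: eqP => _; first by exists z.
by exists 0; exact: value0.
Qed.

Let reg1 : regular 1.
Proof. by apply: reg_gelt; exact: value1. Qed.

Let regB X Y : regular X -> regular Y -> regular (X - Y).
Proof.
move=> rX rY s; have [y Xy] := rX s; have [z Yz] := rY s.
by exists (y - z); rewrite !ffunE; apply: valueD => //; apply: valueN.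
Qed.

Let regM X Y : regular X -> regular Y -> regular (X * Y).
Proof.
move=> rX rY s; rewrite ffunE.
pose f g := projT1 (cid (rX g)); pose f' g := projT1 (cid (rY g)).
exists (\sum_g f g * f' (s * g^-1)%g); apply: value_sum => g.
by apply: valueM; [exact: (projT2 (cid (rX g))) | exact: (projT2 (cid (rY _)))].
Qed.

Let regP a b : regular (P a b).
Proof. by apply: reg_gelt; exact: value1. Qed.

Let uC a b : central (u a b).
Proof. exact: gelt_scalar_central. Qed.

Let PP a b : P a b * P a b = 1.
Proof. by rewrite geltM mulr1 tperm2 gelt1. Qed.

Let Pconj a b k l : P a b * P k l * P a b = P (tperm a b k) (tperm a b l).
Proof.
rewrite !geltM !mulr1; congr (gelt _ _).
by rewrite -tpermJ conjgE tpermV mulgA.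
Qed.

Let PC a b k l : a != k -> a != l -> b != k -> b != l ->
  P a b * P k l = P k l * P a b.
Proof.
move=> ak al bk bl; have := Pconj a b k l; rewrite !tpermD // => e.
by rewrite -[in RHS]e -[RHS]mulrA PP mulr1.
Qed.

Let Psym a b : P a b = P b a. Proof. by rewrite /P tpermC. Qed.

Let Pbraid a b l : a != l -> b != l -> P a l = P a b * P b l * P a b.
Proof. by move=> al bl; rewrite Pconj tpermR tpermD. Qed.

Let Pcycle a b l : a != b -> a != l -> b != l -> P a l * P b l = P a b * P a l.
Proof.
move=> ab al bl; have lb : l != b by rewrite eq_sym.
have := Pconj a l b l; rewrite tpermR tpermD // [P b a]Psym.
by move=> <-; rewrite -[RHS]mulrA PP mulr1.
Qed.

Let rYB a b l : a != b -> a != l -> b != l ->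
  r a b * r a l * r b l = r b l * r a l * r a b.
Proof.
move=> ab al bl; apply: yang_baxter; rewrite ?PP //.
- rewrite !geltM !mulg1; apply/ffunP => s; rewrite !ffunE; case: eqP => _.
    by apply: invf_cocycle; apply: x_neq.
  by rewrite addr0.
- exact: Pbraid.
- by rewrite Pconj tpermL tpermD // eq_sym.
Qed.

Let reg_r a b : c a != c b -> regular (r a b).
Proof.
move=> cab; apply: regB reg1 (regM _ (regP a b)).
apply: reg_gelt; apply: valueV (x_val a b) _.
by rewrite intr_eq0 subr_eq0.
Qed.

Let rC := one_sub_comm uC PC.

(* Standard tableaux are the linear extensions of this order of the cells. *)
Let below a b := (row a <= row b)%N && (col a <= col b)%N.
Let linear w := pairwise (fun a b => ~~ below b a) w.

Let linear_split s a t : linear (s ++ a :: t) ->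
  (forall b, b \in s -> ~~ below a b) /\ (forall b, b \in t -> ~~ below b a).
Proof.
rewrite /linear pairwise_cat allrel_consr /=.
case/and4P => /andP[/allP sa _] _ /allP h _; split=> b bs; last exact: h.
exact: sa.
Qed.

(* Exchanging two neighbours whose columns decrease makes this smaller. *)
Let Fixpoint weight w :=
  if w is a :: w' then (size w * col a + weight w')%N else 0%N.

Let weight_swap s a b t : (col b < col a)%N ->
  (weight (s ++ [:: b, a & t]) < weight (s ++ [:: a, b & t]))%N.
Proof.
move=> ba; elim: s => [|k s IH] /=; first by rewrite !mulSn; lia.
by rewrite !size_cat /= ltn_add2l.
Qed.

Let sorted_or_descent w : sorted (fun a b => (col a <= col b)%N) w \/
  exists s a b t, w = s ++ [:: a, b & t] /\ (col b < col a)%N.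
Proof.
elim: w => [|a w IH]; first by left.
case: w IH => [_|b t [srt|[s [k [l [t' [-> lk]]]]]]]; first by left.
  case: (leqP (col a) (col b)) => ab; first by left; rewrite /= ab.
  by right; exists [::], a, b, t.
by right; exists (a :: s), k, l, t'.
Qed.

(** The fusion procedure.  If two consecutive cells of w are in decreasing columns
then their contents differ by at least two and they can be exchanged, at the
cost of an invertible regular factor.  This leads to the list sorted by columns.
There, if a and l have the same content and thus r a l is singular, the element
right after a is the cell below a, and fusion_regular applies. *)
Lemma lexprod_regular w : uniq w -> (forall a, a \in w) -> linear w ->
  regular (lexprod r w).
Proof.
elim: {w}(weight w).+1 {-2}w (ltnSn (weight w)) => // N IH w wN uw allw lin.
case: (sorted_or_descent w) => [srt|[s [a [b [t [ew ba]]]]]]; last first.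
  pose w' := s ++ [:: b, a & t].
  have ww' : perm_eq w' w by rewrite ew perm_cat2l (perm_catCA [:: b] [:: a] t).
  have ab : a != b by apply: contraTneq ba => ->; rewrite ltnn.
  have {IH}reg' : regular (lexprod r w').
    apply: IH.
    - by have := weight_swap s t ba; rewrite -ew => /leq_trans; apply.
    - by rewrite (perm_uniq ww').
    - by move=> k; rewrite (perm_mem ww').
    move: lin; rewrite /linear ew !pairwise_cat !allrel_consr /=.
    case/and3P => /and3P[-> -> ->] -> /and3P[/andP[_ ->] -> ->].
    by rewrite andbT /below negb_and -!ltnNge ba orbT.
  have [_ lina] := linear_split (s := s) (a := a) (t := b :: t)
    (etrans (congr1 _ (esym ew)) lin).
  have := lina b (mem_head _ _); rewrite /below negb_and -!ltnNge.
  rewrite [(col a < _)%N]ltnNge (ltnW ba) orbF => rab.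
  have cab : c a != c b by rewrite /c; lia.
  pose y := (x a - x b)^-1; pose z : C := ((c a - c b)%:~R)^-1.
  have yz : has_value v y z by apply: valueV (x_val a b) _; rewrite intr_eq0 subr_eq0.
  (* The value of the scalar r a b * r b a is 1 - z * z, where 1/z is the
     difference of the contents. *)
  have z2 : 1 - z * z != 0.
    have d0 : (c a - c b)%:~R != 0 :> C by rewrite intr_eq0 subr_eq0.
    rewrite subr_eq0; apply/eqP => e.
    have /eqP : (c a - c b)%:~R * (c a - c b)%:~R = 1 :> C.
      by rewrite -[LHS]mulr1 [X in _ * X = _]e mulrACA divff // mulr1.
    by rewrite -intrM -[1]/(1%:~R) eqr_int /c; nia.
  have yz2 : has_value v (1 - y * y) (1 - z * z).
    by apply: valueD (value1 v) _; apply/valueN/valueM.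
  have nu : r a b * r b a = gelt (1 - y * y) 1%g.
    have -> : r b a = 1 + gelt y 1%g * P a b.
      rewrite /r Psym /u -(opprB (x a)) invrN -[- _^-1]sub0r geltB gelt0 sub0r.
      by rewrite mulNr opprK.
    by rewrite mul_1B_1D (mulr_central _ _ _ (gelt_scalar_central _)) PP mulr1 geltM mulg1 geltB.
  have e : r b a * lexprod r w = lexprod r w' * r a b.
    by rewrite ew; apply: (lexprod_swap rYB rC); rewrite -ew.
  have -> : lexprod r w = gelt (1 - y * y)^-1 1%g * (r a b * (lexprod r w' * r a b)).
    rewrite -e [r a b * _]mulrA nu mulrA geltM mulg1 mulVf ?gelt1 ?mul1r //.
    exact: value_neq0 yz2 z2.
  apply: regM; first by apply: reg_gelt; apply: valueV yz2 z2.
  by apply: regM (reg_r cab) (regM reg' (reg_r cab)).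
have srtP s a b t : w = s ++ [:: a, b & t] ->
    (col a <= col b)%N /\ forall k, k \in t -> (col b <= col k)%N.
  move=> ew; move: srt; rewrite ew sorted_pairwise; last first.
    by move=> k l m; apply: leq_trans.
  rewrite pairwise_cat /= => /and3P[_ _ /andP[/andP[ab _] /andP[/allP bt _]]].
  by split=> //.
have diag a l : a != l -> ~~ below l a -> c a = c l -> (col a <= col l)%N ->
    (row a < row l)%N /\ (col a < col l)%N.
  move=> al; rewrite /below /c => nla cal cl.
  case: (ltnP (col a) (col l)) => [|cl']; first by split=> //; lia.
  by case/eqP: al; apply: cell_inj; lia.
(* Along a list sorted by columns, a cell is followed by the cell below it
   if there is a later cell with the same content. *)
have next s a b t l : w = s ++ [:: a, b & t] -> l \in b :: t -> c a = c l ->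
    [/\ l \in t, row b = (row a).+1 & col b = col a].
  move=> ew lbt cal; have lin' := lin; rewrite ew in lin'.
  have [sa at'] := linear_split lin'.
  rewrite -cat_rcons in lin'; have [_ bt] := linear_split lin'.
  have [cab cbt] := srtP _ _ _ _ ew.
  have al : a != l.
    apply: contraTneq lbt => <-; move: uw; rewrite ew cat_uniq.
    by case/and3P => _ _ /andP[].
  have cl : (col a <= col l)%N.
    by move: lbt; rewrite inE => /predU1P[->//|/cbt]; apply: leq_trans.
  have [ral ral'] := diag _ _ al (at' _ lbt) cal cl.
  have [m rm cm] := cell_below ral ral'.
  have : m \in w := allw m; rewrite ew mem_cat inE.
  case/or3P => [/sa|/eqP ma|]; first by rewrite /below rm cm leqnn leqnSn.
    by move: rm; rewrite ma; lia.
  rewrite inE => /predU1P[mb|mt].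
    by move: lbt; rewrite -mb inE => /predU1P[lm|->//]; move: ral'; rewrite lm cm ltnn.
  have cbm := cbt _ mt.
  have := bt _ mt; have := at' b (mem_head _ _).
  by rewrite /below rm cm; lia.
apply: fusion_regular => //.
- move=> s a b t ew; apply: reg_r; apply/eqP => cab.
  have [bt _ _] := next _ _ _ _ b ew (mem_head _ _) cab.
  by move: uw; rewrite ew cat_uniq /= bt !andbF.
- move=> s a b t l ew lt.
  have [cal|cal] := eqVneq (c a) (c l); last by left; exact: reg_r.
  right; have [_ rb cb] := next _ _ _ _ l ew (predU1r _ _ lt) cal.
  have xab : x a - x b = 1 by rewrite x_col // /c rb cb (_ : _ - _ = 1) //; lia.
  have bl : c b != c l by rewrite -cal /c rb cb; lia.
  have al : a != l.
    apply: contraTneq lt => <-; move: uw; rewrite ew cat_uniq.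
    by case/and3P => _ _ /andP[]; rewrite inE negb_or => /andP[].
  have bl' : b != l by apply: contraNneq bl => ->.
  split.
  + by rewrite /u xab invr1 gelt1.
  + apply: reg_gelt; apply: valueV (x_val b l) _.
    by rewrite intr_eq0 subr_eq0.
  rewrite geltM mulg1 -geltB; congr (gelt _ _).
  by apply: invf_step xab _ _; apply: x_neq.
Qed.

End FusionProcedure.

(** * Standard tableaux *)

Section TableauOrder.
Variables (la mu : seq nat).
Hypotheses (la_part : is_partition la) (mu_part : is_partition mu).

Lemma part_decr nu i j : is_partition nu -> (i <= j)%N -> (part nu j <= part nu i)%N.
Proof.
rewrite /is_partition /part => srt ij; case: (ltnP j (size nu)) => js; last first.
  by rewrite [nth _ _ j]nth_default.
have geq_tr : transitive geq by move=> x y z /= yx zy; exact: leq_trans zy yx.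
have := sorted_leq_nth geq_tr leqnn 0%N srt; apply=> //.
by rewrite inE (leq_ltn_trans ij).
Qed.

Lemma skew_convex x y i j : in_skew la mu x -> in_skew la mu y ->
  (x.1 <= i <= y.1)%N -> (x.2 <= j <= y.2)%N -> in_skew la mu (i, j).
Proof.
move=> /andP[mx _] /andP[_ yl] /andP[xi iy] /andP[xj jy]; apply/andP; split=> /=.
  exact: leq_trans (part_decr mu_part xi) (leq_trans mx xj).
exact: leq_trans (leq_ltn_trans jy yl) (part_decr la_part iy).
Qed.

Variable Om : std_tableau la mu.
Local Notation n := (skew_size la mu).

Let mkcell p (sk : in_skew la mu p) : cell la mu :=
  exist (fun p => in_skew la mu p) p sk.

(** By convexity of the shape, a cell is joined to any cell weakly below and to
the right of it by steps inside the shape. *)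
Lemma entry_mono (x y : cell la mu) : ((val x).1 <= (val y).1)%N ->
  ((val x).2 <= (val y).2)%N -> (Om x <= Om y)%N.
Proof.
have [d] := ubnP ((val y).1 + (val y).2 - (val x).1 - (val x).2)%N.
elim: d x => // d IH x dx r1 r2.
case: (ltnP (val x).1 (val y).1) => [lt1|ge1].
  have sk : in_skew la mu ((val x).1.+1, (val x).2).
    by apply: skew_convex (valP x) (valP y) _ _; rewrite ?leqnn ?lt1 ?leqnSn.
  have /= down := @entry_down _ _ Om x (mkcell sk) erefl.
  apply: leq_trans (ltnW down) (IH _ _ _ _);
    move: dx lt1 r1 r2; rewrite /mkcell /=; lia.
case: (ltnP (val x).2 (val y).2) => [lt2|ge2].
  have sk : in_skew la mu ((val x).1, (val x).2.+1).
    by apply: skew_convex (valP x) (valP y) _ _; rewrite ?leqnn ?lt2 ?leqnSn ?r1.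
  have /= right := @entry_right _ _ Om x (mkcell sk) erefl.
  apply: leq_trans (ltnW right) (IH _ _ _ _);
    move: dx lt2 r1 r2; rewrite /mkcell /=; lia.
suff -> : x = y by [].
apply/val_inj; case: (val x) (val y) r1 r2 ge1 ge2 => [i j] [i' j'] /= *.
by congr (_, _); lia.
Qed.

Lemma tableau_cell_inj (a b : 'I_n) :
  trow Om a = trow Om b -> tcol Om a = tcol Om b -> a = b.
Proof.
rewrite /trow /tcol => e1 e2; apply: (can_inj (@boxK _ _ Om)); apply: val_inj.
by move: e1 e2; case: (val _) (val _) => [i j] [i' j'] /= -> ->.
Qed.

Lemma tableau_cell_below (a l : 'I_n) : (trow Om a < trow Om l)%N ->
  (tcol Om a < tcol Om l)%N ->
  exists2 m : 'I_n, trow Om m = (trow Om a).+1 & tcol Om m = tcol Om a.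
Proof.
move=> r1 r2; have sk : in_skew la mu ((trow Om a).+1, tcol Om a).
  by apply: skew_convex (valP (box Om a)) (valP (box Om l)) _ _;
    rewrite ?leqnn ?leqnSn ?(ltnW r2).
by exists (Om (mkcell sk)); rewrite /trow /tcol entryK.
Qed.

Lemma tableau_linear : pairwise (fun a b : 'I_n =>
  ~~ ((trow Om b <= trow Om a)%N && (tcol Om b <= tcol Om a)%N)) (enum 'I_n).
Proof.
have srt : pairwise (fun k l : 'I_n => (k < l)%N) (enum 'I_n).
  rewrite -sorted_pairwise => [|k l m]; last exact: ltn_trans.
  by have := iota_ltn_sorted 0 n; rewrite -val_enum_ord sorted_map.
apply: sub_pairwise srt => a b ab; apply/negP => /andP[r1 r2].
by have := entry_mono r1 r2; rewrite !boxK leqNgt ab.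
Qed.

Section VariableContents.
Variable C : numFieldType.
Local Notation K := {fraction {mpoly C[n]}}.
Local Notation v := (fun _ : 'I_n => 0 : C).

Lemma col_repP (k : 'I_n) : tcol Om (col_rep Om k) = tcol Om k /\
  forall l, tcol Om l = tcol Om k -> (col_rep Om k <= l)%N.
Proof.
rewrite /col_rep; case: arg_minnP => // i /eqP ik min; split=> // l /eqP.
exact: min.
Qed.

Lemma col_rep_eq (a b : 'I_n) : (col_rep Om a == col_rep Om b) = (tcol Om a == tcol Om b).
Proof.
have [ca mina] := col_repP a; have [cb minb] := col_repP b.
apply/eqP/eqP => [e|e]; first by rewrite -ca -cb e.
apply/val_inj/eqP; rewrite eqn_leq mina ?cb // minb // ca //.
Qed.

(** The generic spectral parameter of the entry k. *)
Definition var_content (k : 'I_n) : K := tofrac ((content Om k)%:~R + tvar C Om k).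

Let var_contentB a b : var_content a - var_content b =
  tofrac ((content Om a - content Om b)%:~R + tvar C Om a - tvar C Om b).
Proof.
rewrite /var_content -tofracB; congr tofrac.
by rewrite intrB opprD addrACA -[RHS]addrA.
Qed.

Let meval_par (w : 'I_n -> C) (z : int) a b :
  (z%:~R + tvar C Om a - tvar C Om b).@[w] =
  z%:~R + w (col_rep Om a) - w (col_rep Om b).
Proof. by rewrite mevalB mevalD rmorph_int !mevalXU. Qed.

Lemma var_content_val a b :
  has_value v (var_content a - var_content b) (content Om a - content Om b)%:~R.
Proof.
have := value_poly v ((content Om a - content Om b)%:~R + tvar C Om a - tvar C Om b).
by rewrite -var_contentB meval_par subr0 addr0.
Qed.

Lemma var_content_col a b : tcol Om a = tcol Om b ->
  var_content a - var_content b = (content Om a - content Om b)%:~R.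
Proof.
move=> /eqP; rewrite -col_rep_eq var_contentB /tvar => /eqP ->.
by rewrite addrK rmorph_int.
Qed.

Lemma var_content_neq a b : a != b -> var_content a - var_content b != 0.
Proof.
move=> ab; rewrite var_contentB tofrac_eq0.
have [cab|cab] := eqVneq (tcol Om a) (tcol Om b).
  have rep : col_rep Om a = col_rep Om b by apply/eqP; rewrite col_rep_eq cab.
  rewrite /tvar rep addrK; apply/eqP => /(congr1 (meval v)).
  rewrite rmorph_int meval0 => /eqP; rewrite intr_eq0 /content cab.
  move/eqP => h; case/eqP: ab; apply: tableau_cell_inj => //.
  by move: h; lia.
pose c : C := (content Om a - content Om b)%:~R.
(* Values of the variables at which the polynomial takes the value 1. *)
apply/eqP => /(congr1 (meval (fun k => (k == col_rep Om a)%:R * (1 - c)))).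
rewrite meval_par meval0 eqxx eq_sym col_rep_eq (negbTE cab) mul1r mul0r subr0.
by rewrite -/c addrC subrK => /eqP; rewrite oner_eq0.
Qed.

Lemma f_rat_lexprod : f_rat C Om =
  lexprod (fun a b => 1 - gelt (var_content a - var_content b)^-1 1%g * gelt 1 (tperm a b))
    (enum 'I_n).
Proof.
rewrite /f_rat lexprod_enum; apply: eq_lexprod => a b _ _.
by rewrite var_contentB geltM mulr1 mulg1.
Qed.

Lemma f_tab_value s : has_value v (f_rat C Om s) (f_tab C Om s).
Proof.
have := lexprod_regular tableau_cell_inj tableau_cell_below
  var_content_col var_content_val var_content_neq.
move=> /(_ (enum 'I_n) (enum_uniq _) (fun a => mem_enum _ a) tableau_linear).
rewrite -f_rat_lexprod => /(_ s) [y fy].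
by rewrite ffunE (has_value_frac fy).
Qed.

End VariableContents.
End TableauOrder.

(** * The operators of a tableau as intertwiners *)

Section Representation.
Variables (K : fieldType) (N n : nat).

(** The action of the group algebra by permutation of tensor factors. *)
Definition galg_op (X : galg K n) : 'M[K]_(tdim N n) :=
  \sum_(s : 'S_n) X s *: perm_op K N s.

Lemma galg_op_gelt x (s : 'S_n) : galg_op (gelt x s) = x *: perm_op K N s.
Proof.
rewrite /galg_op (bigD1 s) //= ffunE eqxx big1 ?addr0 // => t /negbTE ts.
by rewrite ffunE ts scale0r.
Qed.

Lemma perm_op1 : perm_op K N (1%g : 'S_n) = 1%:M.
Proof.
rewrite -[RHS]opmx1; apply: eq_opmx => i j; congr (nat_of_bool _)%:R.
apply/forallP/eqP => [e|-> k]; last by rewrite perm1.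
by apply/ffunP => k; have /eqP := e k; rewrite perm1.
Qed.

Lemma galg_op1 : galg_op 1 = 1%:M.
Proof. by rewrite -gelt1 galg_op_gelt scale1r perm_op1. Qed.

Lemma galg_opB X Y : galg_op (X - Y) = galg_op X - galg_op Y.
Proof.
by rewrite /galg_op -sumrB; apply: eq_bigr => s _; rewrite !ffunE scalerBl.
Qed.

Lemma galg_opM X Y : galg_op (X * Y) = galg_op X *m galg_op Y.
Proof.
rewrite /galg_op mulmx_suml.
transitivity (\sum_(s : 'S_n) \sum_(u : 'S_n)
    (X u * Y (s * u^-1)%g) *: perm_op K N s).
  by apply: eq_bigr => s _; rewrite ffunE scaler_suml.
rewrite exchange_big; apply: eq_bigr => u _; rewrite mulmx_sumr.
rewrite (reindex_inj (mulIg u)) /=; apply: eq_bigr => t _.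
by rewrite mulgK perm_opM -scalemxAl -scalemxAr scalerA.
Qed.

Lemma phys_galg_op_lexprod (u : 'I_n -> 'I_n -> K) s :
  phys N (galg_op (lexprod
    (fun a b => 1 - gelt (u a b) 1%g * gelt 1 (tperm a b)) s)) =
  lexprod (fun a b => rmx N (u a b) a b) s.
Proof.
elim: s => [|a s IH] /=; first by rewrite galg_op1.
rewrite galg_opM physM IH; congr (_ * _); elim: s {IH} => [|b s IH].
  by rewrite !big_nil galg_op1.
rewrite !big_cons galg_opM physM IH; congr (_ * _).
by rewrite galg_opB galg_op1 geltM mulr1 mulg1 galg_op_gelt.
Qed.

End Representation.

Section Transfer.
Variables (C : fieldType) (h N m : nat) (v : 'I_h -> C).
Local Notation K := {fraction {mpoly C[h]}}.
Local Notation mx F := 'M[series 'M[F]_(tdim N m)]_N.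

(** Identities between matrices whose entries are regular functions pass to the
values of the entries. *)
Definition mx_value (X : mx K) (Y : mx C) :=
  forall a b r i j, has_value v (X a b r i j) (Y a b r i j).

Lemma mx_valueM X X' Y Y' :
  mx_value X X' -> mx_value Y Y' -> mx_value (X * Y) (X' * Y').
Proof.
move=> XX' YY' a b r i j; rewrite !mxE !series_sum !summxE.
apply: value_sum => c; rewrite !seriesM !summxE; apply: value_sum => k.
rewrite !mxE; apply: value_sum => l; exact: valueM.
Qed.

Lemma mx_valueD X X' Y Y' :
  mx_value X X' -> mx_value Y Y' -> mx_value (X + Y) (X' + Y').
Proof.
move=> XX' YY' a b r i j; rewrite !entryD !mxE; exact: valueD.
Qed.

Lemma mx_valueN X X' : mx_value X X' -> mx_value (- X) (- X').
Proof.
move=> XX' a b r i j; rewrite !entryN !mxE; exact: valueN.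
Qed.

Lemma mx_value1 : mx_value 1 1.
Proof.
move=> a b r i j; rewrite !entry1; case: (_ && _); rewrite !mxE.
  exact: value_bool.
exact: value0.
Qed.

Lemma mx_value_prod I (s : seq I) (F : I -> mx K) (G : I -> mx C) :
  (forall i, mx_value (F i) (G i)) ->
  mx_value (\prod_(i <- s) F i) (\prod_(i <- s) G i).
Proof.
move=> FG; elim/big_rec2: _ => [|i Y Z _ IH]; first exact: mx_value1.
exact: mx_valueM.
Qed.

Lemma mx_value_rel_op b : mx_value (rel_op K b) (rel_op C b).
Proof.
move=> c d r i j; rewrite ![rel_op _ _ _ _]mxE; case: r => [|r] /=.
  by rewrite !mxE; exact: value_bool.
by rewrite !mxE; exact: value0.
Qed.

Lemma mx_value_scal (f : series K) (g : series C) :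
  (forall r, has_value v (f r) (g r)) ->
  mx_value (scal N (tdim N m) f) (scal N (tdim N m) g).
Proof.
move=> fg a b r i j; rewrite ![scal _ _ _ _ _]mxE; case: (a == b).
  by rewrite !mulr1n !mxE; case: (i == j); [rewrite !mulr1n|exact: value0].
by rewrite !mulr0n !mxE; exact: value0.
Qed.

Lemma value_pole_series z w : has_value v z w ->
  forall r, has_value v (pole_series z r) (pole_series w r).
Proof.
move=> zw [|r] /=; first exact: value0.
by elim: r => [|r IH]; [exact: value1 | rewrite !exprS; exact: valueM].
Qed.

Lemma mx_value_uniq X Y Y' : mx_value X Y -> mx_value X Y' -> Y = Y'.
Proof.
move=> XY XY'; apply/matrixP => a b; apply/funext => r; apply/matrixP => i j.
by rewrite -(has_value_frac (XY a b r i j)) (has_value_frac (XY' a b r i j)).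
Qed.

Lemma mx_value_phys (A : 'M[K]_(tdim N m)) (B : 'M[C]_(tdim N m)) :
  (forall i j, has_value v (A i j) (B i j)) ->
  mx_value (phys N A) (phys N B).
Proof.
move=> AB a b r i j; rewrite ![phys _ _ _ _]mxE; case: (a == b).
  by rewrite !mulr1n; case: r => [|r] //=; rewrite !mxE; exact: value0.
by rewrite !mulr0n !mxE; exact: value0.
Qed.

Lemma mx_value_galg_op (X : galg K m) (Y : galg C m) :
  (forall s, has_value v (X s) (Y s)) ->
  mx_value (phys N (galg_op N X)) (phys N (galg_op N Y)).
Proof.
move=> XY; apply: mx_value_phys => i j; rewrite !summxE; apply: value_sum => s.
by rewrite !mxE; apply: valueM => //; exact: value_bool.
Qed.

End Transfer.

Section TableauIntertwiners.
Variables (C : numFieldType) (N : nat) (la mu : seq nat).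
Hypotheses (la_part : is_partition la) (mu_part : is_partition mu).
Variable Om : std_tableau la mu.
Local Notation n := (skew_size la mu).
Local Notation K := {fraction {mpoly C[n]}}.
Local Notation v := (fun _ : 'I_n => 0 : C).
Local Notation L k z := (factor_mx k (ymod_eval N z)).
Local Notation D k z := (factor_mx k (ymod_dual (ymod_eval N z))).
Local Notation F := (phys N (F_op C N Om)).
Local Notation U F k z := (1 + scal N (tdim N n) (pole_series z) * Qaux F N k).
Implicit Types k l : 'I_n.

Let f_gen : galg K n := f_rat C Om.

Let F_value : mx_value v (phys N (galg_op N f_gen)) F.
Proof. by apply: mx_value_galg_op => s; exact: f_tab_value. Qed.

Let F_gen : phys N (galg_op N f_gen) =
  lexprod (fun a b => rmx N (var_content Om C a - var_content Om C b)^-1 a b) (enum 'I_n).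
Proof. by rewrite /f_gen f_rat_lexprod phys_galg_op_lexprod. Qed.

Let var_content_value k : has_value v (var_content Om C k) (content Om k)%:~R.
Proof.
have := value_poly v ((content Om k)%:~R + tvar C Om k).
by rewrite mevalD rmorph_int mevalXU addr0.
Qed.

(** For generic values of the variables F_op is the product of the R-matrices, for
which the exchange relations give the result; it is then specialized at zero. *)
Lemma F_op_eval :
  F * (\prod_(k <- rev (enum 'I_n)) L k ((content Om k)%:~R : C)) =
  (\prod_(k <- enum 'I_n) L k ((content Om k)%:~R : C)) * F.
Proof.
have L_value k : mx_value v (L k (var_content Om C k)) (L k ((content Om k)%:~R : C)).
  rewrite !factor_mx_eval; apply: mx_valueD; first exact: mx_value1.
  apply: mx_valueN; apply: mx_valueM (mx_value_rel_op _ _).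
  exact/mx_value_scal/value_pole_series.
have gen : phys N (galg_op N f_gen) * (\prod_(k <- rev (enum 'I_n)) L k (var_content Om C k))
    = (\prod_(k <- enum 'I_n) L k (var_content Om C k)) * phys N (galg_op N f_gen).
  rewrite F_gen; apply: lexprod_exchange_rev (enum_uniq _) _.
    by move=> a b c ca cb; apply: rmx_eval_comm.
  move=> a b _ _ ab; apply: rmx_eval (ab) _.
  by rewrite mulVf // var_content_neq.
apply: (@mx_value_uniq _ _ _ _ v (phys N (galg_op N f_gen)
    * \prod_(k <- rev (enum 'I_n)) L k (var_content Om C k))).
  by apply: mx_valueM => //; apply: mx_value_prod.
by rewrite gen; apply: mx_valueM => //; apply: mx_value_prod.
Qed.

(** For the dual modules the same is done with contents of opposite sign, since
rmx_cap asks for the opposite difference of the parameters. *)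
Lemma F_op_dual (M : C) :
  F * (\prod_(k <- enum 'I_n) D k (- (content Om k)%:~R - M)) =
  (\prod_(k <- rev (enum 'I_n)) D k (- (content Om k)%:~R - M)) * F.
Proof.
pose w k : C := - (content Om k)%:~R - M.
pose z k : K := - var_content Om C k - tofrac (M%:MP).
have zw k : has_value v (z k) (w k).
  apply: valueD; apply: valueN => //.
  by have := value_poly v M%:MP; rewrite mevalC.
have U_value k : mx_value v (U K k (z k)) (U C k (w k)).
  apply: mx_valueD; first exact: mx_value1.
  by apply: mx_valueM (mx_value_rel_op _ _); exact/mx_value_scal/value_pole_series.
have gen : phys N (galg_op N f_gen) * (\prod_(k <- enum 'I_n) U K k (z k))
    = (\prod_(k <- rev (enum 'I_n)) U K k (z k)) * phys N (galg_op N f_gen).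
  rewrite F_gen; apply: lexprod_exchange (enum_uniq _) _.
    by move=> a b c ca cb; apply: rmx_cap_comm.
  move=> a b _ _ ab; apply: rmx_cap (ab) _.
  rewrite /z opprB addrA subrK addrC opprK.
  by rewrite mulVf // var_content_neq.
have genU : F * (\prod_(k <- enum 'I_n) U C k (w k))
    = (\prod_(k <- rev (enum 'I_n)) U C k (w k)) * F.
  apply: (@mx_value_uniq _ _ _ _ v (phys N (galg_op N f_gen)
    * \prod_(k <- enum 'I_n) U K k (z k))).
    by apply: mx_valueM => //; apply: mx_value_prod.
  by rewrite gen; apply: mx_valueM => //; apply: mx_value_prod.
have [kap kapE] := choice (fun k => factor_mx_dual N (w k)).
have DE (s : seq 'I_n) : \prod_(k <- s) D k (w k) =
    (\prod_(k <- s) scal N (tdim N n) (kap k)) * \prod_(k <- s) U C k (w k).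
  rewrite -prod_central => [|k]; last exact: scal_central.
  by apply: eq_bigr => k _; rewrite kapE.
rewrite !DE prod_rev_central => [|k]; last exact: scal_central.
rewrite -[RHS]mulrA -genU !mulrA; congr (_ * _).
by apply: comm_prod => k _; apply/esym/scal_central.
Qed.

End TableauIntertwiners.

(** * The intertwining operator *)

Section Reversal.
Variables (K : fieldType) (N : nat).
Local Notation tdim := (tdim N).
Local Notation midx := (midx N).
Local Notation mx m := 'M[series 'M[K]_(tdim m)]_N.

(** This relation is compatible with products, so that it can be verified on the
contributions of the single tensor factors. *)
Definition intertwines m m' (S : 'M[K]_(tdim m, tdim m')) (X : mx m') (Y : mx m) :=
  forall a b r, S *m X a b r = Y a b r *m S.

Lemma intertwinesM m m' (S : 'M[K]_(tdim m, tdim m')) X X' Y Y' :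
  intertwines S X Y -> intertwines S X' Y' -> intertwines S (X * X') (Y * Y').
Proof.
move=> h h' a b r; rewrite !mxE !series_sum mulmx_sumr mulmx_suml.
apply: eq_bigr => c _; rewrite !seriesM mulmx_sumr mulmx_suml.
apply: eq_bigr => i _; rewrite [_ * _]/(_ *m _) [X in _ = X *m _]/(_ *m _).
by rewrite mulmxA h -mulmxA h' mulmxA.
Qed.

Lemma intertwines_prod m m' (S : 'M[K]_(tdim m, tdim m')) I (s : seq I) F G :
  (forall i, intertwines S (F i) (G i)) ->
  intertwines S (\prod_(i <- s) F i) (\prod_(i <- s) G i).
Proof.
move=> FG; elim/big_rec2: _ => [|i X Y _ IH]; last exact: intertwinesM.
move=> a b r; rewrite !entry1; case: (_ && _); first by rewrite mulmx1 mul1mx.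
by rewrite mulmx0 mul0mx.
Qed.

(** Stated for m = m' because the reversal is used between spaces of dimensions
nt + n and n + nt. *)
Lemma rev_place m m' (e : m = m') (k : 'I_m') A :
  rev_op K N m m' *m place k A =
  place (cast_ord (esym e) (rev_ord k)) A *m rev_op K N m m'.
Proof.
case: m' / e k => k; rewrite cast_ord_id.
pose rv (i : midx m) : midx m := [ffun l => i (rev_ord l)].
have rvK : involutive rv.
  by move=> i; apply/ffunP => x; rewrite !ffunE rev_ordK.
have -> : rev_op K N m m = opmx (fun i j => (j == rv i)%:R).
  apply: eq_opmx => i j; congr (nat_of_bool _)%:R.
  apply/forallP/eqP => [h|-> x]; last first.
    apply/forallP => y; apply/implyP => /eqP xy; rewrite ffunE.
    by apply/eqP; congr (i _); apply: val_inj; rewrite /= -[X in (X - _)%N]xy addnK.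
  apply/ffunP => y; rewrite ffunE; apply/esym/eqP.
  have /forallP/(_ y)/implyP := h (rev_ord y); apply.
  by rewrite /= subnK.
rewrite [LHS]opmxM [RHS]opmxM; apply: eq_opmx => i j.
rewrite (bigD1 (rv i)) //= eqxx mul1r big1 ?addr0 => [|h /negbTE ->]; last first.
  by rewrite mul0r.
rewrite (bigD1 (rv j)) //= rvK eqxx mulr1 big1 ?addr0 => [|h hj]; last first.
  rewrite (_ : (j == _) = false) ?mulr0 //; apply: contraNF hj => /eqP ->.
  by rewrite rvK.
have -> : [ffun=> rv i k] = [ffun=> i (rev_ord k)] :> midx 1.
  by apply/ffunP => x; rewrite !ffunE.
have -> : [ffun=> rv j (rev_ord k)] = [ffun=> j k] :> midx 1.
  by apply/ffunP => x; rewrite !ffunE rev_ordK.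
congr (_ * (nat_of_bool _)%:R); apply/offP/offP => h x xk.
  rewrite ffunE -h ?ffunE ?rev_ordK //.
  by apply: contra_neq xk => <-; rewrite rev_ordK.
rewrite ffunE h ?ffunE ?rev_ordK //.
by apply: contra_neq xk => /rev_ord_inj.
Qed.

Lemma rev_factor_mx m m' (e : m = m') (k : 'I_m') V :
  intertwines (rev_op K N m m') (factor_mx k V)
    (factor_mx (cast_ord (esym e) (rev_ord k)) V).
Proof. by move=> a b r; rewrite !mxE; exact: rev_place. Qed.

Section Blocks.
Variables m k : nat.
Let tl (A : 'M[K]_(tdim m)) := tenmx A (1%:M : 'M_(tdim k)).
Let tr (A : 'M[K]_(tdim k)) := tenmx (1%:M : 'M_(tdim m)) A.

Lemma smap_phys_l A : smap tl (phys N A) = phys N (tl A).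
Proof.
apply/matrixP => a b; rewrite !mxE; apply/funext => r.
have tl0 : tl 0 = 0 by rewrite /tl -(scale0r (0 : 'M_(tdim m))) tenmxZl scale0r.
by case: (a == b); case: r => [|r]; rewrite ?mulr1n ?mulr0n.
Qed.

Lemma smap_phys_r A : smap tr (phys N A) = phys N (tr A).
Proof.
apply/matrixP => a b; rewrite !mxE; apply/funext => r.
have tr0 : tr 0 = 0 by rewrite /tr -(scale0r (0 : 'M_(tdim k))) tenmxZr scale0r.
by case: (a == b); case: r => [|r]; rewrite ?mulr1n ?mulr0n.
Qed.

Lemma comm_blocks_l A X : phys N (tl A) * smap tr X = smap tr X * phys N (tl A).
Proof.
apply/matrixP => a b; apply/funext => r; rewrite phys_entry entry_phys mxE.
by rewrite !tenmxM !mulmx1 !mul1mx.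
Qed.

Lemma comm_blocks_r A X : phys N (tr A) * smap tl X = smap tl X * phys N (tr A).
Proof.
apply/matrixP => a b; apply/funext => r; rewrite phys_entry entry_phys mxE.
by rewrite !tenmxM !mulmx1 !mul1mx.
Qed.
End Blocks.
End Reversal.

Section Contents.

Lemma row_lt_conj nu r : is_partition nu -> (0 < part nu r)%N -> (r < conj_part nu 1)%N.
Proof.
rewrite /conj_part; elim: nu r => [|x nu IH] r; first by rewrite /part nth_nil.
move=> srt; have x0 : (0 < part (x :: nu) r)%N -> (0 < x)%N.
  by move/leq_trans; apply; exact: (part_decr srt (leq0n r)).
move=> pr; rewrite /= (x0 pr); case: r pr {x0} => [|r] // pr.
by rewrite add1n ltnS IH // /is_partition (path_sorted srt).
Qed.

(** This bounds the denominators in G_op from below. *)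
Lemma content_lower la mu (Om : std_tableau la mu) k : is_partition la ->
  (1%:Z - (conj_part la 1)%:Z <= content Om k)%R.
Proof.
move=> la_part; have /andP[_ h] := valP (box Om k).
have := row_lt_conj la_part (leq_ltn_trans (leq0n _) h).
rewrite /content /trow; lia.
Qed.

End Contents.

Section Main.
Variables (C : numFieldType) (N M : nat) (la lat mu mut : seq nat).
Hypotheses (la_part : is_partition la) (lat_part : is_partition lat)
  (mu_part : is_partition mu) (mut_part : is_partition mut)
  (la_lat : (conj_part la 1 + conj_part lat 1 <= N + M)%N).
Variables (Om : std_tableau la mu) (Omt : std_tableau lat mut).
Local Notation n := (skew_size la mu).
Local Notation nt := (skew_size lat mut).
Let c (k : 'I_n) : C := (content Om k)%:~R.
Let w (l : 'I_nt) : C := - (content Omt l)%:~R - M%:R.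
Local Notation L k z := (factor_mx k (ymod_eval N z)).
Local Notation D k z := (factor_mx k (ymod_dual (ymod_eval N z))).
Local Notation mx m := 'M[series 'M[C]_(tdim N m)]_N.

(* X k and Y l are the contributions of the ordinary and of the dual factors
   after the reversal; G_op exchanges them and puts the blocks in order. *)
Let X k : mx (nt + n) := L (rshift nt k) (c k).
Let Y l : mx (nt + n) := D (lshift n (rev_ord l)) (w l).
Let x k l : C := ((content Om k + content Omt l)%:~R + N%:R + M%:R)^-1.
Let g k l : mx (nt + n) := qmx N (x k l) (lshift n (rev_ord l)) (rshift nt k).
Let At := rev_op C N nt nt *m F_op C N Omt *m rev_op C N nt nt.

(* The denominators are at least 2, by the bound on the numbers of rows. *)
Let x_inv k l : x k l * (c k - w l + N%:R) = 1.
Proof.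
have -> : c k - w l + N%:R = (content Om k + content Omt l)%:~R + N%:R + M%:R.
  by rewrite /c /w opprD !opprK intrD addrA; exact: addrAC.
rewrite /x mulVf // -addrA -natrD pmulrn -intrD intr_eq0.
have := content_lower Om k la_part; have := content_lower Omt l lat_part.
by move: la_lat; lia.
Qed.

Let G_exchange :
  (\prod_(k <- enum 'I_n) \prod_(l <- enum 'I_nt) g k l)
    * ((\prod_(k <- enum 'I_n) X k) * \prod_(l <- rev (enum 'I_nt)) Y l)
  = (\prod_(l <- rev (enum 'I_nt)) Y l) * (\prod_(k <- enum 'I_n) X k)
    * \prod_(k <- enum 'I_n) \prod_(l <- enum 'I_nt) g k l.
Proof.
apply: grid_exchange (enum_uniq _) (enum_uniq _) => [k l k' ne|k l l' ne|k l].
- apply: qmx_eval_comm; first by rewrite eq_rlshift.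
  by rewrite (inj_eq (@rshift_inj _ _)).
- apply: qmx_dual_comm; last by rewrite eq_lrshift.
  by rewrite (inj_eq (@lshift_inj _ _)) (inj_eq rev_ord_inj).
- by apply: qmx_exchange (x_inv k l); rewrite eq_rlshift.
Qed.

Let F_exchange :
  phys N (tenmx (1%:M : 'M_(tdim N nt)) (F_op C N Om))
    * (\prod_(k <- rev (enum 'I_n)) X k)
  = (\prod_(k <- enum 'I_n) X k)
    * phys N (tenmx (1%:M : 'M_(tdim N nt)) (F_op C N Om)).
Proof.
have := congr1 (smap (fun A => tenmx (1%:M : 'M_(tdim N nt)) A))
  (F_op_eval C N la_part mu_part Om).
rewrite !smapM_r !smap_prod_r smap_phys_r.
by under eq_bigr => k _ do rewrite smap_factor_r;
   under [X in _ = X * _ -> _]eq_bigr => k _ do rewrite smap_factor_r.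
Qed.

Let Ft_exchange :
  phys N (tenmx At (1%:M : 'M_(tdim N n))) * (\prod_(l <- enum 'I_nt) Y l)
  = (\prod_(l <- rev (enum 'I_nt)) Y l)
    * phys N (tenmx At (1%:M : 'M_(tdim N n))).
Proof.
pose Z l : mx nt := D (rev_ord l) (w l).
have rZ l : intertwines (rev_op C N nt nt) (Z l) (D l (w l)).
  have := rev_factor_mx (erefl nt) (rev_ord l) (ymod_dual (ymod_eval N (w l))).
  by rewrite cast_ord_id rev_ordK.
have rZ' l : intertwines (rev_op C N nt nt) (D l (w l)) (Z l).
  by have := rev_factor_mx (erefl nt) l (ymod_dual (ymod_eval N (w l)));
     rewrite cast_ord_id.
have e : phys N At * (\prod_(l <- enum 'I_nt) Z l)
    = (\prod_(l <- rev (enum 'I_nt)) Z l) * phys N At.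
  apply/matrixP => a b; apply/funext => r; rewrite phys_entry entry_phys /At.
  have h1 := intertwines_prod (enum 'I_nt) rZ a b r.
  have h2 := intertwines_prod (rev (enum 'I_nt)) rZ' a b r.
  have := congr1 (fun T : mx nt => T a b r)
    (F_op_dual N lat_part mut_part Omt (M%:R : C)).
  rewrite phys_entry entry_phys => h3.
  by rewrite -!mulmxA h1 [F_op _ _ _ *m _]mulmxA h3 !mulmxA h2.
have := congr1 (smap (fun A => tenmx A (1%:M : 'M_(tdim N n)))) e.
rewrite !smapM_l !smap_prod_l smap_phys_l.
by under eq_bigr => l _ do rewrite smap_factor_l;
   under [X in _ = X * _ -> _]eq_bigr => l _ do rewrite smap_factor_l.
Qed.

Let F_mixed_exchange :
  phys N (F_mixed C N M Om Omt)
    * ((\prod_(k <- rev (enum 'I_n)) X k) * \prod_(l <- enum 'I_nt) Y l)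
  = (\prod_(l <- rev (enum 'I_nt)) Y l) * (\prod_(k <- enum 'I_n) X k)
    * phys N (F_mixed C N M Om Omt).
Proof.
have GE : phys N (G_op C N M Om Omt)
    = \prod_(k <- enum 'I_n) \prod_(l <- enum 'I_nt) g k l.
  rewrite -!ord_index_enum (big_morph _ (@physM N C _) (phys1 N _ _)).
  apply: eq_bigr => k _; rewrite (big_morph _ (@physM N C _) (phys1 N _ _)).
  by [].
have tE : tenmx At (F_op C N Om)
    = tenmx At (1%:M : 'M_(tdim N n)) *m tenmx (1%:M : 'M_(tdim N nt)) (F_op C N Om).
  by rewrite tenmxM mulmx1 mul1mx.
rewrite /F_mixed -/At tE !physM GE.
apply: exchange_assemble F_exchange _ _ Ft_exchange G_exchange.
  apply: comm_prod => l _.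
  by rewrite /Y -smap_factor_l; exact: comm_blocks_r.
apply: comm_prod => k _.
by rewrite /X -smap_factor_r; exact: comm_blocks_l.
Qed.

Lemma F_mixed_intertwiner :
  yintertwiner
    (ymod_tensor2 (ymod_tensor (fun k => ymod_eval N (c (rev_ord k))))
       (ymod_tensor (fun l => ymod_dual (ymod_eval N (w l)))))
    (ymod_tensor2 (ymod_tensor (fun l => ymod_dual (ymod_eval N (w (rev_ord l)))))
       (ymod_tensor (fun k => ymod_eval N (c k))))
    (F_mixed C N M Om Omt *m rev_op C N (nt + n) (n + nt)).
Proof.
apply: intertwiner_gen => r a b; rewrite !gen_mx_tensor_pair.
set T := _ * _; set W := _ * _.
have revE m (F : 'I_m -> mx (nt + n)) :
    \prod_(i < m) F (rev_ord i) = \prod_(i <- rev (enum 'I_m)) F i.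
  by rewrite rev_enum_ord big_map ord_index_enum.
have TE : intertwines (rev_op C N (nt + n) (n + nt)) T
    ((\prod_(k <- rev (enum 'I_n)) X k) * \prod_(l <- enum 'I_nt) Y l).
  rewrite -revE -ord_index_enum; apply: intertwinesM; apply: intertwines_prod => i.
    have := rev_factor_mx (addnC nt n) (lshift nt i) (ymod_eval N (c (rev_ord i))).
    congr (intertwines _ _ (factor_mx _ _)); apply: val_inj => /=.
    by have := ltn_ord i; lia.
  have := rev_factor_mx (addnC nt n) (rshift n i) (ymod_dual (ymod_eval N (w i))).
  congr (intertwines _ _ (factor_mx _ _)); apply: val_inj => /=.
  by have := ltn_ord i; lia.
have WE : W = (\prod_(l <- rev (enum 'I_nt)) Y l) * (\prod_(k <- enum 'I_n) X k).
  rewrite -revE -ord_index_enum; congr (_ * _); apply: eq_bigr => l _.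
  by rewrite /Y rev_ordK.
rewrite -mulmxA TE mulmxA -phys_entry F_mixed_exchange entry_phys -WE.
by rewrite mulmxA.
Qed.

End Main.

Theorem proposition1p4 (R : realType) (N M : nat) (N_gt0 : (0 < N)%N)
    (la lat mu mut : seq nat)
    (la_part : is_partition la) (lat_part : is_partition lat)
    (mu_part : is_partition mu) (mut_part : is_partition mut)
    (la_lat : (conj_part la 1 + conj_part lat 1 <= N + M)%N)
    (mu_mut : (conj_part mu 1 + conj_part mut 1 <= M)%N)
    (mu_la : forall i, (part mu i <= part la i)%N)
    (mut_lat : forall i, (part mut i <= part lat i)%N)
    (Om : std_tableau la mu) (Omt : std_tableau lat mut) :
  let n := skew_size la mu in
  let nt := skew_size lat mut in
  let c (k : 'I_n) : R[i] := (content Om k)%:~R in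
  let ct (l : 'I_nt) : R[i] := (content Omt l)%:~R in
  let V (z : R[i]) := ymod_eval N z in
  let Vdual (z : R[i]) := ymod_dual (ymod_eval N z) in
  yintertwiner
    (ymod_tensor2 (ymod_tensor (fun k => V (c (rev_ord k))))
                  (ymod_tensor (fun l => Vdual (- ct l - M%:R))))
    (ymod_tensor2 (ymod_tensor (fun l => Vdual (- ct (rev_ord l) - M%:R)))
                  (ymod_tensor (fun k => V (c k))))
    (F_mixed R[i] N M Om Omt *m rev_op R[i] N (nt + n) (n + nt)).
Proof.
move=> n nt c ct V Vdual.
exact (@F_mixed_intertwiner R[i] N M la lat mu mut la_part lat_part
  mu_part mut_part la_lat Om Omt).
Qed.
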